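(* Let $\Gamma = H \wr_X G$ be a finitely presented wreath product, where $H \neq 1$ and $X \neq \emptyset$, and let $\chi: \Gamma \to \mathbb{R}$ be a character. Suppose that the set $$T = \{x \in X \mid \chi|_{H_x} \neq 0\}$$ has at least two elements. Then $[\chi] \in \Sigma^2(\Gamma)$ if and only if at least one of the following conditions holds: \begin{enumerate} \item $[\chi|_{H_x}] \in \Sigma^1(H)$ for some $x \in T$; \item $\chi|_G \neq 0$; \item $T$ has at least three elements. \end{enumerate}
   Context: Wreath product: given groups $H$, $G$ and a (left) $G$-set $X$, $H \wr_X G$ is the semidirect product $M \rtimes G$, where $M = \bigoplus_{x \in X} H_x$ is the restricted direct product of copies $H_x$ of $H$ indexed by $X$, and $G$ acts by permuting the copies according to its action on $X$. The groups $M$, $H_x$, $G$ are regarded as subgroups of $H \wr_X G$, and $H_x$ is identified with $H$. If $H \wr_X G$ is finitely presented (with $H \neq 1$, $X\neq\emptyset$), then $H$ and $G$ are finitely presented. Characters: for a finitely generated group $V$, a character is a homomorphism $\chi: V \to \mathbb{R}$ to the additive group of reals. The character sphere $S(V)$ is the set of non-zero characters modulo $\chi_1 \sim \chi_2$ iff $\chi_2 = r\chi_1$ for some real $r>0$; $[\chi]$ is the class of $\chi$. Put $V_\chi = \{v \in V \mid \chi(v) \geq 0\}$. Invariant $\Sigma^1$: for a finite generating set $\mathcal{X}$ of $V$, $Cay(V;\mathcal{X})$ is the Cayley graph with vertex set $V$, where $v_1, v_2$ are joined by an edge iff $v_2 = v_1 x$ for some $x \in \mathcal{X}^{\pm 1}$.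 $Cay(V;\mathcal{X})_\chi$ is the full subgraph spanned by $V_\chi$. Then $\Sigma^1(V) = \{[\chi] \in S(V) \mid Cay(V;\mathcal{X})_\chi \text{ is connected}\}$; this does not depend on the choice of $\mathcal{X}$. Invariant $\Sigma^2$: let $V$ be finitely presented. For a finite presentation $\langle \mathcal{X} | \mathcal{R} \rangle$ of $V$, the Cayley complex $Cay(V; \langle \mathcal{X} | \mathcal{R} \rangle)$ is obtained from the Cayley graph $Cay(V;\mathcal{X})$ by gluing $2$-cells along the loops determined by the relators $r \in \mathcal{R}$ at each base point in $V$. $Cay(V; \langle \mathcal{X} | \mathcal{R} \rangle)_\chi$ is the full subcomplex spanned by $V_\chi$. Then $\Sigma^2(V) \subseteq S(V)$ is the set of classes $[\chi]$ such that $Cay(V; \langle \mathcal{X} | \mathcal{R} \rangle)_\chi$ is $1$-connected (connected and simply connected) for some finite presentation $\langle \mathcal{X} | \mathcal{R} \rangle$ of $V$. *)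

(* Defs.v *)
From HB Require Import structures.
From mathcomp Require Import all_boot all_order all_algebra.
From mathcomp Require Import finmap.
From mathcomp Require Import boolp classical_sets functions cardinality reals.

Set Implicit Arguments.
Unset Strict Implicit.
Unset Printing Implicit Defensive.

Import Order.TTheory GRing.Theory Num.Theory.

Local Open Scope classical_set_scope.
Local Open Scope group_scope.

(* Graphs in the sense of Serre: every geometric edge is given by two oriented
   edges [e] and [rev_edge e]. *)

Record graph := Graph {
  vertex : Type;
  edge : Type;
  origin : edge -> vertex;
  terminus : edge -> vertex;
  rev_edge : edge -> edge;
  rev_edgeK : involutive rev_edge;
  rev_edge_neq : forall e, rev_edge e <> e;
  origin_rev : forall e, origin (rev_edge e) = terminus e
}.

(* [edge_path A v p w]: [p] is an edge path from [v] to [w] in the full subgraph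
   spanned by the vertex set [A]; since that subgraph contains every edge with
   both ends in [A], it is enough that all the vertices of [p] are in [A]. *)
Fixpoint edge_path (K : graph) (A : set (vertex K)) (v : vertex K)
    (p : seq (edge K)) (w : vertex K) : Prop :=
  match p with
  | [::] => A v /\ v = w
  | e :: q => [/\ A v, origin e = v & edge_path A (terminus e) q w]
  end.

Definition connected_on (K : graph) (A : set (vertex K)) : Prop :=
  forall v w, A v -> A w -> exists p, edge_path A v p w.

Record complex2 := Complex2 {
  skeleton1 :> graph;
  cell : Type;
  base : cell -> vertex skeleton1;
  boundary : cell -> seq (edge skeleton1);
  boundary_closed : forall c, edge_path setT (base c) (boundary c) (base c)
}.

(* Homotopy, relative to the end points [v] and [w], of edge paths in the full
   subcomplex spanned by [A]. A 2-cell belongs to that subcomplex when its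
   vertices are all in [A], which is implied by the [edge_path] premise. *)
Inductive homotopic (K : complex2) (A : set (vertex K)) (v w : vertex K) :
    seq (edge K) -> seq (edge K) -> Prop :=
  | homotopic_refl p :
      edge_path A v p w -> homotopic A v w p p
  | homotopic_sym p q :
      homotopic A v w p q -> homotopic A v w q p
  | homotopic_trans p q r :
      homotopic A v w p q -> homotopic A v w q r -> homotopic A v w p r
  | homotopic_spur p q e :
      edge_path A v (p ++ [:: e; rev_edge e] ++ q) w ->
      homotopic A v w (p ++ [:: e; rev_edge e] ++ q) (p ++ q)
  | homotopic_face p q c :
      edge_path A v (p ++ boundary c ++ q) w ->
      homotopic A v w (p ++ boundary c ++ q) (p ++ q).

Definition simply_connected_on (K : complex2) (A : set (vertex K)) : Prop :=
  forall v p, edge_path A v p v -> homotopic A v v p [::].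

Definition one_connected_on (K : complex2) (A : set (vertex K)) : Prop :=
  connected_on A /\ simply_connected_on A.

(* [(x, true)] stands for [x] and [(x, false)] for its inverse. *)
Definition letter (V : groupType) (X : {fset V}) : Type := (X * bool)%type.
HB.instance Definition _ (V : groupType) (X : {fset V}) :=
  Choice.copy (letter X) (X * bool)%type.

Definition word (V : groupType) (X : {fset V}) : Type := seq (letter X).
HB.instance Definition _ (V : groupType) (X : {fset V}) :=
  Choice.copy (word X) (seq (letter X)).

Section Words.
Variables (V : groupType) (X : {fset V}).
Local Notation letter := (letter X).
Local Notation word := (word X).

Definition letter_inv (a : letter) : letter := (a.1, ~~ a.2).
Definition letter_val (a : letter) : V :=
  if a.2 then fsval a.1 else (fsval a.1)^-1.

Definition word_inv (w : word) : word := rev (map letter_inv w).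
Definition word_val (w : word) : V := \prod_(a <- w) letter_val a.

(* Two words are freely equal iff they represent the same element of the free
   group on [X]. *)
Inductive freely_equal : word -> word -> Prop :=
  | freely_equal_refl w : freely_equal w w
  | freely_equal_sym u w : freely_equal u w -> freely_equal w u
  | freely_equal_trans u w z :
      freely_equal u w -> freely_equal w z -> freely_equal u z
  | freely_equal_cancel u w a :
      freely_equal (u ++ [:: a; letter_inv a] ++ w) (u ++ w).

(* The words representing an element of the normal closure of [rels] in the free
   group on [X]. *)
Inductive normal_closure (rels : seq word) : word -> Prop :=
  | normal_closure_rel r : r \in rels -> normal_closure rels r
  | normal_closure_one : normal_closure rels [::]
  | normal_closure_mul u w : normal_closure rels u -> normal_closure rels w ->
      normal_closure rels (u ++ w)
  | normal_closure_inv w : normal_closure rels w ->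
      normal_closure rels (word_inv w)
  | normal_closure_conj u w : normal_closure rels w ->
      normal_closure rels (u ++ w ++ word_inv u)
  | normal_closure_free u w : freely_equal u w -> normal_closure rels u ->
      normal_closure rels w.

Definition generates : Prop := forall v : V, exists w : word, word_val w = v.

End Words.

Record finite_presentation (V : groupType) := FinitePresentation {
  gens : {fset V};
  rels : seq (word gens);
  gensP : generates gens;
  relsP : forall w : word gens, word_val w = 1 <-> normal_closure rels w
}.

Definition finitely_presented (V : groupType) : Prop :=
  inhabited (finite_presentation V).

Section Cayley.
Variables (V : groupType) (X : {fset V}).

(* The oriented edge [(v, a)] goes from [v] to [v * letter_val a]. *)
Definition cay_edge : Type := (V * letter X)%type.
Definition cay_origin (e : cay_edge) : V := e.1.
Definition cay_terminus (e : cay_edge) : V := e.1 * letter_val e.2.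
Definition cay_rev (e : cay_edge) : cay_edge :=
  (cay_terminus e, letter_inv e.2).

Lemma letter_val_inv (a : letter X) :
  letter_val (letter_inv a) = (letter_val a)^-1.
Proof. by case: a => x [] //=; rewrite /letter_val /= invgK. Qed.

Lemma cay_revK : involutive cay_rev.
Proof.
case=> v [x b]; rewrite /cay_rev /cay_terminus /= letter_val_inv mulgK.
by rewrite /letter_inv /= negbK.
Qed.

Lemma cay_rev_neq e : cay_rev e <> e.
Proof. by case: e => v [x []] []. Qed.

Definition Cay : graph :=
  @Graph V cay_edge cay_origin cay_terminus cay_rev
    cay_revK cay_rev_neq (fun=> erefl).

Fixpoint word_path (v : V) (w : word X) : seq (edge Cay) :=
  if w is a :: u then (v, a) :: word_path (v * letter_val a) u else [::].

Lemma word_pathP v w : @edge_path Cay setT v (word_path v w) (v * word_val w).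
Proof.
rewrite /word_val; elim: w v => [|a w IH] v /=; first by rewrite big_nil mulg1.
by rewrite big_cons mulgA; split=> //; apply: IH.
Qed.

End Cayley.

Section CayleyComplex.
Variables (V : groupType) (P : finite_presentation V).

Definition cay_cell : Type := (V * seq_sub (rels P))%type.
Definition cay_boundary (c : cay_cell) : seq (edge (Cay (gens P))) :=
  word_path c.1 (ssval c.2).

Lemma cay_boundary_closed c :
  @edge_path (Cay (gens P)) setT c.1 (cay_boundary c) c.1.
Proof.
case: c => v [r rR]; rewrite /cay_boundary /=; move: (word_pathP v r).
by have /relsP -> := normal_closure_rel rR; rewrite mulg1.
Qed.

Definition CayComplex : complex2 :=
  @Complex2 (Cay (gens P)) cay_cell fst cay_boundary cay_boundary_closed.

End CayleyComplex.

Record character (V : groupType) (R : realType) := Character {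
  char_fun :> V -> R;
  charM : forall u v, char_fun (u * v) = (char_fun u + char_fun v)%R
}.

Section Sigma.
Variables (V : groupType) (R : realType).
Implicit Type chi : character V R.

Definition char_nonzero chi : Prop := exists v, chi v <> 0%R.

Definition char_class chi : set (character V R) :=
  [set psi | exists2 r : R, (0 < r)%R & forall v, psi v = (r * chi v)%R].

Definition halfspace chi : set V := [set v | (0 <= chi v)%R].

(* Points of the character sphere, i.e. classes of non-zero characters. For a
   finitely generated [V], connectedness does not depend on the choice of [X]. *)
Definition Sigma1 : set (set (character V R)) :=
  [set char_class chi | chi in [set chi | char_nonzero chi /\
    exists2 X : {fset V}, generates X & @connected_on (Cay X) (halfspace chi)]].

Definition Sigma2 : set (set (character V R)) :=
  [set char_class chi | chi in [set chi | char_nonzero chi /\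
    exists P : finite_presentation V,
      @one_connected_on (CayComplex P) (halfspace chi)]].

End Sigma.

Arguments Sigma1 {V R}.
Arguments Sigma2 {V R}.

Definition restrict (K V : groupType) (R : realType)
    (f : {multiplicative K -> V}) (chi : character V R) : character K R.
Proof.
by exists (chi \o f) => u v /=; rewrite gmulfM charM.
Defined.

Record gSet (G : groupType) := GSet {
  gset_sort :> choiceType;
  gact : G -> gset_sort -> gset_sort;
  gact1 : forall x, gact 1 x = x;
  gactM : forall g h x, gact (g * h) x = gact g (gact h x)
}.

Section DirectSum.
Variables (H : groupType) (X : choiceType).

Definition dsum : Type := {fsfun X -> H with 1}.

HB.instance Definition _ := Choice.copy dsum {fsfun X -> H with 1}.

Implicit Types m n : dsum.

Definition dsum_fun (m : dsum) : X -> H := fun_of_fsfun m.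
Coercion dsum_fun : dsum >-> Funclass.

Definition dsum_one : dsum := [fsfun].
Definition dsum_inv m : dsum := [fsfun x in finsupp m => (m x)^-1 | 1].
Definition dsum_mul m n : dsum :=
  [fsfun x in (finsupp m `|` finsupp n)%fset => m x * n x | 1].
Definition dsum_single (x : X) (h : H) : dsum :=
  [fsfun y in [fset x]%fset => h | 1].

Lemma dsumP m n : (forall x, m x = n x) -> m = n.
Proof. by move=> mn; apply/fsfunP. Qed.

Lemma dsum_oneE x : dsum_one x = 1.
Proof. exact: fsfun0E. Qed.

Lemma dsum_invE m x : dsum_inv m x = (m x)^-1.
Proof.
rewrite [LHS]fsfun_fun; case: ifPn => // xm.
by rewrite /dsum_fun fsfun_dflt // invg1.
Qed.

Lemma dsum_mulE m n x : dsum_mul m n x = m x * n x.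
Proof.
rewrite [LHS]fsfun_fun inE; case: ifPn => //; rewrite negb_or => /andP[xm xn].
by rewrite /dsum_fun !fsfun_dflt // mulg1.
Qed.

Lemma dsum_singleE x h y : dsum_single x h y = if y == x then h else 1.
Proof. by rewrite [LHS]fsfun_fun inE. Qed.

Fact dsum_mulA : associative dsum_mul.
Proof. by move=> m n p; apply: dsumP => x; rewrite !dsum_mulE mulgA. Qed.
Fact dsum_mul1 : left_id dsum_one dsum_mul.
Proof. by move=> m; apply: dsumP => x; rewrite dsum_mulE dsum_oneE mul1g. Qed.
Fact dsum_mulr1 : right_id dsum_one dsum_mul.
Proof. by move=> m; apply: dsumP => x; rewrite dsum_mulE dsum_oneE mulg1. Qed.
Fact dsum_mulV : left_inverse dsum_one dsum_inv dsum_mul.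
Proof.
by move=> m; apply: dsumP => x; rewrite dsum_mulE dsum_invE dsum_oneE mulVg.
Qed.
Fact dsum_mulrV : right_inverse dsum_one dsum_inv dsum_mul.
Proof.
by move=> m; apply: dsumP => x; rewrite dsum_mulE dsum_invE dsum_oneE mulgV.
Qed.

HB.instance Definition _ := isGroup.Build dsum
  dsum_mulA dsum_mul1 dsum_mulr1 dsum_mulV dsum_mulrV.

End DirectSum.

Section Wreath.
Variables (G H : groupType) (X : gSet G).

Definition dsum_act (g : G) (m : dsum H X) : dsum H X :=
  [fsfun x in [fset gact g y | y in finsupp m]%fset => m (gact g^-1 x) | 1].

Lemma dsum_actE g m x : dsum_act g m x = m (gact g^-1 x).
Proof.
rewrite [LHS]fsfun_fun; case: ifPn => // xm.
rewrite [in RHS]/dsum_fun fsfun_dflt //.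
apply: contra xm => xm; apply/imfsetP; exists (gact g^-1 x) => //=.
by rewrite -gactM mulgV gact1.
Qed.

Lemma dsum_act1 m : dsum_act 1 m = m.
Proof. by apply: dsumP => x; rewrite dsum_actE invg1 gact1. Qed.

Lemma dsum_actA g h m : dsum_act (g * h) m = dsum_act g (dsum_act h m).
Proof. by apply: dsumP => x; rewrite !dsum_actE invgM gactM. Qed.

Lemma dsum_actM g m n : dsum_act g (m * n) = dsum_act g m * dsum_act g n.
Proof. by apply: dsumP => x; rewrite !(dsum_actE, dsum_mulE). Qed.

Lemma dsum_act_one g : dsum_act g 1 = 1.
Proof. by apply: dsumP => x; rewrite dsum_actE !dsum_oneE. Qed.

Record wreath := Wreath { wr_base : dsum H X; wr_top : G }.

Definition wr_pair (u : wreath) := (wr_base u, wr_top u).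
Definition pair_wr (u : dsum H X * G) := Wreath u.1 u.2.
Fact wr_pairK : cancel wr_pair pair_wr. Proof. by case. Qed.

HB.instance Definition _ := Choice.copy wreath (can_type wr_pairK).

Definition wr_one := Wreath 1 1.
Definition wr_mul (u v : wreath) :=
  Wreath (wr_base u * dsum_act (wr_top u) (wr_base v)) (wr_top u * wr_top v).
Definition wr_inv (u : wreath) :=
  Wreath (dsum_act (wr_top u)^-1 (wr_base u)^-1) (wr_top u)^-1.

Fact wr_mulA : associative wr_mul.
Proof.
by case=> m g [n h] [p k]; rewrite /wr_mul /= dsum_actM dsum_actA !mulgA.
Qed.
Fact wr_mul1 : left_id wr_one wr_mul.
Proof. by case=> m g; rewrite /wr_mul /= dsum_act1 !mul1g. Qed.
Fact wr_mulr1 : right_id wr_one wr_mul.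
Proof. by case=> m g; rewrite /wr_mul /= dsum_act_one !mulg1. Qed.
Fact wr_mulV : left_inverse wr_one wr_inv wr_mul.
Proof.
by case=> m g; rewrite /wr_mul /= -dsum_actM !mulVg dsum_act_one.
Qed.
Fact wr_mulrV : right_inverse wr_one wr_inv wr_mul.
Proof.
by case=> m g; rewrite /wr_mul /= -dsum_actA mulgV dsum_act1 mulgV.
Qed.

HB.instance Definition _ := isGroup.Build wreath
  wr_mulA wr_mul1 wr_mulr1 wr_mulV wr_mulrV.

Definition in_copy (x : X) (h : H) : wreath := Wreath (dsum_single x h) 1.
Definition in_top (g : G) : wreath := Wreath 1 g.

Fact in_copyM x : {morph in_copy x : h k / h * k}.
Proof.
move=> h k; congr Wreath; rewrite ?mulg1 // dsum_act1.
apply: dsumP => y; rewrite dsum_mulE !dsum_singleE.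
by case: ifP => _; rewrite ?mulg1.
Qed.
Fact in_topM : {morph in_top : g h / g * h}.
Proof. by move=> g h; congr Wreath; rewrite dsum_act_one mulg1. Qed.

HB.instance Definition _ x :=
  isMultiplicative.Build H wreath (in_copy x) (in_copyM x).
HB.instance Definition _ := isMultiplicative.Build G wreath in_top in_topM.

Variable R : realType.

Definition char_copy (chi : character wreath R) (x : X) : character H R :=
  restrict (in_copy x) chi.
Definition char_top (chi : character wreath R) : character G R :=
  restrict in_top chi.
Definition copy_support (chi : character wreath R) : set X :=
  [set x | char_nonzero (char_copy chi x)].

End Wreath.

Arguments wreath {G} H X.

(* Main.v *)
Require Import Defs.
From mathcomp Require Import all_boot all_order all_algebra.
From mathcomp Require Import finmap lra.
From mathcomp Require Import boolp classical_sets functions cardinality reals.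

(** Why the theorem holds.  Let [T] be the set of points [x] whose copy [H_x]
    has a non-zero restriction of [chi].

    Sufficiency.  A loop in the half-space [chi >= 0] bounds somewhere in the
    Cayley complex, and it bounds inside the half-space as soon as homotopies
    can be pushed upwards.  The push by an element [t] of positive height moves
    the vertex [v] to [v * t]; the edge from [v] to [v * s] then has to be
    replaced by a path from [v * t] to [v * s * t] that runs strictly above it.
    Such a path exists when [s] has a companion, an element [b] of positive
    height, commuting with [t], whose conjugate [b ^ s] has the same properties:
    climb along [b], cross with [s], come down along [b ^ s].  A relator is
    pushed along when one companion can be carried around it, because the same
    relator, translated by the companion, fills the raised loop.  This is
    [push_criterion].

    In the wreath product the companions are elements [a_f] of positive height
    in the copies [H_f], for [f] in [T], chosen equivariantly: they commute with
    each other, [G] permutes them, and [a_f] commutes with every element of the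
    base whose support misses [f].  A relator whose support misses some point of
    [T] therefore has a companion.  The words in the generators of [G], the
    words supported at one point and the commutators of two conjugates supported
    at two points define the wreath product, and all of them have companions
    except, when [T = {x, y}], the commutators of [H_x] with [H_y]
    ([presents_wreath]).  By finite presentability finitely many of them suffice
    ([presents_compact]), and adding the finitely many companions in use creates
    only relators that have companions too ([finite_pushing_system]).  The
    commutators of [H_x] with [H_y] can be pushed in each of the three cases: a
    third point of [T] provides a companion, a positive element of [G] fixing
    [x] and [y] is one ([wreath_Sigma2_companion]), and if the restriction to
    [H_x] is in [Sigma1] then the letters of [H_x] can be raised inside [H_x],
    where they still commute with [H_y] ([wreath_Sigma2_Sigma1]).

    Necessity.  If [T = {x, y}] and [chi] vanishes on [G], then the height is
    the sum of the heights of two coordinates in [H], and the half-space is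
    covered by the part where the first coordinate is not too low and the part
    where the second one is not too low.  If neither restriction is in [Sigma1],
    both coordinates live in disconnected half-spaces, and lowering these by a
    constant does not connect them ([Sigma1_gap]).  The product of the
    indicators of a component for each coordinate is locally constant where the
    two parts overlap, and its Mayer-Vietoris coboundary is a cocycle with
    values in [Z/2].  It does not vanish on the boundary of a rectangle spanned
    by paths between different components, so that this loop in the half-space
    does not bound there ([halfspace_not_simply_connected]). *)

Set Implicit Arguments.
Unset Strict Implicit.
Unset Printing Implicit Defensive.

Import Order.TTheory GRing.Theory Num.Theory.

Local Open Scope classical_set_scope.
Local Open Scope group_scope.

(** * Words as edge paths, and their homotopies *)

Section WordHomotopy.
Variable V : groupType.
Implicit Types (A Y : set V) (S : set (seq V)) (u v z : V) (p q r w : seq V).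

Fixpoint wprod w : V := if w is a :: q then a * wprod q else 1.
Definition winv w : seq V := rev [seq a^-1 | a <- w].

Lemma wprod_cat p q : wprod (p ++ q) = wprod p * wprod q.
Proof. by elim: p => [|a p IH] /=; rewrite ?mul1g // IH mulgA. Qed.

Lemma winv_cat p q : winv (p ++ q) = winv q ++ winv p.
Proof. by rewrite /winv map_cat rev_cat. Qed.

Lemma winv_cons a p : winv (a :: p) = winv p ++ [:: a^-1].
Proof. by rewrite -cat1s winv_cat. Qed.

Lemma wprod_winv p : wprod (winv p) = (wprod p)^-1.
Proof.
elim: p => [|a p IH]; first by rewrite invg1.
by rewrite winv_cons wprod_cat IH /= mulg1 invgM.
Qed.

Lemma winvK : involutive winv.
Proof.
move=> p; rewrite /winv map_rev revK -map_comp -[RHS]map_id.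
by apply: eq_map => a /=; rewrite invgK.
Qed.

(** A word is a list of group elements, so that the alphabet [Y] can be enlarged
    without changing the type of words; reading [w] from [v] traces an edge path
    of the Cayley graph. *)
Fixpoint walk A Y v w : Prop :=
  if w is a :: q then [/\ A v, Y a & walk A Y (v * a) q] else A v.

Lemma walk_start A Y v w : walk A Y v w -> A v.
Proof. by case: w => [|a w] // []. Qed.

Lemma walk_cat A Y v p q :
  walk A Y v (p ++ q) <-> walk A Y v p /\ walk A Y (v * wprod p) q.
Proof.
elim: p v => [|a p IH] v /=.
  by rewrite mulg1; split=> [h|[]//]; split=> //; apply: walk_start h.
rewrite mulgA; split=> [[Av Ya /IH[]]|[[Av Ya ?] ?]] //.
by split=> //; apply/IH.
Qed.

Lemma walk_end A Y v w : walk A Y v w -> A (v * wprod w).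
Proof. by rewrite -{1}[w]cats0 => /walk_cat[]. Qed.

Lemma walk_sub A A' Y Y' v w :
  A `<=` A' -> Y `<=` Y' -> walk A Y v w -> walk A' Y' v w.
Proof.
move=> sA sY; elim: w v => [|a w IH] v /=; first exact: sA.
by case=> /sA Av /sY Ya /IH.
Qed.

Lemma walk_translate A A' Y g v w :
  (forall z, A z -> A' (g * z)) -> walk A Y v w -> walk A' Y (g * v) w.
Proof.
move=> sA; elim: w v => [|a w IH] v /=; first exact: sA.
by case=> /sA Av Ya /IH; rewrite mulgA.
Qed.

Lemma walk_setT Y v w : walk setT Y v w <-> (forall a, a \in w -> Y a).
Proof.
elim: w v => [|a w IH] v /=; first by split.
split=> [[_ Ya /IH h] b|h]; first by rewrite inE => /orP[/eqP->|/h].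
split=> //; first by apply: h; rewrite mem_head.
by apply/IH => b bw; apply: h; rewrite inE bw orbT.
Qed.

Definition sym_letters Y := forall a, Y a -> Y a^-1.

Lemma walk_winv A Y v w :
  sym_letters Y -> walk A Y v w -> walk A Y (v * wprod w) (winv w).
Proof.
move=> symY; elim: w v => [|a w IH] v /=; first by rewrite mulg1.
case=> Av Ya hw; have h := IH _ hw; rewrite winv_cons; apply/walk_cat; split.
  by rewrite mulgA.
rewrite wprod_winv mulgA mulgK /= mulgK; split=> //; last exact: symY.
exact: walk_start hw.
Qed.

(** Homotopy, inside the vertex set [A], of the edge paths traced from [v], in the
    Cayley complex with generators [Y] and relators [S]. *)
Inductive htpy A Y S v : seq V -> seq V -> Prop :=
  | htpy_refl w : walk A Y v w -> htpy A Y S v w w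
  | htpy_sym p q : htpy A Y S v p q -> htpy A Y S v q p
  | htpy_trans q p r : htpy A Y S v p q -> htpy A Y S v q r -> htpy A Y S v p r
  | htpy_spur p q a :
      walk A Y v (p ++ [:: a; a^-1] ++ q) ->
      htpy A Y S v (p ++ [:: a; a^-1] ++ q) (p ++ q)
  | htpy_face p q r : S r ->
      walk A Y v (p ++ r ++ q) -> htpy A Y S v (p ++ r ++ q) (p ++ q).

Definition true_words S := forall r, S r -> wprod r = 1.

Lemma htpy_walk A Y S v p q : true_words S -> htpy A Y S v p q ->
  [/\ walk A Y v p, walk A Y v q & wprod p = wprod q].
Proof.
move=> trueS; elim=> {p q} [w hw|p q _ [? ? ->]|q p r _ [? _ ->] _ []|p q a|p q r Sr] //.
- move=> h; split=> //; last by rewrite !wprod_cat /= mulg1 mulgV mul1g.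
  move/walk_cat: h => [hp /=[_ _ [_ _]]]; rewrite mulgK => hq.
  by apply/walk_cat.
move=> h; split=> //; last by rewrite !wprod_cat (trueS _ Sr) mul1g.
move/walk_cat: h => [hp /walk_cat[_]]; rewrite (trueS _ Sr) mulg1 => hq.
by apply/walk_cat.
Qed.

Lemma htpy_sub A A' Y Y' S S' v p q : A `<=` A' -> Y `<=` Y' -> S `<=` S' ->
  htpy A Y S v p q -> htpy A' Y' S' v p q.
Proof.
move=> sA sY sS; elim=> {p q}.
- by move=> w /(walk_sub sA sY); apply: htpy_refl.
- by move=> p q _; apply: htpy_sym.
- by move=> q p r _ pq _; apply: htpy_trans.
- by move=> p q a /(walk_sub sA sY); apply: htpy_spur.
by move=> p q r /sS Sr /(walk_sub sA sY); apply: htpy_face.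
Qed.

Lemma htpy_translate A A' Y S g v p q : (forall z, A z -> A' (g * z)) ->
  htpy A Y S v p q -> htpy A' Y S (g * v) p q.
Proof.
move=> sA; elim=> {p q}.
- by move=> w /(walk_translate sA); apply: htpy_refl.
- by move=> p q _; apply: htpy_sym.
- by move=> q p r _ pq _; apply: htpy_trans.
- by move=> p q a /(walk_translate sA); apply: htpy_spur.
by move=> p q r Sr /(walk_translate sA); apply: htpy_face.
Qed.

(** The group acts on the whole complex by left translations, so that the base
    point is irrelevant there. *)
Lemma htpy_move Y S v v' p q : htpy setT Y S v p q -> htpy setT Y S v' p q.
Proof.
by move=> h; rewrite -(mulgVK v v'); apply: htpy_translate h.
Qed.

Lemma htpy_catl A Y S v w p q : walk A Y v w ->
  htpy A Y S (v * wprod w) p q -> htpy A Y S v (w ++ p) (w ++ q).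
Proof.
move=> hw; elim=> {p q}.
- by move=> p hp; apply: htpy_refl; apply/walk_cat.
- by move=> p q _; apply: htpy_sym.
- by move=> q p r _ pq _; apply: htpy_trans.
- by move=> p q a h; rewrite !catA -(catA _ [:: a; a^-1]); apply: htpy_spur;
    rewrite -catA; apply/walk_cat.
by move=> p q r Sr h; rewrite !catA -(catA _ r); apply: htpy_face => //;
    rewrite -catA; apply/walk_cat.
Qed.

Lemma htpy_catr A Y S v w p q : true_words S -> walk A Y (v * wprod p) w ->
  htpy A Y S v p q -> htpy A Y S v (p ++ w) (q ++ w).
Proof.
move=> trueS + h; elim: h => {p q}.
- by move=> p hp hw; apply: htpy_refl; apply/walk_cat.
- move=> p q pq IH hw; apply: htpy_sym; apply: IH.
  by case: (htpy_walk trueS pq) => _ _ ->.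
- move=> q p r pq IH1 qr IH2 hw; apply: htpy_trans (IH1 hw) (IH2 _).
  by case: (htpy_walk trueS pq) => _ _ <-.
- by move=> p q a h hw; rewrite -!catA; apply: htpy_spur;
    rewrite 2!catA; apply/walk_cat; rewrite -catA.
by move=> p q r Sr h hw; rewrite -!catA; apply: htpy_face => //;
    rewrite 2!catA; apply/walk_cat; rewrite -catA.
Qed.

Section TrueRelators.
Variables (A Y : set V) (S : set (seq V)).
Hypotheses (trueS : true_words S) (symY : sym_letters Y).

Lemma htpy_cat v p p' q q' : htpy A Y S v p p' ->
  htpy A Y S (v * wprod p) q q' -> htpy A Y S v (p ++ q) (p' ++ q').
Proof.
move=> hp hq; case: (htpy_walk trueS hp) => wp wp' e.
case: (htpy_walk trueS hq) => wq wq' _.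
apply: htpy_trans (htpy_catr trueS wq hp) _.
by apply: htpy_catl => //; rewrite -e.
Qed.

Lemma htpy_mid v w w' p q : walk A Y v (w ++ p ++ w') ->
  htpy A Y S (v * wprod w) p q -> htpy A Y S v (w ++ p ++ w') (w ++ q ++ w').
Proof.
move=> /walk_cat[hw /walk_cat[hp hw']] h; apply: htpy_catl => //.
exact: htpy_catr.
Qed.

Lemma htpy_mulV v w : walk A Y v w -> htpy A Y S v (w ++ winv w) [::].
Proof.
elim: w v => [|a w IH] v /=; first by move=> Av; apply: htpy_refl.
move=> [Av Ya hw]; rewrite winv_cons catA -cat1s.
have ha : walk A Y v ([::] ++ [:: a; a^-1] ++ [::]).
  by split=> //; split; [apply: walk_start hw | apply: symY | rewrite mulgK].
apply: htpy_trans (htpy_spur _ ha).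
apply: (@htpy_mid v [:: a] [:: a^-1] (w ++ winv w) [::]) => /=; last first.
  by rewrite mulg1; apply: IH.
split=> //; apply/walk_cat; split.
  by apply/walk_cat; split=> //; apply: walk_winv.
rewrite wprod_cat wprod_winv mulgV mulg1 /= mulgK; split=> //; last exact: symY.
exact: walk_start hw.
Qed.

Lemma htpy_Vmul v w : walk A Y v (winv w) -> htpy A Y S v (winv w ++ w) [::].
Proof. by move=> h; have := htpy_mulV h; rewrite winvK. Qed.

(** Insert [q ++ winv q] after [winv p], then contract [winv p ++ p]. *)
Lemma htpy_winv v p q : htpy A Y S v p q ->
  htpy A Y S (v * wprod p) (winv p) (winv q).
Proof.
move=> h; case: (htpy_walk trueS h) => wp wq e.
have wp' := walk_winv symY wp; have wq' := walk_winv symY wq.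
have e1 : v * wprod p * wprod (winv p) = v by rewrite wprod_winv mulgK.
apply: (@htpy_trans _ _ _ _ (winv p ++ q ++ winv q)).
  apply: htpy_sym; rewrite -[X in htpy _ _ _ _ _ X]cats0.
  by apply: htpy_catl => //; rewrite e1; apply: htpy_mulV.
rewrite catA -[X in htpy _ _ _ _ _ X]cat0s.
apply: htpy_catr => //.
  by rewrite wprod_cat wprod_winv e mulVg mulg1.
apply: htpy_trans (htpy_Vmul wp'); apply: htpy_catl => //.
by rewrite e1; apply: htpy_sym.
Qed.

Lemma htpy_of_null v p q : walk A Y v p -> walk A Y v q ->
  wprod p = wprod q -> htpy A Y S v (p ++ winv q) [::] -> htpy A Y S v p q.
Proof.
move=> wp wq e h; apply: (@htpy_trans _ _ _ _ (p ++ winv q ++ q)).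
  apply: htpy_sym; rewrite -[X in htpy _ _ _ _ _ X]cats0.
  apply: htpy_catl => //; apply: htpy_Vmul.
  by rewrite e; apply: walk_winv.
rewrite catA -[X in htpy _ _ _ _ _ X]cat0s; apply: htpy_catr => //.
by rewrite wprod_cat wprod_winv e mulgV mulg1.
Qed.

(** Relators of the form [p ++ winv q] are used as rewriting rules; the detour
    [p ++ winv q ++ q] stays on the two paths, so that nothing else has to lie in
    [A]. *)
Lemma htpy_rel v p q : S (p ++ winv q) ->
  walk A Y v p -> walk A Y v q -> htpy A Y S v p q.
Proof.
move=> Spq wp wq; have e : wprod p = wprod q.
  by apply: divg1_eq; rewrite -wprod_winv -wprod_cat; apply: trueS.
apply: htpy_of_null => //.
rewrite -[X in htpy _ _ _ _ X _]cats0 -[X in htpy _ _ _ _ X _]cat0s.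
apply: htpy_face => //=; rewrite cats0; apply/walk_cat; split=> //.
by rewrite e; apply: walk_winv.
Qed.

End TrueRelators.
End WordHomotopy.

(** * Heights and companions *)

Section CharacterTheory.
Variables (V : groupType) (R : realType) (chi : character V R).

Lemma char1 : chi 1 = 0%R.
Proof. by apply: (@addrI _ (chi 1)); rewrite -charM mulg1 addr0. Qed.

Lemma charV v : chi v^-1 = (- chi v)%R.
Proof. by apply/eqP; rewrite -addr_eq0 -charM mulVg char1. Qed.

Lemma charJ u v : chi (u ^ v) = chi u.
Proof. by rewrite /conjg !charM charV; lra. Qed.

Definition charE := (charJ, @charM _ _ chi, charV).

Definition above (c : R) : set V := [set v | (c <= chi v)%R].

Lemma above_sub c d : (c <= d)%R -> above d `<=` above c.
Proof. by move=> cd v; apply: le_trans. Qed.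

(** Right multiplication is not an action on the Cayley graph, but it shifts all
    heights along a word by the same amount. *)
Lemma walk_above (Y : set V) c c' v v' w : (c' - c <= chi v' - chi v)%R ->
  walk (above c) Y v w -> walk (above c') Y v' w.
Proof.
rewrite /above; elim: w v v' => [|a w IH] v v' /= le; first by lra.
by case=> ? Ya hw; split=> //; [lra | apply: (IH (v * a)); rewrite ?charM //; lra].
Qed.

End CharacterTheory.

Section Companions.
Variable V : groupType.
Implicit Types (B : set V) (b : V) (p q w : seq V).

(** [b] can be carried along [w]: for every prefix [q] of [w] the element
    [b ^ wprod q], which leads from the vertex [wprod q] to the translate by [b]
    of the path, is in the reservoir [B]. *)
Fixpoint companion B b w : Prop :=
  B b /\ (if w is a :: q then companion B (b ^ a) q else True).

Lemma companion_start B b w : companion B b w -> B b.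
Proof. by case: w => [|a w] []. Qed.

Lemma companion_cat B b p q :
  companion B b (p ++ q) <-> companion B b p /\ companion B (b ^ wprod p) q.
Proof.
elim: p b => [|a p IH] b /=.
  by rewrite conjg1; split=> [h|[]//]; split=> //; split=> //;
    apply: companion_start h.
rewrite conjgM; split=> [[Bb /IH[]]|[[Bb ?] ?]] //.
by split=> //; apply/IH.
Qed.

Lemma companion_end B b w : companion B b w -> B (b ^ wprod w).
Proof. by rewrite -{1}[w]cats0 => /companion_cat[_ []]. Qed.

End Companions.

(** * Pushing homotopies upwards *)

(** [B] is the reservoir of companions: commuting letters of height at least
    [eps].  The squares that exchange a companion with a letter are relators. *)
Section Push.
Variables (V : groupType) (R : realType) (chi : character V R).
Variables (B Y : set V) (S : set (seq V)) (t : V) (eps : R).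
Hypotheses (trueS : true_words S) (symY : sym_letters Y).
Hypotheses (BY : B `<=` Y) (Bcomm : forall b d, B b -> B d -> commute b d).
Hypotheses (eps_gt0 : (0 < eps)%R) (B_eps : forall b, B b -> (eps <= chi b)%R).
Hypothesis squareS : forall b s, B b -> Y s -> B (b ^ s) ->
  S [:: b; s; (b ^ s)^-1; s^-1].
Hypothesis Bt : B t.

Local Notation above := (above chi).

Lemma commute_conj (b d : V) : commute b d -> b ^ d = b.
Proof. by move=> bd; rewrite conjgE bd mulKg. Qed.

Lemma B_pos b : B b -> (0 < eps)%R /\ (eps <= chi b)%R.
Proof. by move/B_eps. Qed.

(** The square has its vertices [v], [v * s] and these two moved up by a
    companion. *)
Lemma square_htpy c v b s : B b -> Y s -> B (b ^ s) -> above c v ->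
  above c (v * s) -> htpy (above c) Y S v [:: b; s] [:: s; b ^ s].
Proof.
move=> Bb Ys Bbs hv hvs; have [e0 eb] := B_pos Bb; move: hv hvs.
rewrite /above /= !charE => hv hvs.
apply: (htpy_rel trueS symY); first exact: squareS.
  split; [done|exact: BY|split; [|done|]]; rewrite /above /= !charE; lra.
split; [done|done|split; [|exact: BY|]]; rewrite /above /= !charE; lra.
Qed.

(** The ladder between [w] and its translate by [b]; its rungs are the conjugates
    of [b], which only increase heights. *)
Lemma companion_htpy c v b w : companion B b w -> walk (above c) Y v w ->
  htpy (above c) Y S v (b :: w) (w ++ [:: b ^ wprod w]).
Proof.
elim: w v b => [|a w IH] v b /= [Bb].
  move=> _ hv; rewrite conjg1; apply: htpy_refl; have [? ?] := B_pos Bb.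
  by split; [|exact: BY|move: hv; rewrite /above /= !charE; lra].
move=> Bw [hv Ya hw]; have Bba := companion_start Bw; rewrite conjgM.
apply: (@htpy_trans _ _ _ _ _ ([:: a; b ^ a] ++ w)).
  apply: (@htpy_catr _ _ _ _ _ w [:: b; a] [:: a; b ^ a]) => //=; last first.
    by apply: square_htpy => //; apply: walk_start hw.
  apply: walk_above hw; rewrite mulg1 !charE; have [] := B_pos Bb; lra.
rewrite -cat1s -!catA; apply: htpy_catl; first by split=> //; apply: walk_start hw.
by rewrite /= mulg1; apply: IH.
Qed.

Lemma companion_conj_htpy c v b w : companion B b w -> walk (above c) Y v w ->
  htpy (above c) Y S v w (b :: w ++ [:: (b ^ wprod w)^-1]).
Proof.
move=> Bw hw; have Be := companion_end Bw; have hd := walk_end hw.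
apply: (@htpy_trans _ _ _ _ _ (w ++ [:: b ^ wprod w; (b ^ wprod w)^-1])).
  rewrite -[X in htpy _ _ _ _ X _]cats0; apply: htpy_catl => //.
  apply: htpy_sym; apply: (@htpy_spur _ _ _ _ _ [::] [::]) => /=; rewrite mulgK.
  split; [done|exact: BY|split; [|exact/symY/BY|done]].
  by move: hd; have [] := B_pos Be; rewrite /above /= !charE ; lra.
rewrite -[[:: _; _]]cat1s -cat_cons !catA; apply: htpy_catr => //; last first.
  by apply: htpy_sym; apply: companion_htpy.
rewrite wprod_cat /= mulg1 mulgA mulgK; split; [|exact/symY/BY|done].
by move: hd; have [] := B_pos Be; rewrite /above /= !charE ; lra.
Qed.

Variable b_ : V -> V.
Hypotheses (b_B : forall s, Y s -> B (b_ s)).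
Hypotheses (b_conj : forall s, Y s -> B (b_ s ^ s)).

(** Read from [v * t], the image under the push of the edge from [v] to [v * s]:
    the vertices [v * t * b], [v * b], [v * b * s = v * s * b ^ s],
    [v * s * b ^ s * t] and [v * s * t] are all higher than the edge. *)
Definition detour b s : seq V := [:: b; t^-1; s; t; (b ^ s)^-1].
Definition push w : seq V := flatten [seq detour (b_ s) s | s <- w].

Lemma wprod_detour b s : commute b t -> commute (b ^ s) t ->
  wprod (detour b s) = s ^ t.
Proof.
move=> bt bst; have e1 : t * (b ^ s)^-1 = (b ^ s)^-1 * t := commuteV (commute_sym bst).
have e2 : b * t^-1 = t^-1 * b := commuteV bt.
rewrite /= mulg1 e1 mulgA e2 -mulgA (conjgE s t); congr (t^-1 * _).
by rewrite mulgA (conjgC b s) -mulgA (mulVKg (b ^ s)).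
Qed.

Lemma conjB b d : B b -> B d -> b ^ d = b.
Proof. by move=> Bb Bd; apply: commute_conj; apply: Bcomm. Qed.

Lemma conjBV b d : B b -> B d -> b ^ d^-1 = b.
Proof. by move=> Bb Bd; apply: commute_conj; apply: commuteV; apply: Bcomm. Qed.

Lemma wprod_detourB b s : B b -> B (b ^ s) -> wprod (detour b s) = s ^ t.
Proof. by move=> Bb Bbs; apply: wprod_detour; apply: Bcomm. Qed.

Lemma companion_detour d b s : B d -> B (d ^ s) -> B b -> B (b ^ s) ->
  companion B d (detour b s).
Proof.
move=> Bd Bds Bb Bbs /=.
by rewrite (conjB Bd Bb) (conjBV Bd Bt) (conjB Bds Bt) conjBV.
Qed.

Lemma conj_detour d b s : B d -> B (d ^ s) -> B b -> B (b ^ s) ->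
  d ^ wprod (detour b s) = d ^ s.
Proof.
move=> Bd Bds Bb Bbs /=; rewrite mulg1 !conjgM.
by rewrite (conjB Bd Bb) (conjBV Bd Bt) (conjB Bds Bt) conjBV.
Qed.

Lemma detour_walk c v b s : B b -> B (b ^ s) -> Y s -> above c v ->
  above c (v * s) -> walk (above (c + eps)) Y (v * t) (detour b s).
Proof.
move=> Bb Bbs Ys; rewrite /above /= !charE => hv hvs.
have [e0 tpos] := B_pos Bt; have [_ bpos] := B_pos Bb.
split; [lra|exact: BY|split; [lra|exact/symY/BY|split; [lra|done|]]].
split; [lra|exact: BY|split; [lra|exact/symY/BY|lra]].
Qed.

(** The push of an edge does not depend on the companion: conjugate the detour of
    [b] by [d], and remove [b] from the middle. *)
Lemma detour_htpy c v b d s : B b -> B (b ^ s) -> B d -> B (d ^ s) -> Y s ->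
  above c v -> above c (v * s) ->
  htpy (above (c + eps)) Y S (v * t) (detour b s) (detour d s).
Proof.
move=> Bb Bbs Bd Bds Ys hv hvs; have hw := detour_walk Bb Bbs Ys hv hvs.
have := companion_conj_htpy (companion_detour Bd Bds Bb Bbs) hw.
rewrite conj_detour // => h; apply: htpy_trans h _.
have [e0 tpos] := B_pos Bt; have [_ bpos] := B_pos Bb.
have [_ dpos] := B_pos Bd; have hw' := detour_walk Bd Bds Ys hv hvs.
have hm : walk (above (c + eps)) Y (v * t * d) [:: t^-1; s; t].
  by case: hw' => _ _ [? ? [? ? [? ? [? _ _]]]].
have cm : companion B b [:: t^-1; s; t].
  rewrite /= (conjBV Bb Bt) (conjB Bbs Bt); by do !split.
have := companion_conj_htpy cm hm.
have -> : b ^ wprod [:: t^-1; s; t] = b ^ s.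
  by rewrite /= mulg1 !conjgM (conjBV Bb Bt) (conjB Bbs Bt).
move=> hm'; rewrite -[detour d s]/([:: d] ++ [:: t^-1; s; t] ++ [:: (d ^ s)^-1]).
apply: htpy_sym; apply: htpy_mid => //=; first by rewrite mulg1.
Qed.

Lemma mulJ (v u s : V) : v * u * s ^ u = v * s * u.
Proof. by rewrite -mulgA -conjgC mulgA. Qed.

Lemma push_cons s w : push (s :: w) = detour (b_ s) s ++ push w.
Proof. by []. Qed.

Lemma push_cat p q : push (p ++ q) = push p ++ push q.
Proof. by rewrite /push map_cat flatten_cat. Qed.

Lemma push_walk c v w : walk (above c) Y v w ->
  walk (above (c + eps)) Y (v * t) (push w) /\ wprod (push w) = wprod w ^ t.
Proof.
elim: w v => [|s w IH] v.
  have [e0 tpos] := B_pos Bt.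
  by rewrite /= conj1g /above /= !charE => ?; split=> //; lra.
move=> [hv Ys hw]; have [Bb Bbs] := (b_B Ys, b_conj Ys).
have [IH1 IH2] := IH _ hw; rewrite push_cons wprod_cat IH2 wprod_detourB //.
split; last by rewrite /= conjMg.
apply/walk_cat; split; first by apply: detour_walk => //; apply: walk_start hw.
by rewrite wprod_detourB // mulJ.
Qed.

Lemma htpy_cancel A v p q q' a : htpy A Y S v p (q ++ [:: a; a^-1] ++ q') ->
  htpy A Y S v p (q ++ q').
Proof.
move=> h; apply: (htpy_trans h); apply: htpy_spur.
by case: (htpy_walk trueS h).
Qed.

(** Pushing a word along one companion, the climbs and descents between
    consecutive letters cancel. *)
Lemma push_companion c v b r : companion B b r -> walk (above c) Y v r ->
  htpy (above (c + eps)) Y S (v * t) (push r)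
    ([:: b; t^-1] ++ r ++ [:: t; (b ^ wprod r)^-1]).
Proof.
have [e0 tpos] := B_pos Bt.
elim: r v b => [|s r IH] v b [Bb].
  move=> _ hv; rewrite /= conjg1; apply: htpy_sym.
  have := @htpy_mulV _ (above (c + eps)) Y S trueS symY (v * t) [:: b; t^-1].
  rewrite /winv /= invgK; apply; have [_ bpos] := B_pos Bb.
  move: hv; rewrite /above /= !charE => hv.
  split; [lra|exact: BY|split; [lra|exact/symY/BY|lra]].
move=> Br [hv Ys hw]; have Bbs := companion_start Br.
have hvs := walk_start hw; rewrite push_cons [wprod _]/= conjgM.
pose q' := r ++ [:: t; ((b ^ s) ^ wprod r)^-1].
suff h : htpy (above (c + eps)) Y S (v * t) (detour (b_ s) s ++ push r)
    ([:: b; t^-1; s; t] ++ [:: (b ^ s)^-1; (b ^ s)^-1^-1] ++ [:: t^-1] ++ q').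
  exact: (@htpy_cancel _ _ _ [:: b; t^-1; s] q' t (htpy_cancel h)).
rewrite invgK; change (htpy (above (c + eps)) Y S (v * t)
  (detour (b_ s) s ++ push r) (detour b s ++ ([:: b ^ s; t^-1] ++ q'))).
apply: htpy_cat => //.
  by apply: detour_htpy => //; [apply: b_B | apply: b_conj].
rewrite wprod_detourB; [|exact: b_B|exact: b_conj].
by rewrite mulJ; apply: IH.
Qed.

(** The ladder with rungs [t] between a path and its push does not go below the
    path, so that both are freely homotopic in the half-space. *)
Lemma push_near c v w : walk (above c) Y v w ->
  htpy (above c) Y S v w ([:: t] ++ push w ++ [:: t^-1]).
Proof.
have [e0 tpos] := B_pos Bt.
elim: w v => [|s w IH] v.
  move=> hv; apply: htpy_sym; apply: (@htpy_spur _ _ _ _ _ [::] [::]).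
  by split=> //=; [exact: BY | rewrite mulgK; split=> //;
    [move: hv; rewrite /above /= !charE; lra | exact/symY/BY]].
move=> [hv Ys hw]; have hvs := walk_start hw.
have [Bb Bbs] := (b_B Ys, b_conj Ys); have [_ bpos] := B_pos Bb.
rewrite push_cons; set b := b_ s in Bb Bbs bpos *.
have hs : walk (above c) Y v [:: s] by split.
have cs : companion B b [:: s] by do !split.
have h1 := companion_conj_htpy cs hs; rewrite /= mulg1 in h1.
have hb : walk (above c) Y v [:: b].
  split; [done|exact: BY|move: hv; rewrite /above /= !charE; lra].
have ctb : companion B t [:: b] by rewrite /= (conjB Bt Bb); do !split.
have h2 := companion_conj_htpy ctb hb; rewrite /= mulg1 (conjB Bt Bb) in h2.
have ctb' : companion B t [:: (b ^ s)^-1].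
  by rewrite /= (conjBV Bt Bbs); do !split.
have hb' : walk (above c) Y (v * b * s) [:: (b ^ s)^-1].
  split; [|exact/symY/BY|]; move: hv hvs; rewrite /above /= !charE; lra.
have h3 := companion_htpy ctb' hb'; rewrite /= mulg1 (conjBV Bt Bbs) in h3.
have h4 : htpy (above c) Y S v [:: s; t] ([:: t] ++ detour b s).
  apply: (@htpy_trans _ _ _ _ _ [:: b; s; (b ^ s)^-1; t]).
    rewrite -[[:: b; _; _; _]]/([:: b; s; (b ^ s)^-1] ++ [:: t]).
    apply: (@htpy_catr _ _ _ _ _ [:: t] [:: s]) => //=; rewrite mulg1.
    by split; [done|exact: BY|move: hvs; rewrite /above /= !charE; lra].
  apply: (@htpy_trans _ _ _ _ _ ([:: t; b; t^-1] ++ [:: s; (b ^ s)^-1; t])).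
    apply: (@htpy_catr _ _ _ _ _ [:: s; (b ^ s)^-1; t] [:: b]) => //=.
    rewrite mulg1; move: hv hvs; rewrite /above /= !charE => hv hvs.
    split; [lra|done|split; [lra|exact/symY/BY|split; [lra|exact: BY|lra]]].
  rewrite -[_ ++ detour b s]/([:: t; b; t^-1; s] ++ [:: t; (b ^ s)^-1]).
  rewrite -[_ ++ [:: s; _; _]]/([:: t; b; t^-1; s] ++ [:: (b ^ s)^-1; t]).
  apply: htpy_catl.
    move: hv hvs; rewrite /= /above /= !charE => hv hvs.
    split; [lra|exact: BY|split; [lra|exact: BY|split; [lra|exact/symY/BY|]]].
    split; [lra|done|lra].
  have -> : v * wprod [:: t; b; t^-1; s] = v * b * s.
    by rewrite /= mulg1 !mulgA -(mulgA v) (Bcomm Bt Bb) mulgA mulgK.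
  exact: htpy_sym.
rewrite catA [_ ++ detour _ _ ++ _]catA -[(_ ++ push w) ++ _]catA.
apply: (@htpy_trans _ _ _ _ _ ([:: s; t] ++ push w ++ [:: t^-1])).
  by apply: (@htpy_catl _ _ _ _ _ [:: s]); [split|rewrite /= mulg1; exact: IH].
apply: htpy_catr => //=; rewrite mulg1 mulgA.
apply/walk_cat; have [hp ep] := push_walk hw; split.
  by apply: walk_sub hp => //; apply: above_sub; lra.
rewrite ep mulJ; have he := walk_end hw.
rewrite /= mulgK; split=> //; last exact/symY/BY.
by move: he; rewrite /above /= !charE; lra.
Qed.

(** The condition on relators that makes the push act on homotopies. *)
Definition pushable r : Prop := forall c v, walk (above c) Y v r ->
  htpy (above (c + eps)) Y S (v * t) (push r) [::].

(** The raised loop is filled by the same relator based at [v * b]. *)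
Lemma companion_pushable b r : S r -> companion B b r -> pushable r.
Proof.
move=> Sr Br c v hw; have := push_companion Br hw.
have [e0 tpos] := B_pos Bt; have Bb := companion_start Br.
have [_ bpos] := B_pos Bb.
rewrite trueS // conjg1 => h; apply: htpy_trans h _.
have hv := walk_start hw; have := trueS Sr => r1.
have cons1 : walk (above (c + eps)) Y (v * t) [:: b; t^-1].
  move: hv; rewrite /above /= !charE => hv.
  split; [lra|exact: BY|split; [lra|exact/symY/BY|lra]].
have cons2 : walk (above (c + eps)) Y (v * b) [:: t; b^-1].
  move: hv; rewrite /above /= !charE => hv.
  split; [lra|exact: BY|split; [lra|exact/symY/BY|lra]].
have e : v * t * wprod [:: b; t^-1] = v * b.
  by rewrite /= mulg1 (commuteV (Bcomm Bb Bt)) !mulgA mulgK.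
apply: (@htpy_trans _ _ _ _ _ ([:: b; t^-1] ++ [:: t; b^-1])).
  apply: htpy_face => //; apply/walk_cat; rewrite e; split=> //.
  apply/walk_cat; rewrite r1 mulg1; split=> //.
  by apply: walk_above hw; rewrite !charE; lra.
have := htpy_mulV trueS symY cons1; rewrite /winv /= invgK.
by [].
Qed.

(** Spurs are respected because the push of an inverse letter is, up to homotopy,
    the inverse of the push. *)
Lemma push_htpy c v p q : (forall r, S r -> pushable r) ->
  htpy (above c) Y S v p q ->
  htpy (above (c + eps)) Y S (v * t) (push p) (push q).
Proof.
move=> Spush; elim=> {p q}.
- by move=> w /push_walk[? _]; apply: htpy_refl.
- by move=> p q _; apply: htpy_sym.
- by move=> q p r _ pq _; apply: htpy_trans.
- move=> p q a h; have [hp _] := push_walk h; move: hp; rewrite !push_cat => hp.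
  rewrite -[push q]cat0s; apply: htpy_mid => //.
  have /walk_cat[hp1 /walk_cat[/=[hv Ya [hva Ya' hva']] _]] := h.
  have [_ ->] := push_walk hp1; rewrite mulJ.
  have [Bb Bba] := (b_B Ya, b_conj Ya); have [Bd Bda] := (b_B Ya', b_conj Ya').
  set b := b_ a in Bb Bba *; have Bb' : B ((b ^ a) ^ a^-1) by rewrite conjgK.
  apply: (@htpy_trans _ _ _ _ _ (detour b a ++ winv (detour b a))).
    rewrite !push_cons [push [::]]/push [flatten _]/= cats0; apply: htpy_catl.
      exact: detour_walk.
    rewrite wprod_detourB // mulJ.
    have -> : winv (detour b a) = detour (b ^ a) a^-1.
      by rewrite /detour conjgK /winv /= !invgK.
    exact: detour_htpy.
  by apply: htpy_mulV => //; apply: detour_walk.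
move=> p q r Sr h; have [hp _] := push_walk h; move: hp; rewrite !push_cat => hp.
rewrite -[push q]cat0s; apply: htpy_mid => //.
have /walk_cat[hp1 /walk_cat[hr _]] := h.
have [_ ->] := push_walk hp1; rewrite mulJ.
exact: Spush.
Qed.

Lemma walk_bounded v w : walk setT Y v w -> exists c, walk (above c) Y v w.
Proof.
elim: w v => [|a w IH] v /=; first by exists (chi v); apply: lexx.
move=> [_ Ya /IH[c hc]]; exists (Num.min c (chi v)).
split=> //; first by rewrite /above /= ge_min lexx orbT.
by apply: walk_sub hc => //; apply: above_sub; rewrite ge_min lexx.
Qed.

(** A homotopy visits finitely many vertices. *)
Lemma htpy_bounded v p q : htpy setT Y S v p q ->
  exists c, htpy (above c) Y S v p q.
Proof.
have weaken c d p' q' : (c <= d)%R -> htpy (above d) Y S v p' q' ->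
    htpy (above c) Y S v p' q'.
  by move=> cd; apply: htpy_sub => //; apply: above_sub.
elim=> {p q}.
- by move=> w /walk_bounded[c hc]; exists c; apply: htpy_refl.
- by move=> p q _ [c hc]; exists c; apply: htpy_sym.
- move=> q p r _ [c hc] _ [d hd]; exists (Num.min c d).
  by apply: (@htpy_trans _ _ _ _ _ q); [apply: weaken hc|apply: weaken hd];
    rewrite ge_min lexx ?orbT.
- by move=> p q a /walk_bounded[c hc]; exists c; apply: htpy_spur.
by move=> p q r Sr /walk_bounded[c hc]; exists c; apply: htpy_face.
Qed.

Lemma archimedean_depth c : exists n : nat, (- (eps *+ n) <= c)%R.
Proof.
have e0 := eps_gt0; exists (Num.bound (`|c| / eps)).
have : (`|c| / eps < (Num.bound (`|c| / eps))%:R)%R.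
  by apply: archi_boundP; apply: divr_ge0; rewrite ?normr_ge0 // ltW.
rewrite ltr_pdivrMr // -mulr_natl => h.
by have := ler_norm (- c)%R; rewrite normrN; lra.
Qed.

Lemma walk_descend n u v w : walk (above (- (eps *+ n))) Y u w ->
  v = u * wprod w -> above 0 u -> above 0 v ->
  exists p, walk (above 0) Y u p /\ v = u * wprod p.
Proof.
have e0 := eps_gt0; have [_ tpos] := B_pos Bt.
elim: n u v w => [|n IH] u v w hw e hu hv.
  by exists w; split=> //; apply: walk_sub hw => //; apply: above_sub; rewrite mulr0n oppr0.
have [hp ep] := push_walk hw.
have [||||p [hp' ep']] := IH (u * t) (v * t) (push w).
- by apply: walk_sub hp => //; apply: above_sub; rewrite mulrS; lra.
- by rewrite ep e mulJ.
- by move: hu; rewrite /above /= !charE; lra.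
- by move: hv; rewrite /above /= !charE; lra.
exists (t :: p ++ [:: t^-1]); rewrite /= wprod_cat /= mulg1 !mulgA -ep' mulgK.
split=> //; split=> //; first exact: BY.
apply/walk_cat; split=> //; rewrite -ep' /= mulgK.
split; [|exact/symY/BY|done].
by move: hv; rewrite /above /= !charE; lra.
Qed.

(** Each push trades a homotopy reaching down to [- eps *+ n.+1] for one reaching
    down to [- eps *+ n], at the cost of replacing the loop by a homotopic one. *)
Lemma htpy_descend n v w : (forall r, S r -> pushable r) ->
  htpy (above (- (eps *+ n))) Y S v w [::] -> walk (above 0) Y v w ->
  htpy (above 0) Y S v w [::].
Proof.
move=> Spush; have e0 := eps_gt0; have [_ tpos] := B_pos Bt.
elim: n v w => [|n IH] v w h hw.
  by apply: htpy_sub h => //; apply: above_sub; rewrite mulr0n oppr0.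
have := push_htpy Spush h; have [hp ep] := push_walk hw => hpush.
apply: htpy_trans (push_near hw) _.
have hp0 : walk (above 0) Y (v * t) (push w).
  by apply: walk_sub hp => //; apply: above_sub; lra.
have hv := walk_start hw.
have h0 : htpy (above 0) Y S (v * t) (push w) [::].
  by apply: IH => //; apply: htpy_sub hpush => //; apply: above_sub; rewrite mulrS; lra.
apply: (@htpy_trans _ _ _ _ _ ([:: t] ++ [::] ++ [:: t^-1])).
  apply: htpy_mid => //; last by rewrite /= mulg1.
  split=> //; first exact: BY.
  apply/(walk_cat _ _ _ (push w)); split=> //; have [_ _ ->] := htpy_walk trueS h0.
  rewrite mulg1 /= mulgK; split=> //; last exact/symY/BY.
  by move: hv; rewrite /above /= !charE; lra.
apply: (@htpy_spur _ _ _ _ _ [::] [::]) => /=; rewrite mulgK.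
split; [done|exact: BY|split; [|exact/symY/BY|done]].
by move: hv; rewrite /above /= !charE; lra.
Qed.

Theorem push_criterion :
  (forall v, exists w, walk setT Y 1 w /\ wprod w = v) ->
  (forall w, walk setT Y 1 w -> wprod w = 1 -> htpy setT Y S 1 w [::]) ->
  (forall r, S r -> pushable r) ->
  (forall u v, above 0 u -> above 0 v ->
     exists w, walk (above 0) Y u w /\ v = u * wprod w) /\
  (forall v w, walk (above 0) Y v w -> wprod w = 1 ->
     htpy (above 0) Y S v w [::]).
Proof.
move=> genY presS Spush; split.
  move=> u v hu hv; have [w [hw ew]] := genY (u^-1 * v).
  have hw' : walk setT Y u w by rewrite -[u]mulg1; apply: walk_translate hw.
  have [c hc] := walk_bounded hw'; have [n hn] := archimedean_depth c.
  apply: (@walk_descend n _ _ w) => //; last by rewrite ew mulVKg.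
  by apply: walk_sub hc => //; apply: above_sub.
move=> v w hw ew.
have hw1 : walk setT Y 1 w.
  by apply/walk_setT; apply/(walk_setT _ v); apply: walk_sub hw.
have [c hc] := htpy_bounded (htpy_move v (presS _ hw1 ew)).
have [n hn] := archimedean_depth c; apply: (@htpy_descend n) => //.
by apply: htpy_sub hc => //; apply: above_sub.
Qed.

End Push.

(** * Finite presentations *)

Section Compactness.
Variable V : groupType.
Implicit Types (A Y : set V) (S : set (seq V)) (v : V) (p q r w : seq V).

Lemma htpy_finite A Y S v p q : htpy A Y S v p q ->
  exists2 R : seq (seq V), [set` R] `<=` S & htpy A Y [set` R] v p q.
Proof.
have widen R R' p' q' : [set` R] `<=` [set` R'] -> htpy A Y [set` R] v p' q' ->
    htpy A Y [set` R'] v p' q'.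
  by move=> ?; apply: htpy_sub.
elim=> {p q}.
- by move=> w hw; exists [::] => //; apply: htpy_refl.
- by move=> p q _ [R RS h]; exists R => //; apply: htpy_sym.
- move=> q p r _ [R RS h] _ [R' RS' h']; exists (R ++ R').
    by move=> x /=; rewrite mem_cat => /orP[/RS|/RS'].
  by apply: (@htpy_trans _ _ _ _ _ q); [apply: widen h|apply: widen h'];
    move=> x /=; rewrite mem_cat => ->; rewrite ?orbT.
- by move=> p q a h; exists [::] => //; apply: htpy_spur.
move=> p q r Sr h; exists [:: r].
  by move=> x /=; rewrite inE => /eqP->.
by apply: htpy_face => //=; rewrite mem_head.
Qed.

Lemma htpy_finite_seq A Y S v (L : seq (seq V)) :
  (forall w, w \in L -> htpy A Y S v w [::]) ->
  exists2 R : seq (seq V), [set` R] `<=` S &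
    forall w, w \in L -> htpy A Y [set` R] v w [::].
Proof.
elim: L => [|w L IH] h; first by exists [::].
have [|R RS hR] := IH; first by move=> x xL; apply: h; rewrite inE xL orbT.
have [R' RS' hR'] := htpy_finite (h w (mem_head _ _)).
exists (R ++ R'); first by move=> x /=; rewrite mem_cat => /orP[/RS|/RS'].
move=> x; rewrite inE => /orP[/eqP->|/hR hx].
  by apply: htpy_sub hR' => // z /=; rewrite mem_cat => ->; rewrite orbT.
by apply: htpy_sub hx => // z /=; rewrite mem_cat => ->.
Qed.

Definition presents Y S := forall w, walk setT Y 1 w -> wprod w = 1 ->
  htpy setT Y S 1 w [::].

Definition word_generates Y := forall v, exists2 w, walk setT Y 1 w & wprod w = v.

Lemma walk_move Y v v' w : walk setT Y v w -> walk setT Y v' w.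
Proof. by move/walk_setT => h; apply/walk_setT. Qed.

(** Translate the generators of [P] into words over [Y] and back.  The relators of
    [P] and the definitions of the letters of [Y] become finitely many words, each
    of which is trivial by finitely many elements of [S]; these elements already
    present the group. *)
Lemma presents_compact (P : finite_presentation V) (Y : seq V) S :
  sym_letters [set` Y] -> true_words S -> word_generates [set` Y] ->
  presents [set` Y] S ->
  exists2 R : seq (seq V), [set` R] `<=` S & presents [set` Y] [set` R].
Proof.
move=> symY trueS genY presS.
have /choice[hat hatP] v : exists w, walk setT [set` Y] 1 w /\ wprod w = v.
  by have [w] := genY v; exists w.
have /choice[wd wdP] : forall v, exists w : word (gens P), word_val w = v.
  exact: gensP.
pose hatl (a : letter (gens P)) :=
  if a.2 then hat (fsval a.1) else winv (hat (fsval a.1)).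
pose hatw (w : word (gens P)) := flatten [seq hatl a | a <- w].
have hatw_cat (u w : word (gens P)) : hatw (u ++ w) = hatw u ++ hatw w.
  by rewrite /hatw map_cat flatten_cat.
have hatl_walk v a : walk setT [set` Y] v (hatl a).
  have [h _] := hatP (fsval a.1); rewrite /hatl; case: ifP => _.
    exact: walk_move h.
  exact/walk_move/(walk_winv symY h).
have hatl_val a : wprod (hatl a) = letter_val a.
  have [_ h] := hatP (fsval a.1); rewrite /hatl /letter_val.
  by case: ifP; rewrite ?wprod_winv h.
have hatl_inv a : hatl (letter_inv a) = winv (hatl a).
  by case: a => x []; rewrite /hatl /= ?winvK.
have hatw_walk v (w : word (gens P)) : walk setT [set` Y] v (hatw w).
  elim: w v => [|a w IH] v //; apply/(walk_cat _ _ _ (hatl a)); split=> //.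
have hatw_val (w : word (gens P)) : wprod (hatw w) = word_val w.
  rewrite /word_val; elim: w => [|a w IH]; first by rewrite big_nil.
  by rewrite big_cons -IH -hatl_val -wprod_cat.
have hatw_inv (w : word (gens P)) : hatw (word_inv w) = winv (hatw w).
  elim: w => [|a w IH] //; rewrite /word_inv /= rev_cons -cats1 hatw_cat.
  rewrite -/(word_inv w) IH /hatw /= cats0 hatl_inv -winv_cat //.
pose L := map hatw (rels P) ++ [seq s :: winv (hatw (wd s)) | s <- Y].
have LS w : w \in L -> htpy setT [set` Y] S 1 w [::].
  rewrite mem_cat => /orP[/mapP[r rP ->]|/mapP[s sY ->]]; apply: presS => //.
  - by rewrite hatw_val; apply/relsP; apply: normal_closure_rel.
  - by split=> //; apply/walk_move/(walk_winv symY (hatw_walk 1 _)).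
  by rewrite /= wprod_winv hatw_val wdP mulgV.
have [R RS hR] := htpy_finite_seq LS; exists R => // w hw ew.
have trueR : true_words [set` R] by move=> r /RS; apply: trueS.
have hatw_free (u u' : word (gens P)) : freely_equal u u' -> forall v,
    htpy setT [set` Y] [set` R] v (hatw u) (hatw u').
  elim=> {u u'} [u|u u' _ IH|u u' u'' _ IH _ IH'|u u' a] v.
  - exact: htpy_refl.
  - by apply: htpy_sym.
  - by apply: htpy_trans (IH v) (IH' v).
  rewrite !hatw_cat -[hatw u']cat0s; apply: htpy_mid => //.
    do !(apply/walk_cat; split) => //; exact: hatw_walk.
  rewrite /hatw /= cats0 hatl_inv; exact: htpy_mulV.
have hatw_nc (u : word (gens P)) : normal_closure (rels P) u -> forall v,
    htpy setT [set` Y] [set` R] v (hatw u) [::].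
  elim=> {u} [r rP|||u _ IH|u u' _ IH|u u' uu' _ IH] v.
  - by apply: (@htpy_move _ _ _ 1); apply: hR; rewrite mem_cat map_f.
  - exact: htpy_refl.
  - by move=> u' _ IH _ IH' v'; rewrite hatw_cat; apply: (htpy_cat trueR (IH v')).
  - by rewrite hatw_inv -[[::]]/(winv [::]); have := htpy_winv trueR symY (IH v);
      apply: htpy_move.
  - rewrite !hatw_cat hatw_inv.
    apply: (@htpy_trans _ _ _ _ _ (hatw u ++ [::] ++ winv (hatw u))).
      apply: htpy_mid => //.
      do !(apply/walk_cat; split) => //; rewrite -?hatw_inv; exact: hatw_walk.
    exact: htpy_mulV.
  by apply: htpy_trans (IH v); apply: htpy_sym; apply: hatw_free.
have sY_htpy s v : s \in Y -> htpy setT [set` Y] [set` R] v [:: s] (hatw (wd s)).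
  move=> sY; apply: htpy_of_null => //; first by rewrite hatw_val /= mulg1 wdP.
  by apply: (@htpy_move _ _ _ 1); apply: hR; rewrite mem_cat; apply/orP; right;
    apply/mapP; exists s.
pose wds (u : seq V) := flatten [seq wd s | s <- u].
have w_htpy u v : walk setT [set` Y] v u ->
    htpy setT [set` Y] [set` R] v u (hatw (wds u)).
  elim: u v => [|s u IH] v; first by move=> _; apply: htpy_refl.
  move=> [_ sY hu]; rewrite /wds /= hatw_cat -cat1s; apply: htpy_cat => //.
    exact: sY_htpy.
  by rewrite /= mulg1; apply: IH.
apply: htpy_trans (w_htpy _ _ hw) _; apply: hatw_nc; apply/relsP.
rewrite -hatw_val; have [_ _ <-] := htpy_walk trueR (w_htpy _ _ hw).
exact: ew.
Qed.

End Compactness.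

(** The finite data to which [push_criterion] applies; the words in [special] are
    the relators whose pushability is left to a separate argument. *)
Record pushing_system (V : groupType) (Y B : seq V) (S : seq (seq V))
    (special : set (seq V)) : Prop := PushingSystem {
  ps_sym : sym_letters [set` Y];
  ps_true : true_words [set` S];
  ps_over : forall r, r \in S -> walk setT [set` Y] 1 r;
  ps_gen : word_generates [set` Y];
  ps_pres : presents [set` Y] [set` S];
  ps_BY : {subset B <= Y};
  ps_square : forall b s, b \in B -> s \in Y -> b ^ s \in B ->
    [:: b; s; (b ^ s)^-1; s^-1] \in S;
  ps_cover : forall s, s \in Y -> exists2 b, b \in B & b ^ s \in B;
  ps_rel : forall r, r \in S ->
    (exists b, companion [set` B] b r) \/ special r
}.

Section Closing.
Variable V : groupType.
Implicit Types (b e s v : V) (r w : seq V).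

(** The companions met when [e] is carried along [w]. *)
Fixpoint conjugates e w : seq V :=
  e :: (if w is a :: q then conjugates (e ^ a) q else [::]).

Lemma conjugates_companion (B : set V) e w :
  companion B e w <-> (forall b, b \in conjugates e w -> B b).
Proof.
elim: w e => [|a w IH] e /=.
  by split=> [[Be _] b|h]; [rewrite inE => /eqP-> | split=> //; apply: h;
    rewrite mem_head].
split=> [[Be /IH h] b|h]; first by rewrite inE => /orP[/eqP->|/h].
split; first by apply: h; rewrite mem_head.
by apply/IH => b bw; apply: h; rewrite inE bw orbT.
Qed.

(** [BB] is a possibly infinite reservoir; each word with a companion starting in
    [Y1] uses only finitely many of its elements.  [Ex] and [E0] are relators and
    companions that the finite system is required to contain. *)
Variables (P : finite_presentation V) (Y1 : seq V) (BB : set V).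
Variables (special : set (seq V)) (Ex : seq (seq V)) (E0 : seq V).

Definition companion_words : set (seq V) :=
  [set r | [/\ walk setT [set` Y1] 1 r, wprod r = 1 &
               exists2 e, e \in Y1 & companion BB e r]].

Hypotheses (symY1 : sym_letters [set` Y1]) (genY1 : word_generates [set` Y1]).
Hypothesis special_true : forall r, special r ->
  walk setT [set` Y1] 1 r /\ wprod r = 1.
Hypothesis presY1 : presents [set` Y1] (companion_words `|` special).
Hypothesis Ex_words : forall r, r \in Ex -> companion_words r \/ special r.
Hypothesis cover1 : forall s, s \in Y1 -> exists2 e, e \in Y1 & companion BB e [:: s].
Hypotheses (E0Y : {subset E0 <= Y1}) (E0B : [set` E0] `<=` BB).

Lemma true_companion_words : true_words (companion_words `|` special).
Proof. by move=> r [[]|/special_true[]]. Qed.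

(** After compactness has selected finitely many relators, the letters [B] are the
    companions in use.  The squares define each new letter as a conjugate of an
    old one, so that they present the same group; and a square on [b] and [s] has
    the companion [b], because [b] commutes with itself. *)
Lemma finite_pushing_system : exists Y B S,
  [/\ pushing_system Y B S special, {subset Y1 <= Y}, {subset E0 <= B},
      [set` B] `<=` BB & {subset Ex <= S}].
Proof.
have [R0 R0S presR0] :=
  presents_compact P symY1 true_companion_words genY1 presY1.
pose R1 := R0 ++ Ex.
have R1S r : r \in R1 -> companion_words r \/ special r.
  by rewrite mem_cat => /orP[/R0S|/Ex_words].
have presR1 : presents [set` Y1] [set` R1].
  move=> w hw ew; apply: htpy_sub (presR0 w hw ew) => // r /= rR.
  by rewrite mem_cat rR.
have /choice[ew ewP] : forall w, exists e, companion_words w \/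
    (exists2 s, s \in Y1 & w = [:: s]) -> e \in Y1 /\ companion BB e w.
  move=> w; have [h|h] := pselect (exists2 e, e \in Y1 & companion BB e w).
    by have [e eY he] := h; exists e.
  exists 1 => - [[_ _ //]|[s /cover1 h' ws]].
  by case: h; rewrite ws.
pose good w := `[< companion_words w >].
(* Besides the relators, every single letter needs a companion. *)
pose words := [seq r <- R1 | good r] ++ [seq [:: s] | s <- Y1].
have wordsP w : w \in words -> [/\ ew w \in Y1, companion BB (ew w) w &
    walk setT [set` Y1] 1 w].
  rewrite mem_cat mem_filter => /orP[/andP[/asboolP gw _]|/mapP[s sY ws]].
    have [|? ?] := ewP w; first by left.
    by split=> //; case: gw.
  have [|? ?] := ewP w; first by right; exists s.
  by split=> //; rewrite ws; split.
pose B := E0 ++ flatten [seq conjugates (ew w) w | w <- words].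
have BBB : [set` B] `<=` BB.
  move=> b /=; rewrite mem_cat => /orP[/E0B//|/flattenP[_ /mapP[w wW ->]]].
  have [_ h _] := wordsP w wW; exact: (iffLR (conjugates_companion _ _ _) h).
have companionB w : w \in words -> companion [set` B] (ew w) w.
  move=> wW; apply/conjugates_companion => b bw /=; rewrite mem_cat.
  by apply/orP; right; apply/flattenP; exists (conjugates (ew w) w) => //;
    apply: map_f.
have E0_B : {subset E0 <= B} by move=> b bE; rewrite mem_cat bE.
have inB b : b \in B ->
    b \in E0 \/ exists2 w, w \in words & b \in conjugates (ew w) w.
  rewrite mem_cat => /orP[|/flattenP[_ /mapP[w wW ->]]]; first by left.
  by right; exists w.
clearbody B; pose Y := Y1 ++ B ++ [seq b^-1 | b <- B].
have memY s : (s \in Y) = [|| s \in Y1, s \in B | s \in [seq b^-1 | b <- B]].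
  by rewrite !mem_cat.
clearbody Y.
have Y1Y : {subset Y1 <= Y} by move=> s sY; rewrite memY sY.
have BY : {subset B <= Y} by move=> s sY; rewrite memY sY orbT.
have symY : sym_letters [set` Y].
  move=> s /=; rewrite !memY => /or3P[/symY1/= ->//|sB|/mapP[b bB ->]].
    by rewrite map_f ?orbT.
  by rewrite invgK bB orbT.
pose square b s := [:: b; s; (b ^ s)^-1; s^-1].
pose squares := flatten [seq [seq square b s | s <- Y & b ^ s \in B] | b <- B].
have squaresP r : r \in squares -> exists b s, [/\ b \in B, s \in Y,
    b ^ s \in B & r = square b s].
  move=> /flattenP[_ /mapP[b bB ->] /mapP[s]].
  by rewrite mem_filter => /andP[? ?] ->; exists b, s.
have squareS b s : b \in B -> s \in Y -> b ^ s \in B -> square b s \in squares.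
  move=> bB sY bsB; apply/flattenP; exists [seq square b s | s <- Y & b ^ s \in B].
    by apply: (map_f (fun b => [seq square b s | s <- Y & b ^ s \in B])).
  by apply: map_f; rewrite mem_filter bsB.
clearbody squares; pose S := R1 ++ squares.
have memS r : (r \in S) = (r \in R1) || (r \in squares) by rewrite mem_cat.
clearbody S.
have trueS : true_words [set` S].
  move=> r /=; rewrite memS => /orP[/R1S[[]|/special_true[]]//|].
  move=> /squaresP[b [s [_ _ _ ->]]] /=.
  by rewrite mulg1 mulgA (conjgC b s) -mulgA mulVKg mulgV.
have overS r : r \in S -> walk setT [set` Y] 1 r.
  have up w : walk setT [set` Y1] 1 w -> walk setT [set` Y] 1 w.
    by apply: walk_sub => //.
  rewrite memS => /orP[/R1S[[/up]|/special_true[/up]]//|].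
  move=> /squaresP[b [s [bB sY bsB ->]]].
  have sV a : a \in Y -> a^-1 \in Y by apply: symY.
  apply/walk_setT => a /=; rewrite !inE => /or4P[] /eqP-> //; first exact: BY.
    by apply: sV; apply: BY.
  exact: sV.
have sq_htpy v b s : b \in B -> s \in Y -> b ^ s \in B ->
    htpy setT [set` Y] [set` S] v [:: b; s] [:: s; b ^ s].
  move=> bB sY bsB; apply: (htpy_rel trueS symY).
  - by rewrite /= memS (squareS _ _ bB sY bsB) orbT.
  - by split=> //; apply: BY.
  by split=> //; split=> //; apply: BY.
pose reducible a := exists2 u, walk setT [set` Y1] 1 u &
  forall v, htpy setT [set` Y] [set` S] v [:: a] u.
have red_Y1 s : s \in Y1 -> reducible s.
  move=> sY; exists [:: s]; first by split.
  by move=> v; apply: htpy_refl; split=> //; apply: Y1Y.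
have red_inv a : reducible a -> reducible a^-1.
  move=> [u hu h]; exists (winv u); first exact/walk_move/(walk_winv symY1 hu).
  by move=> v; have := htpy_winv trueS symY (h 1); apply: htpy_move.
have red_conj e w : reducible e -> walk setT [set` Y1] 1 w ->
    companion [set` B] e w -> forall b, b \in conjugates e w -> reducible b.
  elim: w e => [|s w IH] e re hw he b /=; first by rewrite inE => /eqP->.
  rewrite inE => /orP[/eqP->//|]; move: hw he => [_ sY hw] [eB hes].
  apply: IH => //; last exact: walk_move hw.
  have esB := companion_start hes; have [u hu hue] := re.
  have hs v : walk setT [set` Y] v [:: s] by split=> //; apply: Y1Y.
  have hsV v : walk setT [set` Y] v [:: s^-1] by split=> //; apply/symY/Y1Y.
  exists ([:: s^-1] ++ u ++ [:: s]).
    apply/(walk_cat _ _ _ [:: s^-1]); split; first by split=> //; apply: symY1.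
    by apply/(walk_cat _ _ _ u); split; [exact: walk_move hu | split].
  move=> v; apply: (@htpy_trans _ _ _ _ _ ([:: s^-1] ++ [:: s; e ^ s])).
    apply: htpy_sym; have := @htpy_spur _ setT [set` Y] [set` S] v [::] [:: e ^ s] s^-1.
    by rewrite invgK; apply; split=> //; [exact/symY/Y1Y|];
      split=> //; [exact: Y1Y|]; split=> //; apply: BY.
  apply: htpy_catl => //.
  apply: (@htpy_trans _ _ _ _ _ [:: e; s]).
    by apply: htpy_sym; apply: sq_htpy => //; apply: Y1Y.
  by apply: (@htpy_catr _ _ _ _ _ [:: s] [:: e]).
have red_B b : b \in B -> reducible b.
  move=> /inB[/E0Y/red_Y1//|[w wW bw]].
  have [eY _ hw] := wordsP w wW.
  by apply: (red_conj _ w _ _ _ _ bw) => //; [exact: red_Y1 | exact: companionB].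
have red a : a \in Y -> reducible a.
  rewrite memY => /or3P[/red_Y1//|/red_B//|/mapP[b /red_B rb ->]].
  exact: red_inv.
have red_word w : walk setT [set` Y] 1 w -> exists2 u, walk setT [set` Y1] 1 u &
    htpy setT [set` Y] [set` S] 1 w u.
  elim: w => [|a w IH]; first by exists [::] => //; apply: htpy_refl.
  move=> [_ /red[u hu hau] hw]; have [|u' hu' hwu'] := IH; first exact: walk_move hw.
  exists (u ++ u'); first by apply/walk_cat; split=> //; apply: walk_move hu'.
  rewrite -cat1s; apply: htpy_cat => //; exact: htpy_move hwu'.
exists Y, B, S; split=> //; first split=> //.
- move=> v; have [w hw <-] := genY1 v; exists w => //.
  by apply: walk_sub hw => //.
- move=> w hw ew1; have [u hu hwu] := red_word _ hw.
  apply: (htpy_trans hwu).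
  have [_ _ e] := htpy_walk trueS hwu.
  have := presR1 u hu; rewrite -e ew1 => /(_ erefl); apply: htpy_sub => //.
  by move=> r /= rR; rewrite memS rR.
- by move=> b s bB sY bsB; rewrite memS (squareS _ _ bB sY bsB) orbT.
- move=> s; rewrite memY => /or3P[sY|sB|/mapP[b bB ->]].
  + have : [:: s] \in words by rewrite mem_cat orbC map_f.
    by move=> /companionB[? [? _]]; exists (ew [:: s]).
  + by exists s => //; rewrite conjgE mulKg.
  by exists b => //; rewrite commute_conj //; apply: commuteV.
- move=> r; rewrite memS => /orP[rR|/squaresP[b [s [bB sY bsB ->]]]].
    have [h|h] := R1S r rR; last by right.
    left; exists (ew r); apply: companionB; rewrite mem_cat mem_filter rR andbT.
    by apply/orP; left; apply/asboolP.
  left; exists b => /=.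
  have -> : b ^ b = b by rewrite conjgE mulKg.
  have e : (b ^ s) ^ (b ^ s)^-1 = b ^ s by apply/commute_conj/commuteV.
  by rewrite e conjgK; do !split.
by move=> r rE; rewrite memS mem_cat rE orbT.
Qed.

End Closing.

(** * From words to Cayley complexes *)

Section FreeWords.
Variables (V : groupType) (X : {fset V}).
Implicit Types (u w p q : word X).

Lemma letter_invK : involutive (@letter_inv V X).
Proof. by case=> x b; rewrite /letter_inv /= negbK. Qed.

Lemma word_inv_cons (a : letter X) u : word_inv (a :: u) = word_inv u ++ [:: letter_inv a].
Proof. by rewrite /word_inv /= rev_cons -cats1. Qed.

Lemma word_invK : involutive (@word_inv V X).
Proof.
move=> w; rewrite /word_inv map_rev revK -map_comp -[RHS]map_id.
by apply: eq_map => a /=; rewrite letter_invK.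
Qed.

Lemma word_val_cons (a : letter X) w : word_val (a :: w) = letter_val a * word_val w.
Proof. by rewrite /word_val big_cons. Qed.

Lemma word_val_cat u w : word_val (u ++ w) = word_val u * word_val w.
Proof.
elim: u => [|a u IH] /=; first by rewrite /word_val big_nil mul1g.
by rewrite !word_val_cons IH mulgA.
Qed.

Lemma word_val_inv u : word_val (word_inv u) = (word_val u)^-1.
Proof.
elim: u => [|a u IH]; first by rewrite /word_val big_nil invg1.
rewrite word_inv_cons word_val_cat IH !word_val_cons letter_val_inv.
by rewrite /word_val big_nil mulg1 invgM.
Qed.

Lemma freely_equal_cat p q u w :
  freely_equal u w -> freely_equal (p ++ u ++ q) (p ++ w ++ q).
Proof.
elim=> {u w} [w|u w _|u w z _ h1 _ h2|u w a].
- exact: freely_equal_refl.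
- exact: freely_equal_sym.
- exact: freely_equal_trans h1 h2.
by have := freely_equal_cancel (p ++ u) (w ++ q) a; rewrite -!catA.
Qed.

Lemma freely_equal_mulV u : freely_equal (u ++ word_inv u) [::].
Proof.
elim: u => [|a u IH]; first exact: freely_equal_refl.
apply: (@freely_equal_trans _ _ _ [:: a; letter_inv a]); last first.
  exact: (freely_equal_cancel [::] [::] a).
rewrite word_inv_cons catA.
exact: (freely_equal_cat [:: a] [:: letter_inv a] IH).
Qed.

Lemma freely_equal_Vmul u : freely_equal (word_inv u ++ u) [::].
Proof. by have := freely_equal_mulV (word_inv u); rewrite word_invK. Qed.

(** [u r w] is freely equal to the product of the conjugate [u r u^-1] and [u w]. *)
Lemma normal_closure_insert rels u r w : normal_closure rels r ->
  normal_closure rels (u ++ r ++ w) <-> normal_closure rels (u ++ w).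
Proof.
have ins r' : normal_closure rels r' -> forall z, normal_closure rels (u ++ z) ->
    normal_closure rels (u ++ r' ++ z).
  move=> hr z hz.
  have := normal_closure_mul (normal_closure_conj u hr) hz.
  apply: normal_closure_free; rewrite -!catA.
  have := freely_equal_cat (u ++ r') z (freely_equal_Vmul u).
  by rewrite -!catA.
move=> hr; split=> [h|]; last exact: ins.
have := ins _ (normal_closure_inv hr) _ h.
apply: normal_closure_free.
have := freely_equal_cat u w (freely_equal_Vmul r).
by rewrite -!catA.
Qed.

Lemma word_path_cat (v : V) u w :
  word_path v (u ++ w) = word_path v u ++ word_path (v * word_val u) w.
Proof.
elim: u v => [|a u IH] v /=; first by rewrite /word_val big_nil mulg1.
by rewrite IH word_val_cons mulgA.
Qed.

End FreeWords.

Section Realization.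
Variables (V : groupType) (Y : seq V) (S : seq (seq V)).
Hypotheses (symY : sym_letters [set` Y]) (trueS : true_words [set` S]).
Hypothesis overS : forall r, r \in S -> walk setT [set` Y] 1 r.
Hypotheses (genY : word_generates [set` Y]) (presS : presents [set` Y] [set` S]).

Let X : {fset V} := [fset y in Y]%fset.

(** Elements outside the alphabet are dropped; on words over [Y] nothing is
    lost. *)
Definition lift (w : seq V) : word X :=
  [seq (x, true) | x <- pmap (insub : V -> option X) w].

Lemma lift_cat u w : lift (u ++ w) = lift u ++ lift w.
Proof. by rewrite /lift pmap_cat map_cat. Qed.

Lemma lift_cons a w : lift (a :: w) = lift [:: a] ++ lift w.
Proof. exact: lift_cat [:: a] w. Qed.

Lemma lift1 a : a \in Y -> exists2 x : X, fsval x = a & lift [:: a] = [:: (x, true)].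
Proof.
move=> aY; have aX : a \in X by rewrite !inE.
by exists [` aX]%fset => //; rewrite /lift /= insubT.
Qed.

Lemma liftK (x : X) : lift [:: fsval x] = [:: (x, true)].
Proof. by rewrite /lift /= valK. Qed.

Lemma lift_val w : walk setT [set` Y] 1 w -> word_val (lift w) = wprod w.
Proof.
elim: w => [|a w IH]; first by rewrite /word_val big_nil.
move=> [_ aY hw]; rewrite lift_cons word_val_cat IH; last exact: walk_move hw.
by have [x <- ->] := lift1 aY; rewrite word_val_cons /word_val big_nil mulg1.
Qed.

(** In the Cayley graph the inverse of the generator [a] and the generator [a^-1]
    are different letters, which the added relators identify. *)
Let rS : seq (seq V) := S ++ [seq [:: a; a^-1] | a <- Y].
Let rX : seq (word X) := map lift rS.

Lemma lift_htpy_closure v u w : htpy setT [set` Y] [set` S] v u w ->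
  normal_closure rX (lift u) <-> normal_closure rX (lift w).
Proof.
elim=> {u w} [w _|p q _ IH|q p r _ h1 _ h2|p q a|p q r Sr _] //.
- by split=> /IH.
- by rewrite h1.
- move=> /walk_cat[_ [_ aY _]]; rewrite !lift_cat; apply: normal_closure_insert.
  by apply: normal_closure_rel; apply: map_f; rewrite mem_cat map_f ?orbT.
rewrite !lift_cat; apply: normal_closure_insert.
by apply: normal_closure_rel; apply: map_f; rewrite mem_cat Sr.
Qed.

Lemma rX_true r : r \in rX -> word_val r = 1.
Proof.
move=> /mapP[w wS ->]; rewrite mem_cat in wS.
case/orP: wS => [wS|/mapP[a aY ->]].
  by rewrite lift_val; [exact: trueS | exact: overS].
by rewrite lift_val /= ?mulg1 ?mulgV //; split=> //; split=> //; apply: symY.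
Qed.

Lemma freely_equal_val (u w : word X) : freely_equal u w -> word_val u = word_val w.
Proof.
elim=> {u w} [w|u w _ ->|u w z _ -> _|u w a] //.
by rewrite !(word_val_cat u) /= !word_val_cons letter_val_inv mulVKg.
Qed.

Lemma closure_true (w : word X) : normal_closure rX w -> word_val w = 1.
Proof.
elim=> {w} [r /rX_true||u w _ eu _ ew|w _ ew|u w _ ew|u w uw _ eu] //.
- by rewrite /word_val big_nil.
- by rewrite word_val_cat eu ew mulg1.
- by rewrite word_val_inv ew invg1.
- by rewrite !word_val_cat ew mul1g word_val_inv mulgV.
by rewrite -(freely_equal_val uw).
Qed.

Definition letters_val (w : word X) : seq V := [seq letter_val a | a <- w].

Lemma letter_valY (a : letter X) : letter_val a \in Y.
Proof.
have xY : fsval a.1 \in Y by have := fsvalP a.1; rewrite !inE.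
by rewrite /letter_val; case: ifP => _ //; apply: (symY xY).
Qed.

Lemma letters_val_walk v w : walk setT [set` Y] v (letters_val w).
Proof. by elim: w v => [|a w IH] v //; split=> //; apply: letter_valY. Qed.

Lemma letters_valE w : wprod (letters_val w) = word_val w.
Proof.
elim: w => [|a w IH]; first by rewrite /word_val big_nil.
by rewrite word_val_cons -IH.
Qed.

Lemma inverse_relator (x : X) : lift [:: fsval x; (fsval x)^-1] \in rX.
Proof.
by apply: map_f; rewrite mem_cat map_f ?orbT //; have := fsvalP x; rewrite !inE.
Qed.

Lemma lift_letter_closure p q (a : letter X) :
  normal_closure rX (p ++ lift [:: letter_val a] ++ q) ->
  normal_closure rX (p ++ [:: a] ++ q).
Proof.
case: a => x [] h; first by move: h; rewrite /letter_val /= liftK.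
have hx := normal_closure_rel (inverse_relator x).
rewrite catA; apply/(normal_closure_insert _ _ hx).
apply: normal_closure_free h; rewrite (lift_cons (fsval x)) liftK.
apply: freely_equal_sym.
have := freely_equal_cancel p (lift [:: (fsval x)^-1] ++ q) (x, false).
by rewrite -!catA.
Qed.

Lemma lift_letters_closure p w :
  normal_closure rX (p ++ lift (letters_val w)) -> normal_closure rX (p ++ w).
Proof.
elim: w p => [|a w IH] p //; rewrite /= (lift_cons (letter_val a)).
by move=> /lift_letter_closure; rewrite catA => /IH; rewrite -catA.
Qed.

Lemma realization_relsP (w : word X) : word_val w = 1 <-> normal_closure rX w.
Proof.
split=> [ew|]; last exact: closure_true.
apply: (@lift_letters_closure [::]); rewrite cat0s.
apply/(@lift_htpy_closure 1 _ [::]); last exact: normal_closure_one.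
by apply: presS; [exact: letters_val_walk | rewrite letters_valE].
Qed.

Lemma realization_gensP : generates X.
Proof.
by move=> v; have [w hw <-] := genY v; exists (lift w); rewrite lift_val.
Qed.

Definition realization : finite_presentation V :=
  FinitePresentation realization_gensP realization_relsP.

Local Notation K := (CayComplex realization).

Lemma lift_edge_path A v w : walk A [set` Y] v w ->
  @edge_path K A v (word_path v (lift w)) (v * wprod w).
Proof.
elim: w v => [|a w IH] v; first by rewrite /= mulg1.
move=> [Av aY hw]; have [x xa] := lift1 aY; rewrite (lift_cons a w) => -> /=.
split=> //; rewrite /cay_terminus /= mulgA.
by rewrite /letter_val /= xa; apply: IH.
Qed.

Lemma realization_cell v r : r \in rS ->
  exists c : cell K, boundary c = word_path v (lift r).
Proof. by move=> /(map_f lift) rR; exists (v, SeqSub rR). Qed.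

Lemma lift_htpy A v u w : htpy A [set` Y] [set` S] v u w ->
  @homotopic K A v (v * wprod u) (word_path v (lift u)) (word_path v (lift w)).
Proof.
have face x p r q : r \in rS -> wprod r = 1 -> walk setT [set` Y] 1 p ->
    walk setT [set` Y] 1 r -> walk A [set` Y] x (p ++ r ++ q) ->
    @homotopic K A x (x * wprod (p ++ r ++ q)) (word_path x (lift (p ++ r ++ q)))
      (word_path x (lift (p ++ q))).
  move=> rR er hp hr hw; have := lift_edge_path hw; rewrite !lift_cat !word_path_cat.
  rewrite (lift_val hp) (lift_val hr) er mulg1.
  by have [c <-] := realization_cell (x * wprod p) rR; apply: homotopic_face.
elim=> {u w} [w hw|p q pq IH|q p r pq IH1 qr IH2|p q a h|p q r Sr h].
- by apply: homotopic_refl; apply: lift_edge_path.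
- have [_ _ <-] := htpy_walk trueS pq; exact: homotopic_sym.
- apply: homotopic_trans IH1 _; have [_ _ ->] := htpy_walk trueS pq; exact: IH2.
- have h' : walk setT [set` Y] v (p ++ [:: a; a^-1] ++ q) by apply: walk_sub h.
  move/walk_cat: h' => [/walk_move hp /walk_cat[/walk_move ha _]].
  apply: face => //; last by rewrite /= mulg1 mulgV.
  by case: (ha 1) => _ aY _; rewrite mem_cat map_f ?orbT.
have h' : walk setT [set` Y] v (p ++ r ++ q) by apply: walk_sub h.
move/walk_cat: h' => [/walk_move hp /walk_cat[/walk_move hr _]].
by apply: face => //; [rewrite mem_cat Sr | exact: trueS].
Qed.

Lemma edge_path_word A v p w : @edge_path K A v p w -> exists u : word X,
  [/\ p = word_path v u, w = v * word_val u & walk A [set` Y] v (letters_val u)].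
Proof.
elim: p v => [|[z a] p IH] v /=.
  by move=> [Av <-]; exists [::]; rewrite /word_val big_nil mulg1.
move=> [Av zv /IH[u [-> -> hu]]]; rewrite /= in zv *; exists (a :: u).
rewrite -zv word_val_cons mulgA; split=> //; split=> //; last exact: letter_valY.
by rewrite zv.
Qed.

Lemma walk_edge_path A v u : walk A [set` Y] v (letters_val u) ->
  @edge_path K A v (word_path v u) (v * word_val u).
Proof.
elim: u v => [|a u IH] v; first by rewrite /word_val big_nil mulg1.
by move=> [Av _ hu]; rewrite word_val_cons mulgA; split=> //; apply: IH.
Qed.

(** The inverse of a generator [x] is replaced by the generator [x^-1]: the
    relator made of these two generators is inserted behind it, then the spur goes
    away. All this happens on the two ends of the edge. *)
Lemma letter_homotopic A v p q (a : letter X) :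
  walk A [set` Y] v (letters_val (p ++ [:: a] ++ q)) ->
  @homotopic K A v (v * word_val (p ++ [:: a] ++ q))
    (word_path v (p ++ [:: a] ++ q))
    (word_path v (p ++ lift [:: letter_val a] ++ q)).
Proof.
move=> hw; case: a hw => x [] hw.
  by rewrite /letter_val /= liftK; apply/homotopic_refl/walk_edge_path.
set b := letter_val (x, false); pose a : letter X := (x, false).
have bE : b = (fsval x)^-1 by [].
have [x' x'E bx'] := lift1 (letter_valY (x, false)).
have e1 : letter_val (x', true) = b := x'E.
have e2 : letter_val (x, true) = b^-1 by rewrite bE invgK.
pose long := p ++ [:: a] ++ [:: (x, true); (x', true)] ++ q.
have e : word_val long = word_val (p ++ [:: a] ++ q).
  rewrite (word_val_cat p) (word_val_cat p) /= !word_val_cons e1 e2.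
  by rewrite mulKg.
have hlong : walk A [set` Y] v (letters_val long).
  move: hw; rewrite /long /letters_val !map_cat => /walk_cat[hp /= hq].
  apply/walk_cat; split=> //; move: hq => [h1 h2 h3] /=.
  rewrite e1 e2 -/b mulgK.
  split=> //; split; [exact: walk_start h3| |by split].
  by rewrite -e2; apply: letter_valY.
have := walk_edge_path hlong; rewrite e => hpath.
refine (@homotopic_trans K A v _ _ (word_path v long) _ _ _); last first.
  move: hpath; rewrite bx' /long !(word_path_cat _ p) /=.
  rewrite -[x in v * word_val p * letter_val x]/a.
  set z := v * word_val p; rewrite (_ : z * _ * _ = z); last first.
    by rewrite /letter_val /= mulgVK.
  exact: (@homotopic_spur K A v _ (word_path v p) ((z, (x', true)) :: _) (z, a)).
apply: homotopic_sym; move: hpath; rewrite /long catA [p ++ _ ++ _]catA.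
rewrite !(word_path_cat _ (p ++ [:: a])) (word_path_cat _ [:: _; _]).
have rR : [:: fsval x; (fsval x)^-1] \in rS.
  by rewrite mem_cat map_f ?orbT //; have := fsvalP x; rewrite !inE.
have -> : [:: (x, true); (x', true)] = lift [:: fsval x; (fsval x)^-1].
  by rewrite (lift_cons (fsval x)) liftK -bE bx'.
have -> y : y * word_val (lift [:: fsval x; (fsval x)^-1]) = y.
  by rewrite rX_true ?mulg1 ?map_f.
have [c <-] := realization_cell (v * word_val (p ++ [:: a])) rR.
exact: homotopic_face.
Qed.

Lemma homotopic_lift A v u : walk A [set` Y] v (letters_val u) ->
  @homotopic K A v (v * word_val u) (word_path v u)
    (word_path v (lift (letters_val u))).
Proof.
have gen p : walk A [set` Y] v (letters_val (p ++ u)) ->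
    @homotopic K A v (v * word_val (p ++ u)) (word_path v (p ++ u))
      (word_path v (p ++ lift (letters_val u))); last exact: (gen [::]).
elim: u p => [|a u IH] p hw; first exact/homotopic_refl/walk_edge_path.
have lv (b : letter X) : letters_val (lift [:: letter_val b]) = [:: letter_val b].
  by have [x xb ->] := lift1 (letter_valY b); rewrite /letters_val /= {1}/letter_val /= xb.
refine (@homotopic_trans K A v _ _ _ _ (letter_homotopic hw) _).
have e : letters_val ((p ++ lift [:: letter_val a]) ++ u) =
    letters_val (p ++ a :: u).
  by rewrite /letters_val !map_cat -/(letters_val (lift _)) lv -catA.
have := IH (p ++ lift [:: letter_val a]); rewrite e => /(_ hw).
by rewrite -letters_valE e letters_valE -!catA -lift_cat.
Qed.

Theorem realization_one_connected A :
  (forall u v, A u -> A v -> exists w, walk A [set` Y] u w /\ v = u * wprod w) ->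
  (forall v w, walk A [set` Y] v w -> wprod w = 1 ->
     htpy A [set` Y] [set` S] v w [::]) ->
  @one_connected_on K A.
Proof.
move=> conn sconn; split.
  move=> u v Au Av; have [w [hw ->]] := conn _ _ Au Av.
  by exists (word_path u (lift w)); apply: lift_edge_path.
move=> v p /edge_path_word[u [-> e hu]].
have eu : word_val u = 1 by apply: (@mulgI _ v); rewrite -e mulg1.
have := homotopic_lift hu; rewrite eu mulg1 => h; refine (@homotopic_trans K A v _ _ _ _ h _).
have := lift_htpy (sconn v (letters_val u) hu _).
by rewrite letters_valE eu mulg1; apply.
Qed.

End Realization.

Lemma finite_lower_bound (T : eqType) (R : realType) (f : T -> R) (s : seq T) :
  (forall x, x \in s -> (0 < f x)%R) ->
  exists2 eps : R, (0 < eps)%R & forall x, x \in s -> (eps <= f x)%R.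
Proof.
elim: s => [|x s IH] h; first by exists 1%R => //; exact: ltr01.
have [|e e0 he] := IH; first by move=> y ys; apply: h; rewrite inE ys orbT.
exists (Num.min e (f x)); first by rewrite lt_min e0 h ?mem_head.
by move=> y; rewrite inE ge_min => /orP[/eqP->|/he ->//]; rewrite lexx orbT.
Qed.

(** A finite set of companions has a positive lower bound for the heights, and a
    companion can be chosen for each letter. *)
Theorem pushing_system_Sigma2 (V : groupType) (R : realType)
    (chi : character V R) (Y B : seq V) (S : seq (seq V)) special (t : V) :
  pushing_system Y B S special ->
  (forall b d, b \in B -> d \in B -> commute b d) ->
  (forall b, b \in B -> (0 < chi b)%R) -> t \in B ->
  (forall eps b_, (0 < eps)%R -> (forall b, b \in B -> (eps <= chi b)%R) ->
     (forall s, s \in Y -> b_ s \in B) ->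
     (forall s, s \in Y -> b_ s ^ s \in B) ->
     forall r, r \in S -> special r ->
       pushable chi [set` Y] [set` S] t eps b_ r) ->
  Sigma2 (char_class chi).
Proof.
case=> symY trueS overS genY presS BY sqS coverY relS comB posB tB specS.
exists chi => //; split.
  by exists t => e; have := posB t tB; rewrite e ltxx.
have [eps e0 Beps] := finite_lower_bound posB.
have /choice[b_ b_P] s : exists b, s \in Y -> b \in B /\ b ^ s \in B.
  have [sY|sY] := boolP (s \in Y); last by exists 1.
  by have [b bB bsB] := coverY s sY; exists b.
exists (realization symY trueS overS genY presS).
have genY' v : exists w, walk setT [set` Y] 1 w /\ wprod w = v.
  by have [w] := genY v; exists w.
have bB s : s \in Y -> b_ s \in B by move=> /b_P[].
have bsB s : s \in Y -> b_ s ^ s \in B by move=> /b_P[].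
have push r : r \in S -> pushable chi [set` Y] [set` S] t eps b_ r.
  move=> rS; have [[b hb]|sp] := relS r rS; last exact: specS.
  exact: (@companion_pushable _ _ chi [set` B] [set` Y] [set` S] t eps
    trueS symY BY comB e0 Beps sqS tB b_ bB bsB b r rS hb).
have [conn sconn] := @push_criterion _ _ chi [set` B] [set` Y] [set` S] t eps
  trueS symY BY comB e0 Beps sqS tB b_ bB bsB genY' presS push.
exact: realization_one_connected.
Qed.

(** * Wreath products *)

Section WreathBasics.
Variables (G H : groupType) (X : gSet G).
Local Notation Gamma := (wreath H X).
Local Notation tp := (in_top H X).
Implicit Types (u v : Gamma) (g : G) (h k : H) (x y : X).

Lemma gactK g : cancel (@gact _ X g) (gact g^-1).
Proof. by move=> x; rewrite -gactM mulVg gact1. Qed.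

Lemma gactVK g : cancel (@gact _ X g^-1) (gact g).
Proof. by move=> x; rewrite -gactM mulgV gact1. Qed.

Lemma wr_eq u v : (forall x, wr_base u x = wr_base v x) ->
  wr_top u = wr_top v -> u = v.
Proof. by case: u v => [m g] [n h] /= /dsumP-> ->. Qed.

Lemma base_mul u v x :
  wr_base (u * v) x = wr_base u x * wr_base v (gact (wr_top u)^-1 x).
Proof. by rewrite /= [LHS]dsum_mulE dsum_actE. Qed.

Lemma top_mul u v : wr_top (u * v) = wr_top u * wr_top v.
Proof. by []. Qed.

Lemma base1 x : wr_base (1 : Gamma) x = 1.
Proof. exact: dsum_oneE. Qed.

Lemma top1 : wr_top (1 : Gamma) = 1.
Proof. by []. Qed.

Lemma top_inv u : wr_top u^-1 = (wr_top u)^-1.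
Proof. by []. Qed.

Lemma base_inv u x : wr_base u^-1 x = (wr_base u (gact (wr_top u) x))^-1.
Proof. by rewrite [LHS]dsum_actE invgK [LHS]dsum_invE. Qed.

Lemma base_copy x h y : wr_base (in_copy x h) y = if y == x then h else 1.
Proof. exact: dsum_singleE. Qed.

Lemma base_top g y : wr_base (tp g : Gamma) y = 1.
Proof. exact: dsum_oneE. Qed.

Lemma top_copy x h : wr_top (in_copy x h : Gamma) = 1.
Proof. by []. Qed.

Lemma top_top g : wr_top (tp g : Gamma) = g.
Proof. by []. Qed.

Definition wrE := (base_mul, base_copy, base_top, base1, base_inv,
  top_mul, top_copy, top_top, top1, top_inv).

Lemma in_copy1 x : in_copy x 1 = 1 :> Gamma.
Proof. by apply: (@mulgI _ (in_copy x 1)); rewrite -in_copyM !mulg1. Qed.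

Lemma in_copyV x h : in_copy x h^-1 = (in_copy x h)^-1 :> Gamma.
Proof. by apply/esym/mulg1_eq; rewrite -in_copyM mulgV in_copy1. Qed.

Lemma in_top1 : tp 1 = 1.
Proof. by apply: (@mulgI _ (tp 1)); rewrite -in_topM !mulg1. Qed.

Lemma in_topV g : tp g^-1 = (tp g)^-1.
Proof. by apply/esym/mulg1_eq; rewrite -in_topM mulgV in_top1. Qed.

Lemma in_copyJ x h g : (in_copy x h : Gamma) ^ tp g = in_copy (gact g^-1 x) h.
Proof.
rewrite conjgE; apply: wr_eq => [y|].
  rewrite !wrE !(invg1, gact1, invgK, mul1g, mulg1).
  by rewrite (can2_eq (gactK g) (gactVK g)); case: ifP; rewrite ?mulg1.
by rewrite !wrE mul1g mulVg.
Qed.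

Lemma commute_copy x y h k : x != y -> commute (in_copy x h : Gamma) (in_copy y k).
Proof.
move=> xy; apply: wr_eq => [z|]; last by rewrite !wrE.
rewrite !wrE invg1 gact1; case: (eqVneq z x) => [->|_].
  by rewrite (negbTE xy) mulg1 mul1g.
by rewrite mulg1 mul1g.
Qed.

Lemma commute_copy_top x h g : gact g x = x ->
  commute (in_copy x h : Gamma) (tp g).
Proof.
move=> gx; rewrite /commute (conjgC (in_copy x h)) in_copyJ.
by rewrite -{1}gx gactK.
Qed.

(** Elements of the base have finite support, so that factors in single copies can
    be split off until an element of the top group remains. *)
Lemma wreath_ind (P : Gamma -> Prop) : (forall g, P (tp g)) ->
  (forall x h u, h != 1 -> wr_base u x = 1 -> P u -> P (in_copy x h * u)) ->
  forall u, P u.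
Proof.
move=> Ptop Pcopy u.
elim: {u}(size (finsupp (wr_base u))).+1 {-2}u (ltnSn (size (finsupp (wr_base u)))) => // n IH u.
rewrite ltnS => le_n.
have [e|/fset0Pn[x xu]] := eqVneq (finsupp (wr_base u)) fset0.
  rewrite (_ : u = tp (wr_top u)) //; apply: wr_eq => // y; rewrite base_top.
  by rewrite /dsum_fun fsfun_dflt // e inE.
pose h := wr_base u x; pose u' := in_copy x h^-1 * u.
have u'E y : wr_base u' y = if y == x then 1 else wr_base u y.
  by rewrite !wrE invg1 gact1; case: eqP => [->|_]; rewrite ?mulVg ?mul1g.
have -> : u = in_copy x h * u' by rewrite /u' in_copyV mulVKg.
have hN1 : h != 1 by rewrite /h /dsum_fun -mem_finsupp.
apply: Pcopy => //; first by rewrite u'E eqxx.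
apply: IH; apply: leq_trans le_n.
have : (finsupp (wr_base u') `<=` finsupp (wr_base u) `\ x)%fset.
  apply/fsubsetP => y; rewrite !inE !mem_finsupp.
  by rewrite -![fun_of_fsfun _ _]/(dsum_fun _ _) u'E; case: (y == x); rewrite ?eqxx.
move=> /fsubset_leq_card; rewrite (cardfsD1 x (finsupp (wr_base u))) xu.
by rewrite add1n ltnS.
Qed.

End WreathBasics.

Lemma sym_closure (V : groupType) (Y : seq V) a :
  a \in Y ++ [seq b^-1 | b <- Y] -> a^-1 \in Y ++ [seq b^-1 | b <- Y].
Proof.
rewrite !mem_cat => /orP[aY|/mapP[b bY ->]]; first by rewrite map_f ?orbT.
by rewrite invgK bY.
Qed.

Definition spanned (V : groupType) (Y : seq V) v :=
  exists2 w, walk setT [set` Y] 1 w & wprod w = v.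

Lemma spanned1 (V : groupType) (Y : seq V) : spanned Y 1.
Proof. by exists [::]. Qed.

Lemma spannedM (V : groupType) (Y : seq V) (u v : V) :
  spanned Y u -> spanned Y v -> spanned Y (u * v).
Proof.
move=> [w hw <-] [w' hw' <-]; exists (w ++ w'); last by rewrite wprod_cat.
by apply/walk_cat; split=> //; apply: walk_move hw'.
Qed.

Lemma spanned_letter (V : groupType) (Y : seq V) v : v \in Y -> spanned Y v.
Proof. by move=> vY; exists [:: v]; rewrite /= ?mulg1. Qed.

Section CopyCharacters.
Variables (R : realType) (G H : groupType) (X : gSet G).
Variable chi : character (wreath H X) R.
Local Notation T := (copy_support chi).
Implicit Types (g : G) (h k : H) (x y : X).

Lemma chi_copy_act g x h : chi (in_copy (gact g x) h) = chi (in_copy x h).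
Proof. by rewrite -(charJ chi _ (in_top H X g)) in_copyJ gactK. Qed.

(** A choice that depends on [x] only through the restriction of [chi] to the copy
    at [x], and hence is constant on orbits. *)
Definition lifter x : H := xget 1 [set h | (0 < chi (in_copy x h))%R].

Lemma lifter_act g x : lifter (gact g x) = lifter x.
Proof.
by congr xget; apply/seteqP; split=> h /=; rewrite chi_copy_act.
Qed.

Lemma copy_support_act g x : T x -> T (gact g x).
Proof. by move=> [h hx]; exists h; rewrite /= chi_copy_act. Qed.

Lemma copy_support_pos x : T x -> exists h, (0 < chi (in_copy x h))%R.
Proof.
move=> [h /= hx]; have [?|?|e] := ltgtP 0%R (chi (in_copy x h)).
- by exists h.
- by exists h^-1; rewrite in_copyV charV oppr_gt0.
by case: hx; rewrite e.
Qed.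

Lemma lifter_pos x : T x -> (0 < chi (in_copy x (lifter x)))%R.
Proof. by move=> /copy_support_pos/(xgetPex 1). Qed.

End CopyCharacters.

(** * A presentation of the wreath product by words with companions *)

Section CompanionPresentation.
Variables (R : realType) (G H : groupType) (X : gSet G).
Variable chi : character (wreath H X) R.
Local Notation Gamma := (wreath H X).
Local Notation T := (copy_support chi).
Local Notation tp := (in_top H X).
Implicit Types (g c : G) (h k : H) (p f z : X) (q : seq G) (v : Gamma).

Let a_ f : Gamma := in_copy f (lifter chi f).

Lemma lifterJ f g : a_ f ^ tp g = a_ (gact g^-1 f).
Proof. by rewrite /a_ in_copyJ lifter_act. Qed.

(** [E] is a finite set of points of [T] containing [x] and [y], large enough to
    miss any two given points unless these are [x] and [y].  [Cl] lists elements of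
    the top group that serve as further companions, and [Hx] lists elements of [H]
    that are wanted as letters. *)
Variables (P : finite_presentation Gamma) (Hx : seq H).
Variables (x y : X) (E : seq X) (Cl : seq G).
Hypotheses (ET : [set` E] `<=` T) (xE : x \in E) (yE : y \in E) (xy : x != y).
Hypothesis pairE : forall p p', p != p' ->
  [\/ exists f, [/\ f \in E, f != p & f != p'],
      p = x /\ p' = y | p = y /\ p' = x].

(** The reservoir of companions. *)
Definition lifters : set Gamma :=
  [set a_ f | f in T] `|` [set tp c | c in [set` Cl]].

Let Y0 : seq Gamma := enum_fset (gens P).
Let sups (v : Gamma) : seq X := enum_fset (finsupp (wr_base v)).

Definition top_letters : seq G :=
  let Y := [seq wr_top v | v <- Y0] ++ Cl in Y ++ [seq g^-1 | g <- Y].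

Definition points : seq X := E ++ flatten [seq sups v | v <- Y0].

Definition copy_letters : seq H :=
  let Y := flatten [seq [seq wr_base v z | z <- sups v] | v <- Y0] ++
    [seq lifter chi f | f <- E] ++ Hx in Y ++ [seq h^-1 | h <- Y].

Definition wreath_letters : seq Gamma :=
  [seq tp g | g <- top_letters] ++
  [seq in_copy z h | z <- points, h <- copy_letters].

Local Notation YG := top_letters.
Local Notation YH := copy_letters.
Local Notation Z := points.
Local Notation Y1 := wreath_letters.

Lemma top_lettersV g : g \in YG -> g^-1 \in YG.
Proof. exact: sym_closure. Qed.

Lemma copy_lettersV h : h \in YH -> h^-1 \in YH.
Proof. exact: sym_closure. Qed.

Lemma wreath_lettersP v : v \in Y1 <->
  (exists2 g, g \in YG & v = tp g) \/
  (exists z h, [/\ z \in Z, h \in YH & v = in_copy z h]).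
Proof.
rewrite mem_cat; split=> [/orP[/mapP[g gY ->]|/allpairsP[[z h] [/= zZ hY ->]]]|].
- by left; exists g.
- by right; exists z, h.
move=> [[g gY ->]|[z [h [zZ hY ->]]]]; first by rewrite map_f.
by apply/orP; right; apply/allpairsP; exists (z, h).
Qed.

Lemma top_letter g : g \in YG -> tp g \in Y1.
Proof. by move=> gY; apply/wreath_lettersP; left; exists g. Qed.

Lemma copy_letter z h : z \in Z -> h \in YH -> in_copy z h \in Y1.
Proof. by move=> zZ hY; apply/wreath_lettersP; right; exists z, h. Qed.

Lemma sym_wreath_letters : sym_letters [set` Y1].
Proof.
move=> v /= /wreath_lettersP[[g gY ->]|[z [h [zZ hY ->]]]].
  by rewrite -in_topV; apply/top_letter/top_lettersV.
by rewrite -in_copyV; apply: copy_letter => //; apply: copy_lettersV.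
Qed.

Lemma E_points f : f \in E -> f \in Z.
Proof. by move=> fE; rewrite mem_cat fE. Qed.

Lemma lifter_letter f : f \in E -> a_ f \in Y1.
Proof.
move=> fE; apply: copy_letter; first exact: E_points.
by rewrite !mem_cat map_f ?orbT.
Qed.

Lemma gen_top v : v \in Y0 -> wr_top v \in YG.
Proof. by move=> vY; rewrite !mem_cat map_f. Qed.

Lemma gen_base v p : v \in Y0 ->
  wr_base v p = 1 \/ p \in Z /\ wr_base v p \in YH.
Proof.
move=> vY; have [pv|pv] := boolP (p \in finsupp (wr_base v)); last first.
  by left; rewrite /dsum_fun fsfun_dflt.
right; split.
  rewrite mem_cat; apply/orP; right; apply/flattenP; exists (sups v) => //.
  exact: map_f.
rewrite !mem_cat -!orbA; apply/orP; left; apply/flattenP.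
exists [seq wr_base v z | z <- sups v]; last exact: map_f.
exact: (map_f (fun v => [seq wr_base v z | z <- sups v])).
Qed.

(** Finite generation passes to the top group, to [H] and to the chosen letters by
    looking at the coordinates of the given generators. *)
Lemma spanned_gens (Q : Gamma -> Prop) : Q 1 ->
  (forall u v, Q u -> Q v -> Q (u * v)) ->
  (forall v, v \in Y0 -> Q v /\ Q v^-1) -> forall v, Q v.
Proof.
move=> Q1 QM QY v; have [w <-] := gensP P v.
elim: w => [|a w IH]; first by rewrite /word_val big_nil.
rewrite word_val_cons; apply: QM => //.
have [Qa QaV] := QY (fsval a.1) (fsvalP a.1).
by rewrite /letter_val; case: ifP.
Qed.

Lemma top_letters_generate : word_generates [set` YG].
Proof.
move=> g; rewrite -(top_top H X g); move: (tp g).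
apply: spanned_gens => [|u v hu hv|v vY].
- exact: spanned1.
- exact: spannedM.
have vG := gen_top vY; split; apply: spanned_letter => //.
exact: top_lettersV.
Qed.

Lemma copy_letters_generate : word_generates [set` YH].
Proof.
move=> h; have -> : h = wr_base (in_copy x h) x by rewrite base_copy eqxx.
move: (in_copy x h) => v; move: x; move: v.
apply: spanned_gens => [p|u v hu hv p|v vY].
- rewrite base1; exact: spanned1.
- rewrite base_mul; exact: spannedM.
have base p : spanned YH (wr_base v p) /\ spanned YH (wr_base v p)^-1.
  have [->|[_ hY]] := gen_base p vY; first by rewrite invg1; split; apply: spanned1.
  by split; apply: spanned_letter => //; apply: copy_lettersV.
by split=> p; [have [] := base p|rewrite base_inv; have [] := base (gact (wr_top v) p)].
Qed.

Lemma spanned_top g : spanned Y1 (tp g).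
Proof.
have [w hw <-] := top_letters_generate g; elim: w hw => [|a w IH].
  by rewrite in_top1 => _; apply: spanned1.
move=> [_ aY /walk_move/IH hw]; rewrite /= in_topM; apply: spannedM => //.
exact/spanned_letter/top_letter.
Qed.

Lemma spanned_copy z h : z \in Z -> spanned Y1 (in_copy z h).
Proof.
move=> zZ; have [w hw <-] := copy_letters_generate h; elim: w hw => [|a w IH].
  by rewrite in_copy1 => _; apply: spanned1.
move=> [_ aY /walk_move/IH hw]; rewrite /= in_copyM; apply: spannedM => //.
exact/spanned_letter/copy_letter.
Qed.

Lemma wreath_letters_generate : word_generates [set` Y1].
Proof.
apply: spanned_gens => [|u v hu hv|v vY]; [exact: spanned1|exact: spannedM|].
suff sv : spanned Y1 v.
  split=> //; have [w hw <-] := sv; exists (winv w); last by rewrite wprod_winv.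
  exact/walk_move/(walk_winv sym_wreath_letters hw).
have : forall p, wr_base v p = 1 \/ p \in Z.
  by move=> p; have [|[]] := gen_base p vY; [left|right].
move: v {vY}; apply: wreath_ind => [g _|p h v hN1 vp IH hZ].
  exact: spanned_top.
apply: spannedM.
  apply: spanned_copy; have [|//] := hZ p.
  by rewrite !wrE eqxx invg1 gact1 vp mulg1 => e; rewrite e eqxx in hN1.
apply: IH => p'; have [->|p'p] := eqVneq p' p; first by left.
by have := hZ p'; rewrite !wrE (negbTE p'p) invg1 gact1 mul1g.
Qed.

Definition basic_commutators : set (seq Gamma) :=
  [set r | exists h h', [/\ h \in YH, h' \in YH &
     r = [:: in_copy x h; in_copy y h'; (in_copy x h)^-1; (in_copy y h')^-1]]].

Lemma basic_commutators_true r : basic_commutators r ->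
  walk setT [set` Y1] 1 r /\ wprod r = 1.
Proof.
move=> [h [h' [hY hY' ->]]]; split.
  have [xZ yZ] : x \in Z /\ y \in Z by split; apply: E_points.
  have sV := sym_wreath_letters; split=> //; first exact: copy_letter.
  split=> //; first exact: copy_letter.
  split=> //; first by apply: sV; apply: copy_letter.
  by split=> //; apply: sV; apply: copy_letter.
rewrite /= mulg1 mulgA (commute_copy h h' xy) -mulgA mulVKg mulgV //.
Qed.

Local Notation Sinf := (companion_words Y1 lifters `|` basic_commutators).
Local Notation trivially := (htpy setT [set` Y1] Sinf).

Let trueSinf : true_words Sinf.
Proof. by move=> r [[]|/basic_commutators_true[]]. Qed.

(** The triple [(q, z, h)] stands for the conjugate by the top word [q] of the
    letter [h] in the copy at [z], an element of the copy at [cl_point]. *)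
Definition conj_letter : Type := (seq G * X * H)%type.
Implicit Types (d : conj_letter) (ds : seq conj_letter).

Definition cl_word d : seq Gamma :=
  [seq tp g | g <- d.1.1] ++ in_copy d.1.2 d.2 :: winv [seq tp g | g <- d.1.1].
Definition cl_point d : X := gact (wprod d.1.1) d.1.2.
Definition cl_inv d : conj_letter := (d.1, d.2^-1).
Definition cl_valid d :=
  [&& all (mem YG) d.1.1, d.1.2 \in Z & d.2 \in YH].
Definition cl_words ds : seq Gamma := flatten [seq cl_word d | d <- ds].

Lemma cl_words_cat ds ds' : cl_words (ds ++ ds') = cl_words ds ++ cl_words ds'.
Proof. by rewrite /cl_words map_cat flatten_cat. Qed.

Lemma cl_words1 d : cl_words [:: d] = cl_word d.
Proof. exact: cats0. Qed.

Lemma wprod_tops q : wprod [seq tp g | g <- q] = tp (wprod q).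
Proof. by elim: q => [|g q IH] /=; rewrite ?in_top1 // in_topM IH. Qed.

Lemma winv_tops q : winv [seq tp g | g <- q] = [seq tp g | g <- winv q].
Proof.
rewrite /winv map_rev -!map_comp; congr rev; apply: eq_map => g /=.
by rewrite in_topV.
Qed.

Lemma wprod_cl_word d : wprod (cl_word d) = in_copy (cl_point d) d.2.
Proof.
rewrite wprod_cat /= wprod_winv wprod_tops /cl_point; set g := wprod d.1.1.
have -> : in_copy (gact g d.1.2) d.2 = in_copy d.1.2 d.2 ^ tp g^-1.
  by rewrite in_copyJ invgK.
by rewrite conjgE in_topV invgK.
Qed.

Lemma wprod_pair d d' : wprod (cl_words ([:: d] ++ [:: d'])) =
  in_copy (cl_point d) d.2 * in_copy (cl_point d') d'.2.
Proof. by rewrite cl_words_cat wprod_cat !cl_words1 !wprod_cl_word. Qed.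

Lemma winv_cl_word d : winv (cl_word d) = cl_word (cl_inv d).
Proof.
rewrite /cl_word -cat1s !winv_cat winvK -catA; congr (_ ++ _).
by rewrite /winv /= in_copyV.
Qed.

Lemma cl_validV d : cl_valid d -> cl_valid (cl_inv d).
Proof. by case/and3P=> ? ? /copy_lettersV ?; apply/and3P. Qed.

Lemma winv_cl_words ds : winv (cl_words ds) = cl_words (rev (map cl_inv ds)).
Proof.
elim: ds => [|d ds IH] //; rewrite [cl_words _]/= winv_cat winv_cl_word IH.
by rewrite /= rev_cons -cats1 cl_words_cat cl_words1.
Qed.

Lemma walk_tops v q : all (mem YG) q -> walk setT [set` Y1] v [seq tp g | g <- q].
Proof.
elim: q v => [|g q IH] v //= /andP[gY /IH hq]; split=> //.
exact: top_letter.
Qed.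

Lemma walk_cl_word v d : cl_valid d -> walk setT [set` Y1] v (cl_word d).
Proof.
case/and3P=> qY zZ hY; have hq := walk_tops _ qY.
apply/walk_cat; split=> //; split=> //; first exact: copy_letter.
exact/walk_move/(walk_winv sym_wreath_letters (hq 1)).
Qed.

Lemma walk_cl_words v ds : all cl_valid ds -> walk setT [set` Y1] v (cl_words ds).
Proof.
elim: ds v => [|d ds IH] v //= /andP[/walk_cl_word hd /IH hds].
by apply/(walk_cat _ _ _ (cl_word d)).
Qed.

Lemma lifters_a f : T f -> lifters (a_ f).
Proof. by move=> Tf; left; exists f. Qed.

(** Top words carry every [a_f] along, moving the point [f]. *)
Lemma companion_tops f q : T f ->
  companion lifters (a_ f) [seq tp g | g <- q] /\
  a_ f ^ wprod [seq tp g | g <- q] = a_ (gact (wprod q)^-1 f).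
Proof.
elim: q f => [|g q IH] f Tf /=.
  by rewrite conjg1 invg1 gact1; split=> //; split=> //; apply: lifters_a.
have [h1 h2] := IH _ (copy_support_act g^-1 Tf).
rewrite conjgM lifterJ h2 invgM gactM; split=> //; split=> //.
exact: lifters_a.
Qed.

(** Carried along [q], the point [f] becomes different from [z], because
    [cl_point d] is different from [f]; the middle letter then commutes with the
    companion, and the way back along [q] restores [f]. *)
Lemma companion_cl_word f d : T f -> f != cl_point d ->
  companion lifters (a_ f) (cl_word d) /\ a_ f ^ wprod (cl_word d) = a_ f.
Proof.
move=> Tf fp; split; last first.
  by rewrite wprod_cl_word; apply/commute_conj/commute_copy.
have [h1 h2] := companion_tops d.1.1 Tf; apply/companion_cat; split=> //.
rewrite h2; set f' := gact _ f; have Tf' : T f' by apply: copy_support_act.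
have f'z : f' != d.1.2.
  by apply: contra fp => /eqP e; rewrite /cl_point -e gactVK.
split; first exact: lifters_a.
have -> : a_ f' ^ in_copy d.1.2 d.2 = a_ f' by apply/commute_conj/commute_copy.
by rewrite winv_tops; case: (companion_tops (winv d.1.1) Tf').
Qed.

Lemma companion_cl_words f ds : T f -> (forall d, d \in ds -> f != cl_point d) ->
  companion lifters (a_ f) (cl_words ds) /\ a_ f ^ wprod (cl_words ds) = a_ f.
Proof.
move=> Tf; elim: ds => [|d ds IH] h.
  by rewrite /= conjg1; split=> //; split=> //; apply: lifters_a.
have [h1 h2] := companion_cl_word Tf (h d (mem_head _ _)).
have [|h3 h4] := IH; first by move=> d' d'ds; apply: h; rewrite inE d'ds orbT.
rewrite [cl_words _]/= wprod_cat conjgM h2 h4; split=> //.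
by apply/(companion_cat _ _ (cl_word d)); rewrite h2.
Qed.

Lemma null_companion v f w : f \in E -> walk setT [set` Y1] 1 w -> wprod w = 1 ->
  companion lifters (a_ f) w -> trivially v w [::].
Proof.
move=> fE hw ew hc; apply: (@htpy_move _ _ _ 1).
rewrite -[w]cats0 -[X in htpy _ _ _ _ X _]cat0s.
apply: htpy_face; last by rewrite /= cats0.
by left; split=> //; exists (a_ f) => //; apply: lifter_letter.
Qed.

Lemma null_cl_words v f ds : f \in E -> all cl_valid ds ->
  (forall d, d \in ds -> f != cl_point d) -> wprod (cl_words ds) = 1 ->
  trivially v (cl_words ds) [::].
Proof.
move=> fE vds hf e; apply: (@null_companion _ f) => //.
  exact: walk_cl_words.
by have [] := companion_cl_words (ET fE) hf.
Qed.

Lemma off_point p : exists2 f, f \in E & f != p.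
Proof.
have [->|xp] := eqVneq p x; first by exists y => //; rewrite eq_sym.
by exists x => //; rewrite eq_sym.
Qed.

(** Words supported at one point avoid a point of [E]. *)
Lemma cl_words_eq p v ds ds' : all cl_valid ds -> all cl_valid ds' ->
  (forall d, d \in ds ++ ds' -> cl_point d = p) ->
  wprod (cl_words ds) = wprod (cl_words ds') ->
  trivially v (cl_words ds) (cl_words ds').
Proof.
move=> vds vds' hp e.
apply: (htpy_of_null trueSinf sym_wreath_letters) => //; try exact: walk_cl_words.
have [f fE fp] := off_point p; rewrite winv_cl_words -cl_words_cat.
apply: (@null_cl_words _ f) => //.
- rewrite all_cat vds all_rev all_map; apply: sub_all vds' => d /=.
  exact: cl_validV.
- move=> d dds; rewrite (_ : cl_point d = p) //.
  move: dds; rewrite mem_cat mem_rev => /orP[d1|/mapP[d' d1 ->]].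
    by apply: hp; rewrite mem_cat d1.
  by rewrite -(hp d') // mem_cat d1 orbT.
by rewrite cl_words_cat -winv_cl_words wprod_cat wprod_winv e mulgV.
Qed.

Lemma copies_swap v u u' : all (mem YH) u -> all (mem YH) u' ->
  trivially v ([seq in_copy x h | h <- u] ++ [seq in_copy y h | h <- u'])
    ([seq in_copy y h | h <- u'] ++ [seq in_copy x h | h <- u]).
Proof.
have [xZ yZ] : x \in Z /\ y \in Z by split; apply: E_points.
have wk (z : X) : z \in Z -> forall v u, all (mem YH) u ->
    walk setT [set` Y1] v [seq in_copy z h | h <- u].
  move=> zZ v' u1; elim: u1 v' => [|h u1 IH] v' //= /andP[hY /IH ?].
  by split=> //; apply: copy_letter.
have sw v' h h' : h \in YH -> h' \in YH ->
    trivially v' [:: in_copy x h; in_copy y h'] [:: in_copy y h'; in_copy x h].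
  move=> hY hY'; apply: (htpy_rel trueSinf sym_wreath_letters).
  - by right; exists h, h'.
  - by split=> //; [exact: copy_letter|split=> //; exact: copy_letter].
  by split=> //; [exact: copy_letter|split=> //; exact: copy_letter].
have sw1 v' h u1 : h \in YH -> all (mem YH) u1 ->
    trivially v' (in_copy x h :: [seq in_copy y h | h <- u1])
      ([seq in_copy y h | h <- u1] ++ [:: in_copy x h]).
  move=> hY; elim: u1 v' => [|h' u1 IH] v' /=.
    by move=> _; apply: htpy_refl; split=> //; apply: copy_letter.
  case/andP=> hY' vu1.
  apply: (@htpy_trans _ _ _ _ _ ([:: in_copy y h'; in_copy x h] ++
    [seq in_copy y h | h <- u1])).
    apply: (@htpy_catr _ _ _ _ _ _ [:: _; _]) => //; [exact: wk|exact: sw].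
  apply: (@htpy_catl _ _ _ _ _ [:: in_copy y h']); last exact: IH.
  by split=> //; apply: copy_letter.
move=> + vu'; elim: u v => [|h u IH] v.
  by move=> _; rewrite cats0; apply: htpy_refl; apply: wk.
case/andP=> hY vu /=.
apply: (@htpy_trans _ _ _ _ _ ([:: in_copy x h] ++
    ([seq in_copy y h | h <- u'] ++ [seq in_copy x h | h <- u]))).
  apply: (@htpy_catl _ _ _ _ _ [:: in_copy x h]); last exact: IH.
  by split=> //; apply: copy_letter.
rewrite -(cat1s _ [seq in_copy x h | h <- u]) !catA.
by apply: htpy_catr => //; [exact: wk|exact: sw1].
Qed.

Lemma cl_word_copies v d : cl_valid d ->
  exists2 u, all (mem YH) u & forall z, z \in Z -> cl_point d = z ->
    trivially v (cl_word d) [seq in_copy z h | h <- u].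
Proof.
move=> vd; have [u hu eu] := copy_letters_generate d.2.
have vu : all (mem YH) u by apply/allP => h hin; apply: (iffLR (walk_setT _ _ _) hu).
exists u => // z zZ ez.
pose ds := [seq (([::], z), h) : conj_letter | h <- u].
have e : cl_words ds = [seq in_copy z h | h <- u].
  by rewrite /cl_words /ds -map_comp; elim: (u) => //= h u' ->.
have ept d' : d' \in ds -> cl_point d' = z.
  by move=> /mapP[h _ ->]; rewrite /cl_point /= gact1.
rewrite -e -cl_words1; apply: (@cl_words_eq z) => //.
- by rewrite /= vd.
- apply/allP => d' /mapP[h hin ->]; rewrite /cl_valid /= zZ /=.
  exact: (allP vu).
- by move=> d'; rewrite inE => /orP[/eqP->|/ept].
rewrite cl_words1 wprod_cl_word ez e -eu; elim: (u) => [|h u' IH] /=.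
  by rewrite in_copy1.
by rewrite in_copyM IH.
Qed.

(** If some point of [E] differs from both supports, the commutator has a
    companion.  Otherwise the supports are [x] and [y]; both conjugates are then
    words in the letters of their copies, which commute by the basic
    commutators. *)
Lemma cl_word_swap v d d' : cl_valid d -> cl_valid d' ->
  cl_point d != cl_point d' ->
  trivially v (cl_word d ++ cl_word d') (cl_word d' ++ cl_word d).
Proof.
move=> vd vd' dd'.
have [[f [fE fd fd']]|[dx dy]|[dy dx]] := pairE dd'.
- rewrite -(cl_words1 d) -(cl_words1 d') -!cl_words_cat.
  apply: (htpy_of_null trueSinf sym_wreath_letters).
  + by apply: walk_cl_words; rewrite /= vd vd'.
  + by apply: walk_cl_words; rewrite /= vd vd'.
  + by rewrite !wprod_pair; apply: commute_copy.
  rewrite winv_cl_words -cl_words_cat; apply: (@null_cl_words _ f) => //.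
  + by rewrite /= vd vd' /= !cl_validV.
  + by move=> d1; rewrite !inE => /or4P[] /eqP->.
  rewrite cl_words_cat -winv_cl_words wprod_cat wprod_winv.
  by rewrite !wprod_pair (commute_copy _ _ dd') mulgV.
- have [u vu hu] := cl_word_copies 1 vd; have [u' vu' hu'] := cl_word_copies 1 vd'.
  have {}hu := hu x (E_points xE) dx; have {}hu' := hu' y (E_points yE) dy.
  apply: (htpy_trans (htpy_cat trueSinf (htpy_move v hu) (htpy_move _ hu'))).
  apply: (htpy_trans (copies_swap v vu vu')).
  apply: htpy_sym; apply: (htpy_cat trueSinf (htpy_move v hu') (htpy_move _ hu)).
have [u vu hu] := cl_word_copies 1 vd; have [u' vu' hu'] := cl_word_copies 1 vd'.
have {}hu := hu y (E_points yE) dy; have {}hu' := hu' x (E_points xE) dx.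
apply: (htpy_trans (htpy_cat trueSinf (htpy_move v hu) (htpy_move _ hu'))).
apply: (htpy_trans (htpy_sym (copies_swap v vu' vu))).
apply: htpy_sym; apply: (htpy_cat trueSinf (htpy_move v hu') (htpy_move _ hu)).
Qed.

Lemma cl_words_sort v p ds : all cl_valid ds ->
  trivially v (cl_words ds)
    (cl_words ([seq d <- ds | cl_point d == p] ++ [seq d <- ds | cl_point d != p])).
Proof.
have past v' d ds' : cl_valid d -> all cl_valid ds' ->
    (forall d', d' \in ds' -> cl_point d != cl_point d') ->
    trivially v' (cl_words (d :: ds')) (cl_words (ds' ++ [:: d])).
  move=> vd; elim: ds' v' => [|d' ds' IH] v'.
    by move=> _ _; apply: htpy_refl; apply: walk_cl_words; rewrite /= vd.
  case/andP=> vd' vds' h.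
  apply: (@htpy_trans _ _ _ _ _ ((cl_word d' ++ cl_word d) ++ cl_words ds')).
    rewrite -(cat1s d) cl_words_cat -(cat1s d') cl_words_cat !cl_words1 catA.
    apply: htpy_catr => //; first exact: walk_cl_words.
    by apply: cl_word_swap => //; apply: h; rewrite mem_head.
  rewrite -catA -{1}(cl_words1 d) -cl_words_cat [cl_words (_ ++ [:: d])]/=.
  apply: htpy_catl; first exact: walk_cl_word.
  by apply: IH => // d1 d1ds; apply: h; rewrite inE d1ds orbT.
elim: ds v => [|d ds IH] v; first by move=> _; apply: htpy_refl.
case/andP=> vd vds /=; have [dp|dp] := eqVneq (cl_point d) p.
  rewrite [cl_words (d :: _)]/= [cl_words (_ ++ _)]/=.
  by apply: htpy_catl; [exact: walk_cl_word|exact: IH].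
set A := [seq _ <- _ | _] in IH *; set B := [seq _ <- ds | _] in IH *.
have vA : all cl_valid A by rewrite all_filter; apply: sub_all vds => ? /= ->; rewrite implybT.
have vB : all cl_valid B by rewrite all_filter; apply: sub_all vds => ? /= ->; rewrite implybT.
apply: (@htpy_trans _ _ _ _ _ (cl_words ([:: d] ++ (A ++ B)))).
  rewrite -(cat1s d ds) (cl_words_cat [:: d] ds) (cl_words_cat [:: d] (A ++ B)).
  apply: htpy_catl.
    by rewrite cl_words1; apply: walk_cl_word.
  exact: IH.
rewrite catA -(cat1s d B) (catA A) (cl_words_cat ([:: d] ++ A) B)
  (cl_words_cat (A ++ [:: d]) B).
apply: htpy_catr => //; first exact: walk_cl_words.
apply: past => // d'; rewrite mem_filter => /andP[/eqP-> _].
exact: dp.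
Qed.

Lemma cl_words_top ds : wr_top (wprod (cl_words ds)) = 1.
Proof.
elim: ds => [|d ds IH] //; rewrite [cl_words _]/= wprod_cat wprod_cl_word.
by rewrite top_mul IH top_copy mulg1.
Qed.

Lemma cl_words_base ds p : (forall d, d \in ds -> cl_point d != p) ->
  wr_base (wprod (cl_words ds)) p = 1.
Proof.
elim: ds => [|d ds IH] h; first by rewrite base1.
rewrite [cl_words _]/= wprod_cat wprod_cl_word base_mul base_copy top_copy.
rewrite invg1 gact1 IH; last by move=> d' d'ds; apply: h; rewrite inE d'ds orbT.
by rewrite eq_sym (negbTE (h d (mem_head _ _))) mulg1.
Qed.

(** Collect the factors at the point of the first one.  The product at this point
    is trivial, since the remaining factors have no coordinate there; so this part
    is null by [cl_words_eq], and the rest is shorter. *)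
Lemma cl_words_null v ds : all cl_valid ds -> wprod (cl_words ds) = 1 ->
  trivially v (cl_words ds) [::].
Proof.
elim: {ds}(size ds).+1 {-2}ds (ltnSn (size ds)) v => // n IH [|d ds] le_n v vds e.
  exact: htpy_refl.
pose p := cl_point d.
have := cl_words_sort v p vds.
set A := [seq _ <- _ | _]; set B := [seq _ <- d :: ds | _] => hAB.
have vA : all cl_valid A by rewrite all_filter; apply: sub_all vds => ? /= ->; rewrite implybT.
have vB : all cl_valid B by rewrite all_filter; apply: sub_all vds => ? /= ->; rewrite implybT.
have [_ _] := htpy_walk trueSinf hAB; rewrite e cl_words_cat wprod_cat => /esym eAB.
have pA d' : d' \in A -> cl_point d' = p by rewrite mem_filter => /andP[/eqP].
have pB d' : d' \in B -> cl_point d' != p by rewrite mem_filter => /andP[].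
have A1 : wprod (cl_words A) = 1.
  apply: wr_eq => [z|]; last by rewrite cl_words_top.
  rewrite base1; have [->|zp] := eqVneq z p.
    have : wr_base (wprod (cl_words A) * wprod (cl_words B)) p = 1.
      by rewrite eAB base1.
    by rewrite base_mul cl_words_top invg1 gact1 (cl_words_base pB) mulg1.
  by apply: cl_words_base => d' /pA->; rewrite eq_sym.
have B1 : wprod (cl_words B) = 1 by move: eAB; rewrite A1 mul1g.
apply: (htpy_trans hAB); rewrite cl_words_cat -[X in htpy _ _ _ _ _ X]cats0.
apply: htpy_cat => //.
  by apply: (@cl_words_eq p _ _ [::]) => // d'; rewrite cats0 => /pA.
apply: IH => //; move: le_n; rewrite ltnS /= => /(leq_trans _); apply.
by rewrite /B /= eqxx /= ltnS size_filter count_size.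
Qed.

(** Top letters are moved to the right and conjugate the copy letters that they
    pass. *)
Lemma word_normal_form q w : all (mem YG) q -> walk setT [set` Y1] 1 w ->
  exists ds q', [/\ all cl_valid ds, all (mem YG) q' & forall v,
    trivially v ([seq tp g | g <- q] ++ w) (cl_words ds ++ [seq tp g | g <- q'])].
Proof.
elim: w q => [|a w IH] q vq.
  move=> _; exists [::], q; split=> // v; rewrite cats0; apply: htpy_refl.
  exact: walk_tops.
move=> [_ aY /walk_move hw]; case/wreath_lettersP: aY => [[g gY ->]|].
  have [||ds [q' [vds vq' h]]] := IH (q ++ [:: g]); last first.
  - by exists ds, q'; split=> // v; have := h v; rewrite map_cat -catA.
  - exact: hw.
  by rewrite all_cat vq /= gY.
move=> [z [h [zZ hY ->]]]; have [|ds [q' [vds vq' hds]]] := IH q vq; first exact: hw.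
have vd : cl_valid (q, z, h) by apply/and3P.
exists ((q, z, h) :: ds), q'; split=> //; first by rewrite /= vd.
move=> v; rewrite [cl_words _]/= -catA.
apply: (@htpy_trans _ _ _ _ _ (cl_word (q, z, h) ++ [seq tp g | g <- q] ++ w));
  last by apply: htpy_catl; [exact: walk_cl_word|exact: hds].
apply: htpy_sym; rewrite /cl_word /= -!catA; apply: htpy_catl.
  exact: walk_tops.
set Q := [seq tp g | g <- q]; set v' := v * _.
change (trivially v' ([:: in_copy z h] ++ (winv Q ++ Q ++ w))
  ([:: in_copy z h] ++ w)).
apply: htpy_catl; first by split=> //; apply: copy_letter.
rewrite catA -[X in htpy _ _ _ _ _ X]cat0s; apply: htpy_catr => //.
apply: htpy_Vmul => //; first exact: sym_wreath_letters.
exact/walk_move/(walk_winv sym_wreath_letters (walk_tops 1 vq)).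
Qed.

Lemma presents_wreath : presents [set` Y1] Sinf.
Proof.
move=> w hw ew; have [||ds [q [vds vq h]]] := @word_normal_form [::] w => //.
have {}h := h 1; apply: (htpy_trans h).
have [_ _] := htpy_walk trueSinf h; rewrite /= ew wprod_cat => /esym e.
have q1 : wprod q = 1.
  by have := congr1 (@wr_top _ _ _) e; rewrite top_mul cl_words_top mul1g wprod_tops.
have t1 : wprod [seq tp g | g <- q] = 1 by rewrite wprod_tops q1 in_top1.
rewrite -[X in htpy _ _ _ _ _ X]cats0; apply: htpy_cat => //.
  by apply: cl_words_null => //; rewrite t1 mulg1 in e.
apply: (@null_companion _ x) => //; first exact: walk_tops.
by have [] := companion_tops q (ET xE).
Qed.

(** * Raising the basic commutators *)

Hypothesis Cl_pos : forall c, c \in Cl -> (0 < chi (tp c))%R.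
Hypothesis Cl_fix : forall c f, c \in Cl -> T f -> gact c f = f.
Hypothesis Cl_comm : forall c c', c \in Cl -> c' \in Cl -> commute c c'.

Lemma lifters_pos b : lifters b -> (0 < chi b)%R.
Proof. by move=> [[f Tf <-]|[c cC <-]]; [exact: lifter_pos|exact: Cl_pos]. Qed.

Lemma lifters_commute b b' : lifters b -> lifters b' -> commute b b'.
Proof.
move=> [[f Tf <-]|[c cC <-]] [[f' Tf' <-]|[c' cC' <-]].
- by have [->//|ff'] := eqVneq f f'; apply: commute_copy.
- by apply: commute_copy_top; apply: Cl_fix.
- by apply: commute_sym; apply: commute_copy_top; apply: Cl_fix.
by rewrite /commute -!in_topM Cl_comm.
Qed.

Definition base_lifters : seq Gamma := [seq a_ f | f <- E] ++ [seq tp c | c <- Cl].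

(** Only the basic commutators remain to be pushed. *)
Lemma wreath_Sigma2 (Ex : seq (seq Gamma)) :
  (forall r, r \in Ex -> companion_words Y1 lifters r) ->
  (forall Y B S (eps : R) b_, pushing_system Y B S basic_commutators ->
     {subset Y1 <= Y} -> {subset base_lifters <= B} -> {subset Ex <= S} ->
     (forall b b', b \in B -> b' \in B -> commute b b') ->
     (forall r, basic_commutators r -> r \in S) ->
     (0 < eps)%R -> (forall b, b \in B -> (eps <= chi b)%R) ->
     (forall s, s \in Y -> b_ s \in B) -> (forall s, s \in Y -> b_ s ^ s \in B) ->
     forall r, basic_commutators r ->
       pushable chi [set` Y] [set` S] (a_ x) eps b_ r) ->
  Sigma2 (char_class chi).
Proof.
move=> ExC push.
pose basics := [seq [:: in_copy x h; in_copy y h'; (in_copy x h)^-1; (in_copy y h')^-1]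
  | h <- YH, h' <- YH].
have [||s|b /=|Y [B [S [ps Y1Y EB BL ExS]]]] := @finite_pushing_system Gamma P Y1
  lifters basic_commutators (Ex ++ basics) base_lifters sym_wreath_letters
  wreath_letters_generate basic_commutators_true presents_wreath.
- move=> r; rewrite mem_cat => /orP[/ExC|/allpairsP[[h h'] [/= hY hY' ->]]].
    by left.
  by right; exists h, h'.
- move=> s /wreath_lettersP[[g gY ->]|[z [h [zZ hY ->]]]].
    exists (a_ x); first exact: lifter_letter.
    by have [] := companion_tops [:: g] (ET xE).
  have [f fE fz] := off_point z; exists (a_ f); first exact: lifter_letter.
  have Lf := lifters_a (ET fE); split=> //.
  by rewrite commute_conj; [split|apply: commute_copy].
- rewrite mem_cat => /orP[/mapP[f fE ->]|/mapP[c cC ->]]; first exact: lifter_letter.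
  by apply: top_letter; rewrite !mem_cat cC ?orbT.
- rewrite mem_cat => /orP[/mapP[f fE ->]|/mapP[c cC ->]]; last by right; exists c.
  by apply: lifters_a; apply: ET.
have comB b b' : b \in B -> b' \in B -> commute b b'.
  by move=> /BL Lb /BL Lb'; apply: lifters_commute.
apply: (@pushing_system_Sigma2 _ _ chi Y B S basic_commutators (a_ x)) => //.
- by move=> b /BL/lifters_pos.
- by apply: EB; rewrite mem_cat map_f.
move=> eps b_ e0 Be bB bsB r rS br; apply: (push Y B S) => //.
- by move=> w wE; apply: ExS; rewrite mem_cat wE.
move=> _ [h [h' [hY hY' ->]]]; apply: ExS; rewrite mem_cat; apply/orP; right.
by apply/allpairsP; exists (h, h').
Qed.

Lemma companion_commute (B : set Gamma) b w : B b ->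
  (forall a, a \in w -> commute b a) -> companion B b w.
Proof.
move=> Bb; elim: w => [|a w IH] h //=; split=> //.
rewrite commute_conj; last by apply: h; rewrite mem_head.
by apply: IH => a' a'w; apply: h; rewrite inE a'w orbT.
Qed.

Theorem wreath_Sigma2_companion b : b \in base_lifters ->
  (forall h, commute b (in_copy x h)) -> (forall h, commute b (in_copy y h)) ->
  Sigma2 (char_class chi).
Proof.
move=> bE bx by_; apply: (@wreath_Sigma2 [::]) => //.
move=> Y B S eps b_ [symY trueS _ _ _ BY sqS _ _] _ EB _ comB basS e0 Be bB bsB r br.
have rS := basS r br.
apply: (companion_pushable trueS symY BY comB e0 Be sqS _ bB bsB rS).
  by apply: EB; rewrite mem_cat map_f.
have [h [h' [_ _ ->]]] := br.
apply: (@companion_commute _ b); first exact: EB.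
move=> a; rewrite !inE => /or4P[] /eqP-> //; exact: commuteV.
Qed.

Local Notation chiH := (char_copy chi x).

Lemma walk_copies (r r' : R) v h0 u (Y : set Gamma) :
  (forall h, h \in YH -> Y (in_copy x h)) -> (r' - r <= chi v - chiH h0)%R ->
  walk (above chiH r) [set` YH] h0 u ->
  walk (above chi r') Y v [seq in_copy x h | h <- u].
Proof.
move=> YHY; rewrite /above; elim: u v h0 => [|h u IH] v h0 /= le; first by lra.
move=> [r0 hY hu]; split=> //; [lra|exact: YHY|].
by apply: IH hu; rewrite /= in_copyM !charM; lra.
Qed.

(** By hypothesis each edge [h] of the copy at [x] has a raised version inside
    that copy: a path [u] between the translates of its ends by [a_ x] which runs
    above the edge.  It is homotopic to the detour around the edge, because [a_ y]
    is a companion for all words in the copy at [x].  The push of the commutator of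
    [h] with [h'] thus becomes the commutator of [u] with [h'], which is filled by
    the grid of the commutators of the letters of [u] with [h']. *)
Theorem wreath_Sigma2_Sigma1 :
  (forall h, h \in YH -> exists2 u,
     walk (above chiH (chi (a_ x) + Num.min 0%R (chi (in_copy x h)))) [set` YH]
       (lifter chi x) u & lifter chi x * wprod u = h * lifter chi x) ->
  Sigma2 (char_class chi).
Proof.
move=> detours; pose t := a_ x.
have /choice[u_ u_P] h : exists u, h \in YH ->
    walk (above chiH (chi t + Num.min 0%R (chi (in_copy x h)))) [set` YH]
      (lifter chi x) u /\ lifter chi x * wprod u = h * lifter chi x.
  have [hY|hY] := boolP (h \in YH); last by exists [::].
  by have [u ? ?] := detours h hY; exists u.
pose U h : seq Gamma := [seq in_copy x k | k <- u_ h].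
have wprodU h : h \in YH -> wprod (U h) = in_copy x h ^ t.
  move=> hY; have [_ e] := u_P h hY; apply: (@mulgI _ t).
  rewrite -conjgC /t -in_copyM -e in_copyM; congr (_ * _); rewrite /U.
  by elim: (u_ h) => [|k u IH] /=; rewrite ?in_copy1 // IH in_copyM.
(* The relation of [H_x] that replaces the detour by [U h]. *)
pose rel h := U h ++ winv [:: t^-1; in_copy x h; t].
have xZ := E_points xE; have yZ := E_points yE.
have U_in h a : h \in YH -> a \in U h -> exists2 k, k \in YH & a = in_copy x k.
  move=> hY /mapP[k ku ->]; exists k => //; have [hw _] := u_P h hY.
  have hw' : walk setT [set` YH] (lifter chi x) (u_ h) by apply: walk_sub hw.
  exact: (iffLR (walk_setT _ _ _) hw').
have sV := sym_wreath_letters.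
have tY : t \in Y1 by apply: lifter_letter.
apply: (@wreath_Sigma2 [seq rel h | h <- YH]).
  move=> r /mapP[h hY ->]; split.
  - apply/walk_setT => a; rewrite mem_cat => /orP[/(U_in _ _ hY)[k kY ->]|].
      exact: copy_letter.
    rewrite /winv /= !inE invgK => /or3P[] /eqP-> //; first exact: sV.
    by apply: sV; apply: copy_letter.
  - by rewrite wprod_cat wprodU // wprod_winv /= mulg1 -conjgE mulgV.
  exists (a_ y); first exact: lifter_letter.
  apply: companion_commute; first exact: lifters_a (ET yE).
  move=> a; rewrite mem_cat => /orP[/(U_in _ _ hY)[k _ ->]|].
    by apply: commute_copy; rewrite eq_sym.
  have cy k : commute (a_ y) (in_copy x k) by apply: commute_copy; rewrite eq_sym.
  by rewrite /winv /= !inE invgK => /or3P[] /eqP->; try apply: commuteV; apply: cy.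
move=> Y B S eps b_ [symY trueS _ _ _ BY sqS _ _] Y1Y EB relS comB basS e0 Be bB bsB.
move=> _ [h [h' [hY hY' ->]]] c v.
have tB : t \in B by apply: EB; rewrite mem_cat map_f.
have sB : a_ y \in B by apply: EB; rewrite mem_cat map_f.
set s := a_ y in sB; set hx : Gamma := in_copy x h; set hy : Gamma := in_copy y h'.
have hxY : hx \in Y by apply/Y1Y/copy_letter.
have hyY : hy \in Y by apply/Y1Y/copy_letter.
have sh k : commute s (in_copy x k) by apply: commute_copy; rewrite eq_sym.
have th k : commute t (in_copy y k) by apply: commute_copy.
have tpos := Be t tB; have spos := Be s sB.
move=> [hv _ [hvx _ [hvxy _ [hvy' _ _]]]].
have hxy : commute hx hy by apply: commute_copy.
have hvy : above chi c (v * hy).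
  by move: hvy'; rewrite -!mulgA (mulgA hx) hxy mulgK.
pose A := above chi (c + eps).
have YHY k : k \in YH -> in_copy x k \in Y by move=> kY; apply/Y1Y/copy_letter.
have [hU eU] := u_P h hY.
have walkU m : (c + eps <= chi m + chi t + Num.min 0 (chi hx))%R ->
    walk A [set` Y] (m * t) (U h).
  by move=> le; apply: (walk_copies YHY _ hU); rewrite charM /t /=; move: le; lra.
have minP m : above chi c m -> above chi c (m * hx) ->
    (c <= chi m + Num.min 0 (chi hx))%R.
  by rewrite /above /= charM; case: (lerP 0 (chi hx)); lra.
(* The detour of [hx] with the companion [s] is [U h] conjugated by [s]. *)
have lift_x m : above chi c m -> above chi c (m * hx) ->
    htpy A [set` Y] [set` S] (m * t) (detour t (b_ hx) hx) (U h).
  move=> hm hmx; have le := minP m hm hmx.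
  have shx : s ^ hx = s := commute_conj (sh h).
  apply: (@htpy_trans _ _ _ _ _ (detour t s hx)).
    apply: (detour_htpy trueS symY BY comB e0 Be sqS tB) => //=.
    - exact: bB.
    - exact: bsB.
    - by rewrite shx.
  rewrite /detour shx.
  have wU : walk A [set` Y] (m * t) (U h) by apply: walkU; lra.
  have cU : companion [set` B] s (U h).
    apply: companion_commute => // a /(U_in _ _ hY)[k _ ->]; exact: sh.
  have := companion_conj_htpy trueS symY BY e0 Be sqS cU wU.
  rewrite wprodU // commute_conj; last first.
    by rewrite conjgE; apply: commuteM; [apply: commuteV|apply: commuteM]; apply: sh.
  move=> hUs; apply: htpy_sym; apply: (htpy_trans hUs).
  change (htpy A [set` Y] [set` S] (m * t) ([:: s] ++ U h ++ [:: s^-1])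
    ([:: s] ++ [:: t^-1; hx; t] ++ [:: s^-1])).
  have [_ wUs _] := htpy_walk trueS hUs.
  apply: (htpy_mid trueS) => //; rewrite /= mulg1.
  apply: (htpy_rel trueS symY).
  - by apply: relS; apply: (map_f rel).
  - by move: wUs => [_ _] /walk_cat[].
  move: hm hmx; rewrite /A /above /= !charE => hm hmx.
  split; [lra|exact/symY/BY|split; [lra|done|split; [lra|exact: BY|lra]]].
have inv_letter a m : a \in Y -> above chi c m -> above chi c (m * a) ->
    htpy A [set` Y] [set` S] (m * a * t) (detour t (b_ a^-1) a^-1)
      (winv (detour t (b_ a) a)).
  move=> aY hm hma; have aVY := symY _ aY.
  have -> : winv (detour t (b_ a) a) = detour t (b_ a ^ a) a^-1.
    by rewrite /detour conjgK /winv /= !invgK.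
  apply: (detour_htpy trueS symY BY comB e0 Be sqS tB) => //=.
  - exact: bB.
  - exact: bsB.
  - exact: bsB.
  - by rewrite conjgK; apply: bB.
  by rewrite mulgK.
have lift_xV m : above chi c m -> above chi c (m * hx) ->
    htpy A [set` Y] [set` S] (m * hx * t) (detour t (b_ hx^-1) hx^-1) (winv (U h)).
  move=> hm hmx; apply: (htpy_trans (inv_letter hx m hxY hm hmx)).
  have := htpy_winv trueS symY (lift_x m hm hmx).
  by rewrite (wprod_detourB comB tB) ?mulJ //; [exact: bB|exact: bsB].
have lift_y m : above chi c m -> above chi c (m * hy) ->
    htpy A [set` Y] [set` S] (m * t) (detour t (b_ hy) hy) [:: hy].
  move=> hm hmy; have thy : t ^ hy = t := commute_conj (th h').
  apply: (@htpy_trans _ _ _ _ _ (detour t t hy)).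
    apply: (detour_htpy trueS symY BY comB e0 Be sqS tB) => //=.
    - exact: bB.
    - exact: bsB.
    - by rewrite thy.
  have wd : walk A [set` Y] (m * t) (detour t t hy).
    by apply: (detour_walk symY BY e0 Be tB) => //=; rewrite thy.
  move: (wd); rewrite /detour thy => wd'.
  have h1 := @htpy_cancel _ _ _ trueS A (m * t) _ [::] [:: hy; t; t^-1] t
    (htpy_refl [set` S] wd').
  exact: (@htpy_cancel _ _ _ trueS A (m * t) _ [:: hy] [::] t h1).
have lift_yV m : above chi c m -> above chi c (m * hy) ->
    htpy A [set` Y] [set` S] (m * hy * t) (detour t (b_ hy^-1) hy^-1) [:: hy^-1].
  move=> hm hmy; apply: (htpy_trans (inv_letter hy m hyY hm hmy)).
  have := htpy_winv trueS symY (lift_y m hm hmy).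
  by rewrite (wprod_detourB comB tB) ?mulJ //; [exact: bB|exact: bsB].
have swap u m : all (mem YH) u -> walk A [set` Y] m [seq in_copy x k | k <- u] ->
    walk A [set` Y] (m * hy) [seq in_copy x k | k <- u] ->
    htpy A [set` Y] [set` S] m ([seq in_copy x k | k <- u] ++ [:: hy])
      (hy :: [seq in_copy x k | k <- u]).
  elim: u m => [|k u IH] m /=; first by move=> _ hm hmy; apply: htpy_refl.
  move=> /andP[kY vu] [hm _ hu] [hmy kYY hu'].
  have kc : in_copy x k * hy = hy * in_copy x k by apply: commute_copy.
  have hu'' : walk A [set` Y] (m * in_copy x k * hy) [seq in_copy x k | k <- u].
    by rewrite -mulgA kc mulgA.
  apply: (@htpy_trans _ _ _ _ _ ([:: in_copy x k] ++ hy :: [seq in_copy x k | k <- u])).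
    apply: (@htpy_catl _ _ _ _ _ [:: in_copy x k]).
      by split=> //; apply: walk_start hu.
    by rewrite /= mulg1; apply: IH.
  apply: (@htpy_catr _ _ _ _ _ [seq in_copy x k | k <- u] [:: _; _] [:: _; _] trueS).
    by rewrite /= mulg1 mulgA.
  apply: (htpy_rel trueS symY).
  - by apply: basS; exists k, h'.
  - split=> //; split=> //; first exact: walk_start hu.
    exact: walk_start hu''.
  split=> //; split=> //; exact: walk_start hu'.
have vU : all (mem YH) (u_ h).
  have hU' : walk setT [set` YH] (lifter chi x) (u_ h) by apply: walk_sub hU.
  by apply/allP; apply: (iffLR (walk_setT _ _ _) hU').
have hmin := minP v hv hvx.
have hminy : (c <= chi (v * hy)%g + Num.min 0 (chi hx))%R.
  by apply: minP => //; rewrite -mulgA -hxy mulgA.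
have wU1 : walk A [set` Y] (v * t) (U h) by apply: walkU; lra.
have tyE : v * t * hy = v * hy * t by rewrite -!mulgA th.
have wU2 : walk A [set` Y] (v * t * hy) (U h) by rewrite tyE; apply: walkU; lra.
have hUy := swap (u_ h) (v * t) vU wU1 wU2.
have wprod_d a : a \in Y -> wprod (detour t (b_ a) a) = a ^ t.
  by move=> aY; apply: (wprod_detourB comB tB); [exact: bB|exact: bsB].
have hvyx : above chi c (v * hy * hx) by rewrite -mulgA -hxy mulgA.
have vyx : v * hx * hy = v * hy * hx by rewrite -!mulgA hxy.
pose D a := detour t (b_ a) a.
have DE : push t b_ [:: hx; hy; hx^-1; hy^-1] = D hx ++ D hy ++ D hx^-1 ++ D hy^-1.
  by [].
apply: (@htpy_trans _ _ _ _ _ (U h ++ [:: hy] ++ winv (U h) ++ [:: hy^-1])).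
  rewrite DE; apply: (htpy_cat trueS (lift_x v hv hvx)).
  rewrite wprod_d // mulJ; apply: (htpy_cat trueS (lift_y _ hvx hvxy)).
  rewrite wprod_d // mulJ vyx; apply: (htpy_cat trueS (lift_xV _ hvy hvyx)).
  rewrite wprod_d; last exact: symY.
  by rewrite mulJ mulgK; apply: lift_yV.
have e1 : v * t * wprod (hy :: U h ++ winv (U h)) = v * t * hy.
  by rewrite /= wprod_cat wprod_winv mulgV mulg1.
have vt : A (v * t) by apply: walk_start wU1.
have vty : A (v * t * hy) by apply: walk_start wU2.
have hyVY : hy^-1 \in Y by apply: symY.
have walky : walk A [set` Y] (v * t * hy) [:: hy^-1] by split=> //=; rewrite mulgK.
apply: (@htpy_trans _ _ _ _ _ ((hy :: U h) ++ winv (U h) ++ [:: hy^-1])).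
  rewrite catA; apply: (htpy_catr trueS); last exact: hUy.
  rewrite wprod_cat /= mulg1.
  have -> : v * t * (wprod (U h) * hy) = v * t * hy * wprod (U h).
    have [_ _ e] := htpy_walk trueS hUy; move: e.
    by rewrite wprod_cat /= mulg1 => ->; rewrite !mulgA.
  apply/(walk_cat _ _ _ (winv (U h))); split; first exact: walk_winv wU2.
  by rewrite wprod_winv mulgK.
apply: (@htpy_trans _ _ _ _ _ ([:: hy] ++ [::] ++ [:: hy^-1])).
  rewrite -(cat1s hy (U h)) -(catA [:: hy]) (catA (U h)).
  apply: (htpy_mid trueS); last by rewrite /= mulg1; apply: htpy_mulV.
  apply/(walk_cat _ _ _ [:: hy]); split; first by split.
  rewrite [wprod [:: hy]]/= mulg1; apply/(walk_cat _ _ _ (U h ++ winv (U h))).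
  split; last by rewrite wprod_cat wprod_winv mulgV mulg1.
  by apply/walk_cat; split=> //; apply: walk_winv.
apply: (@htpy_spur _ _ _ _ _ [::] [::]).
by split=> //; apply: walky.
Qed.
End CompanionPresentation.

(** * Cardinalities, Cayley paths and half-spaces *)

Section Counting.
Local Open Scope card_scope.

Lemma card_ge_uniq (T : choiceType) (n : nat) (A : set T) : `I_n #<= A ->
  exists s : seq T, [/\ size s = n, uniq s & [set` s] `<=` A].
Proof.
move=> /card_leP[f].
pose mk (i : 'I_n) : set_type `I_n := 
  exist _ (i : nat) (mem_set (ltn_ord i : (`I_n : set nat) i)).
exists [seq val (f (mk i)) | i <- enum 'I_n]; split.
- by rewrite size_map size_enum_ord.
- rewrite map_inj_uniq ?enum_uniq // => i j /val_inj.
  by move/(@inj _ _ _ f _ _ (mem_set I) (mem_set I)) => /(congr1 val) /= /val_inj.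
by move=> x /= /mapP[i _ ->]; apply: set_valP.
Qed.

Lemma uniq_card_ge (T : choiceType) (n : nat) (A : set T) (s : seq T) :
  size s = n -> uniq s -> [set` s] `<=` A -> `I_n #<= A.
Proof.
move=> <-; case: s => [|x s] us sA; first by rewrite II0; apply: card_ge0.
suff [f] : $|{injfun `I_(size (x :: s)) >-> A}| by apply: (inj_card_le f).
apply/injfunPex; exists (nth x (x :: s)).
  by move=> i /= lti; apply: sA; apply: mem_nth.
by move=> i j; rewrite !inE => /= lti ltj /eqP; rewrite nth_uniq // => /eqP.
Qed.

End Counting.

Section CayleyPaths.
Variables (V : groupType) (X : {fset V}).

Definition fset_letters : set V := [set a | a \in X \/ a^-1 \in X].

Lemma fset_letters_sym : sym_letters fset_letters.
Proof. by move=> a []; [right; rewrite invgK|left]. Qed.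

Lemma letter_val_letters (a : letter X) : fset_letters (letter_val a).
Proof.
case: a => x [] /=; [left|right]; rewrite /letter_val /= ?invgK; exact: fsvalP.
Qed.

Lemma cay_path_walk A v p w : @edge_path (Cay X) A v p w ->
  exists2 u, walk A fset_letters v u & w = v * wprod u.
Proof.
elim: p v => [|[z a] p IH] v /=.
  by move=> [Av <-]; exists [::]; rewrite ?mulg1.
move=> [Av zv /IH[u]]; rewrite /= in zv *; rewrite /cay_terminus /= => hu ->.
rewrite -zv in Av *; exists (letter_val a :: u); last by rewrite /= mulgA.
by split=> //; apply: letter_val_letters.
Qed.

Lemma walk_cay_path A Y v u : Y `<=` fset_letters -> walk A Y v u ->
  exists p, @edge_path (Cay X) A v p (v * wprod u).
Proof.
move=> YX; elim: u v => [|a u IH] v /=; first by exists [::]; rewrite mulg1.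
move=> [Av /YX aX /IH[p hp]].
have [l la] : exists l : letter X, letter_val l = a.
  case: aX => aX; first by exists ([` aX]%fset, true).
  by exists ([` aX]%fset, false); rewrite /letter_val /= invgK.
by exists ((v, l) :: p); split=> //; rewrite /= /cay_terminus /= la mulgA.
Qed.

End CayleyPaths.

Section Halfspaces.
Variables (V : groupType) (R : realType).
Implicit Types chi psi : character V R.

Lemma char_class_refl chi : char_class chi chi.
Proof. by exists 1%R => [|v]; rewrite ?ltr01 ?mul1r. Qed.

Lemma halfspace_class chi psi : char_class psi = char_class chi ->
  halfspace psi = halfspace chi.
Proof.
move=> e; have : char_class psi chi by rewrite e; apply: char_class_refl.
move=> [r r0 h]; apply/seteqP; split=> v; rewrite /halfspace /= h.
  exact: mulr_ge0 (ltW r0).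
by rewrite pmulr_rge0.
Qed.

Lemma Sigma1_letters chi : Sigma1 (char_class chi) -> exists2 X : {fset V},
  generates X & @connected_on (Cay X) (halfspace chi).
Proof. by move=> [psi [_ [X genX hX]] /halfspace_class <-]; exists X. Qed.

End Halfspaces.

(** * The three sufficient conditions *)

Section Sufficiency.
Variables (R : realType) (G H : groupType) (X : gSet G).
Variable chi : character (wreath H X) R.
Local Notation Gamma := (wreath H X).
Local Notation T := (copy_support chi).
Local Notation tp := (in_top H X).
Hypothesis P : finite_presentation Gamma.

Lemma Sigma2_of_three (x y z : X) : T x -> T y -> T z -> uniq [:: x; y; z] ->
  Sigma2 (char_class chi).
Proof.
move=> Tx Ty Tz; rewrite /= !inE negb_or andbT => /andP[/andP[xy xz] yz].
pose E := [:: x; y; z].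
apply: (@wreath_Sigma2_companion R G H X chi P [::] x y E [::]
  _ _ _ xy _ _ _ _ (in_copy z (lifter chi z))) => //.
- by move=> f /=; rewrite !inE => /or3P[] /eqP->.
- by rewrite !inE eqxx.
- by rewrite !inE eqxx orbT.
- move=> p p' pp'; apply: Or31.
  have [xp|xp] := eqVneq x p; [|have [xp'|xp'] := eqVneq x p'].
  + have [yp'|yp'] := eqVneq y p'.
      by exists z; rewrite -xp -yp' !inE eqxx !orbT ![z == _]eq_sym.
    by exists y; rewrite -xp !inE eqxx orbT yp' eq_sym.
  + have [yp|yp] := eqVneq y p.
      by exists z; rewrite -yp -xp' !inE eqxx !orbT ![z == _]eq_sym.
    by exists y; rewrite -xp' !inE eqxx orbT yp eq_sym.
  by exists x; rewrite !inE eqxx.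
- rewrite mem_cat; apply/orP; left.
  by apply: (map_f (fun f => in_copy f (lifter chi f))); rewrite !inE eqxx !orbT.
- by move=> h; apply: commute_copy; rewrite eq_sym.
by move=> h; apply: commute_copy; rewrite eq_sym.
Qed.

Section TwoCopies.
Variables (x y : X).
Hypotheses (Tx : T x) (Ty : T y) (xy : x != y).
Hypothesis Txy : forall z, T z -> z = x \/ z = y.

Let E := [:: x; y].

Lemma two_points p p' : p != p' ->
  [\/ exists f, [/\ f \in E, f != p & f != p'],
      p = x /\ p' = y | p = y /\ p' = x].
Proof.
move=> pp'; have [xp|xp] := eqVneq x p.
  have [yp'|yp'] := eqVneq y p'; first by apply: Or32.
  by apply: Or31; exists y; rewrite -xp !inE eqxx orbT yp' eq_sym.
have [xp'|xp'] := eqVneq x p'; last by apply: Or31; exists x; rewrite !inE eqxx.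
have [yp|yp] := eqVneq y p; first by apply: Or33.
by apply: Or31; exists y; rewrite -xp' !inE eqxx orbT yp eq_sym.
Qed.

(** The top group acts on the set [T] of two points. *)
Lemma square_fixes (g : G) f : T f -> gact (g * g) f = f.
Proof.
have inj_g : injective (@gact _ X g) := can_inj (gactK g).
have gT z : T z -> gact g z = x \/ gact g z = y.
  by move=> Tz; apply/Txy/copy_support_act.
move=> /Txy[] ->; rewrite gactM.
  have [gx|gx] := gT x Tx; first by rewrite !gx.
  have [gy|gy] := gT y Ty; first by rewrite gx gy.
  by have /inj_g e := etrans gx (esym gy); move: (xy); rewrite e eqxx.
have [gy|gy] := gT y Ty; last by rewrite !gy.
have [gx|gx] := gT x Tx; last by rewrite gy gx.
by have /inj_g e := etrans gx (esym gy); move: (xy); rewrite e eqxx.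
Qed.

Lemma E_support : [set` E] `<=` T.
Proof. by move=> f /=; rewrite !inE => /orP[] /eqP->. Qed.

Lemma Sigma2_of_top : char_nonzero (char_top chi) -> Sigma2 (char_class chi).
Proof.
move=> [g /= hg].
(* A square fixes both points, and one of the two signs makes it positive. *)
have [c cpos cfix] : exists2 c : G, (0 < chi (tp c))%R &
    forall f, T f -> gact c f = f.
  have [gpos|gneg|//] := ltgtP 0%R (chi (tp g)); last by move=> e; rewrite e in hg.
    exists (g * g); last exact: square_fixes.
    by rewrite in_topM charM; lra.
  exists (g^-1 * g^-1); last exact: square_fixes.
  by rewrite in_topM charM in_topV charV; lra.
have fixc z k : T z -> commute (tp c) (in_copy z k).
  by move=> Tz; apply: commute_sym; apply: commute_copy_top; apply: cfix.
apply: (@wreath_Sigma2_companion R G H X chi P [::] x y E [:: c]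
  E_support _ _ xy two_points _ _ _ (tp c)).
- by rewrite !inE eqxx.
- by rewrite !inE eqxx orbT.
- by move=> c'; rewrite inE => /eqP->.
- by move=> c' f; rewrite inE => /eqP-> /cfix.
- by move=> c1 c2; rewrite !inE => /eqP-> /eqP->.
- by rewrite mem_cat; apply/orP; right; apply: map_f; rewrite inE eqxx.
- by move=> h; apply: fixc.
by move=> h; apply: fixc.
Qed.

(** Connectedness of the half-space of the copy at [x], translated by one of the
    ends of the raised edge, gives the paths that [wreath_Sigma2_Sigma1] asks
    for. *)
Lemma Sigma2_of_Sigma1 : Sigma1 (char_class (char_copy chi x)) ->
  Sigma2 (char_class chi).
Proof.
move=> /Sigma1_letters[XH genXH conn].
have xE : x \in E by rewrite !inE eqxx.
have yE : y \in E by rewrite !inE eqxx orbT.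
apply: (@wreath_Sigma2_Sigma1 R G H X chi P (enum_fset XH) x y E [::]
  E_support xE yE xy two_points) => //.
move=> h hY; set Y := copy_letters _ _ _ _ in hY *.
have XHY : fset_letters XH `<=` [set` Y].
  move=> a /= [aX|aX].
    by rewrite !mem_cat aX !orbT.
  rewrite -[a]invgK; apply: copy_lettersV.
  by rewrite !mem_cat aX !orbT.
set psi := char_copy chi x in conn *; set alpha := lifter chi x.
have psiE k : chi (in_copy x k) = psi k by [].
rewrite !psiE -/alpha; clearbody psi; set mu := Num.min _ _.
have [mu0 muh] : (mu <= 0)%R /\ (mu <= psi h)%R by rewrite !ge_min !lexx orbT.
(* [m] is the lower end of the raised edge from [alpha] to [h * alpha]. *)
have [m hm] : exists2 m : H, psi m = (psi alpha + mu)%R & True.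
  rewrite /mu; have [h0|h0] := lerP 0%R (psi h).
    by exists alpha => //; rewrite addr0.
  by exists (h * alpha) => //; rewrite charM addrC.
move=> _; have [||p /cay_path_walk[u hu e]] := conn (m^-1 * alpha) (m^-1 * (h * alpha)).
- by rewrite /halfspace /= charM charV hm; lra.
- by rewrite /halfspace /= !charM charV hm; lra.
exists u; last by apply: (@mulgI _ m^-1); rewrite mulgA -e.
have hu' : walk (above psi (psi alpha + mu)) (fset_letters XH)
    (m * (m^-1 * alpha)) u.
  by apply: walk_translate hu => z; rewrite /halfspace /above /= => hz;
    rewrite charM hm; lra.
by rewrite mulVKg in hu'; apply: walk_sub XHY hu'.
Qed.

End TwoCopies.

End Sufficiency.

(** * Necessity: a cocycle on the half-space *)

Lemma charX (V : groupType) (R : realType) (chi : character V R) v n :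
  chi (v ^+ n) = (chi v *+ n)%R.
Proof.
elim: n => [|n IH]; first by rewrite expg0 mulr0n char1.
by rewrite expgS charM IH mulrS.
Qed.

Lemma power_above (V : groupType) (R : realType) (chi : character V R) t c :
  (0 < chi t)%R -> exists n, (c <= chi (t ^+ n)%g)%R.
Proof.
move=> t0; exists (Num.bound (`|c| / chi t)).
have : (`|c| / chi t < (Num.bound (`|c| / chi t))%:R)%R.
  by apply: archi_boundP; apply: divr_ge0; rewrite ?normr_ge0 // ltW.
rewrite charX ltr_pdivrMr // -[(chi t *+ _)%R]mulr_natl => h.
by have := ler_norm c; lra.
Qed.

Lemma char_nonzero_pos (V : groupType) (R : realType) (chi : character V R) :
  char_nonzero chi -> exists v, (0 < chi v)%R.
Proof.
move=> [v hv]; have [?|?|e] := ltgtP 0%R (chi v); first by exists v.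
  by exists v^-1; rewrite charV oppr_gt0.
by case: hv.
Qed.

Definition joined (V : groupType) (A Y : set V) u v :=
  exists2 w, walk A Y u w & v = u * wprod w.

(** Otherwise, with [t] of height at least [D], the path from [a] to [b] that
    reaches down to [- D] could be translated by [t] and read in the generators
    [t^-1 * y * t]; with the generators [Y], [t] and these, the half-space would be
    connected. *)
Lemma Sigma1_gap (V : groupType) (R : realType) (chi : character V R)
    (Y : seq V) (D : R) :
  word_generates [set` Y] -> char_nonzero chi ->
  ~ Sigma1 (char_class chi) ->
  exists a b, [/\ (0 <= chi a)%R, (0 <= chi b)%R &
    ~ joined (above chi (- D)) [set` Y] a b].
Proof.
move=> genY chi0 notS; apply: contrapT => noGap; apply: notS.
have [v vpos] := char_nonzero_pos chi0.
have [n hn] := power_above (Num.max D 0%R) vpos; set t := v ^+ n in hn.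
have [tD t0] : (D <= chi t)%R /\ (0 <= chi t)%R by apply/andP; rewrite -ge_max.
pose X := [fset y in Y ++ t :: [seq y ^ t | y <- Y]]%fset.
have XE y : y \in Y ++ t :: [seq y ^ t | y <- Y] -> fset_letters X y.
  by rewrite mem_cat => h; left; rewrite /X inE !in_fset.
have tX : fset_letters X t by apply: XE; rewrite mem_cat mem_head orbT.
exists chi => //; split=> //; exists X.
  move=> u; have [w hw <-] := genY u.
  elim: w hw => [|a w IH]; first by exists [::]; rewrite /word_val big_nil.
  move=> [_ aY /walk_move/IH[l]] /= <-.
  have aX : a \in X by rewrite /X inE in_fset aY.
  by exists (([` aX]%fset, true) :: l); rewrite word_val_cons.
move=> a b ha hb.
have [w hw e] : joined (above chi (- D)) [set` Y] a b.
  by apply: contrapT => h; apply: noGap; exists a, b.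
have [hw' ew] : walk (above chi 0) (fset_letters X) (a * t) [seq y ^ t | y <- w]
    /\ wprod [seq y ^ t | y <- w] = wprod w ^ t.
  elim: w a {ha e} hw => [|y w IH] a /=.
    by rewrite /above /= charM conj1g => ?; split=> //; lra.
  move=> [ha yY /IH[h1 ->]]; rewrite conjMg; split=> //; split.
  - by move: ha; rewrite /above /= charM; lra.
  - by apply: XE; rewrite mem_cat inE (map_f (fun y => y ^ t)) ?orbT.
  by rewrite -mulgA -conjgC mulgA.
have [||p hp] := @walk_cay_path _ X (above chi 0) (fset_letters X) a
    (t :: [seq y ^ t | y <- w] ++ [:: t^-1]).
- by [].
- split=> //; apply/walk_cat; split=> //; rewrite ew mulJ -e /= mulgK.
  split=> //; last exact: fset_letters_sym.
  by move: hb; rewrite /above /halfspace /= charM; lra.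
exists p; move: hp; rewrite /= wprod_cat ew /= mulg1 (mulgA a) (mulgA (a * t)) mulJ -e mulgK.
exact.
Qed.

Lemma edge_path_cat (K : graph) (A : set (vertex K)) v p q w :
  edge_path A v (p ++ q) w <-> exists2 z, edge_path A v p z & edge_path A z q w.
Proof.
elim: p v => [|e p IH] v /=.
  split=> [h|[z [_ <-]]//]; exists v => //; split=> //.
  by case: q h => [|e q] [].
split=> [[Av ev /IH[z h1 h2]]|[z [Av ev h1] h2]]; first by exists z.
by split=> //; apply/IH; exists z.
Qed.

Section Necessity.
Variables (R : realType) (G H : groupType) (X : gSet G).
Variable chi : character (wreath H X) R.
Local Notation Gamma := (wreath H X).
Local Notation T := (copy_support chi).
Local Notation tp := (in_top H X).
Variable P : finite_presentation Gamma.
Variables (x y : X).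
Hypotheses (Tx : T x) (Ty : T y) (xy : x != y).
Hypothesis Txy : forall z, T z -> z = x \/ z = y.
Hypothesis top0 : ~ char_nonzero (char_top chi).

Local Notation chi1 := (char_copy chi x).
Local Notation chi2 := (char_copy chi y).
Implicit Types (u v : Gamma) (h k : H).

Definition left_coord u := wr_base u x.
Definition right_coord u := wr_base u y.

Lemma chi_coords u : chi u = (chi1 (left_coord u) + chi2 (right_coord u))%R.
Proof.
rewrite /left_coord /right_coord.
elim/wreath_ind: u => [g|z h u _ _ IH].
  rewrite !base_top !char1 addr0; apply: contrapT => h.
  by apply: top0; exists g.
rewrite charM IH !base_mul !base_copy !top_copy !invg1 !gact1 !charM.
suff -> : chi (in_copy z h) = (chi1 (if x == z then h else 1%g) +
    chi2 (if y == z then h else 1%g))%R by rewrite addrACA.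
have [xz|xz] := eqVneq x z.
  by rewrite -xz [y == x]eq_sym (negbTE xy) char1 addr0.
have [yz|yz] := eqVneq y z; first by rewrite -yz char1 add0r.
rewrite !char1 addr0; apply: contrapT => hz.
have Tz : T z by exists h.
by have [e|e] := Txy Tz; [rewrite e eqxx in xz|rewrite e eqxx in yz].
Qed.

Lemma gact_pair (g : G) (z : X) : z = x \/ z = y -> gact g z = x \/ gact g z = y.
Proof. by move=> [->|->]; apply: Txy; apply: copy_support_act. Qed.

(** The top group permutes [x] and [y]; hence along an edge each of the two
    coordinates is multiplied by a coordinate at [x] or [y] of a generator. *)
Definition pair_letters : seq H :=
  let Y := [seq wr_base v z | v <- enum_fset (gens P), z <- [:: x; y]] in
  Y ++ [seq h^-1 | h <- Y].
Local Notation YH := pair_letters.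

Lemma pair_letters_sym : sym_letters [set` YH].
Proof. by move=> h; apply: sym_closure. Qed.

Lemma letter_base (a : letter (gens P)) (z : X) : z = x \/ z = y ->
  wr_base (letter_val a) z \in YH.
Proof.
have gen (v : gens P) z' : z' = x \/ z' = y -> wr_base (fsval v) z' \in YH.
  move=> hz; rewrite mem_cat; apply/orP; left; apply/allpairsP.
  exists (fsval v, z') => /=; split=> //; first exact: fsvalP.
  by rewrite !inE; case: hz => ->; rewrite eqxx ?orbT.
move=> hz; rewrite /letter_val; case: ifP => _; first exact: gen.
by rewrite base_inv; apply: pair_letters_sym; apply: gen; apply: gact_pair.
Qed.

Lemma step_coord u (a : letter (gens P)) (z : X) : z = x \/ z = y ->
  exists2 h, h \in YH & wr_base (u * letter_val a) z = wr_base u z * h.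
Proof.
by move=> hz; rewrite base_mul; eexists; last first; [by []|];
  apply/letter_base/gact_pair.
Qed.

Lemma pair_letters_generate : word_generates [set` YH].
Proof.
move=> h; have -> : h = wr_base (in_copy x h) x by rewrite base_copy eqxx.
move: (in_copy x h) => v; have [w <-] := gensP P v.
have : x = x \/ x = y by left.
move: {1 3 4}x; elim: w => [|a w IH] z hz.
  by rewrite /word_val big_nil base1; apply: spanned1.
rewrite word_val_cons base_mul; apply: spannedM; last exact/IH/gact_pair.
exact/spanned_letter/letter_base.
Qed.

Lemma bounded_letters : exists2 d : R, (0 <= d)%R &
  forall h, h \in YH -> (`|chi1 h| <= d)%R /\ (`|chi2 h| <= d)%R.
Proof.
elim: YH => [|k s [d d0 IH]]; first by exists 0%R.
exists (d + `|chi1 k| + `|chi2 k|)%R; first by rewrite !addr_ge0.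
have n1 := normr_ge0 (chi1 k); have n2 := normr_ge0 (chi2 k).
move=> h; rewrite inE => /orP[/eqP->|/IH[]]; first by split; lra.
by split; lra.
Qed.

(** Along a relator the coordinates move by at most [D] in height. *)
Variable d : R.
Hypothesis d_ge0 : (0 <= d)%R.
Hypothesis d_bound : forall h, h \in YH ->
  (`|chi1 h| <= d)%R /\ (`|chi2 h| <= d)%R.
Variable l : nat.
Hypothesis rels_size : forall r, r \in rels P -> (size r <= l)%N.
Let D : R := (d *+ l.+1)%R.

Variables (b1 b2 : H).
(** [C1] and [C2] are the components of [b1] and [b2] in the lowered half-spaces of
    the two coordinates. *)
Let C1 h := joined (above chi1 (- D)) [set` YH] b1 h.
Let C2 h := joined (above chi2 (- D)) [set` YH] b2 h.
(** On the overlap of [U] and [W] this is the locally constant function of the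
    Mayer-Vietoris argument, and it is extended by zero to the rest of [U]. *)
Let alpha u : bool := `[< C1 (left_coord u) /\ C2 (right_coord u) >].
Let U u : bool := (- D <= chi1 (left_coord u))%R.
Let W u : bool := (- D <= chi2 (right_coord u))%R.

Local Notation K := (CayComplex P).

(** The coboundary of [alpha] on [U], and zero on [W]; the two agree on the
    overlap by [label_right]. *)
Definition label (e : edge K) : bool :=
  if U (origin e) && U (terminus e)
  then alpha (origin e) (+) alpha (terminus e) else false.

Definition labels (p : seq (edge K)) : bool := foldr (fun e c => label e (+) c) false p.

Lemma labels_cat p q : labels (p ++ q) = labels p (+) labels q.
Proof. by elim: p => [|e p IH] //=; rewrite IH addbA. Qed.

Lemma label_rev (e : edge K) : label (rev_edge e) = label e.
Proof.
case: e => v a; rewrite /label /= /cay_terminus /= letter_val_inv mulgK.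
by rewrite andbC addbC.
Qed.

Lemma joined_step (psi : character H R) c b h k :
  k \in YH -> (c <= psi h)%R -> (c <= psi (h * k)%g)%R ->
  joined (above psi c) [set` YH] b h <-> joined (above psi c) [set` YH] b (h * k).
Proof.
have fw h' k' : k' \in YH -> (c <= psi (h' * k')%g)%R ->
    joined (above psi c) [set` YH] b h' ->
    joined (above psi c) [set` YH] b (h' * k').
  move=> kY hc [w hw e]; exists (w ++ [:: k']).
    apply/walk_cat; split=> //; rewrite -e; split=> //.
    by rewrite e; apply: walk_end hw.
  by rewrite wprod_cat /= mulg1 mulgA e.
move=> kY hc hkc; split; first exact: fw.
rewrite -{2}[h](mulgK k); apply: fw; first exact: pair_letters_sym.
by rewrite mulgK.
Qed.

Lemma label_right (e : edge K) : W (origin e) -> W (terminus e) -> label e = false.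
Proof.
case: e => v a; rewrite /label /= /cay_terminus /= => Wv Wva.
case: ifP => // /andP[Uv Uva].
suff -> : alpha (v * letter_val a) = alpha v by rewrite addbb.
have [|h hY e1] := @step_coord v a x; first by left.
have [|k kY e2] := @step_coord v a y; first by right.
move: Wv Wva Uv Uva; rewrite /alpha /W /U /left_coord /right_coord e1 e2.
move=> Wv Wva Uv Uva.
have J1 := @joined_step chi1 _ b1 _ _ hY Uv Uva.
have J2 := @joined_step chi2 _ b2 _ _ kY Wv Wva.
by apply: asbool_equiv_eq; split=> -[j1 j2]; split; by [apply/J1|apply/J2].
Qed.

Lemma letter_height (psi : character H R) (p : X) u (a : letter (gens P)) :
  p = x \/ p = y -> (forall h, h \in YH -> (`|psi h| <= d)%R) ->
  (psi (wr_base u p) - d <= psi (wr_base (u * letter_val a)%g p))%R.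
Proof.
move=> hp hd; have [h hY ->] := @step_coord u a p hp.
by have := hd h hY; rewrite ler_norml charM => /andP[? _]; lra.
Qed.

Let bound1 h : h \in YH -> (`|chi1 h| <= d)%R. Proof. by move/d_bound => []. Qed.
Let bound2 h : h \in YH -> (`|chi2 h| <= d)%R. Proof. by move/d_bound => []. Qed.
Let x_xy : x = x \/ x = y. Proof. by left. Qed.
Let y_xy : y = x \/ y = y. Proof. by right. Qed.

Lemma labels_left u (r : word (gens P)) :
  (- D + d *+ size r <= chi1 (left_coord u))%R ->
  labels (word_path u r) = alpha u (+) alpha (u * word_val r).
Proof.
have d0 := d_ge0.
elim: r u => [|a r IH] u; first by rewrite /word_val big_nil mulg1 addbb.
rewrite [size _]/= mulrS word_val_cons mulgA => hu.
have hs := letter_height u a x_xy bound1.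
have h1 : (- D + d *+ size r <= chi1 (left_coord (u * letter_val a)%g))%R.
  by move: hs; rewrite -/(left_coord _) -/(left_coord u); lra.
have dr : (0 <= d *+ size r)%R by apply: mulrn_wge0.
rewrite [labels _]/= -/(labels _) IH // /label /= /cay_terminus /= /U.
have -> : (- D <= chi1 (left_coord u))%R by lra.
have -> : (- D <= chi1 (left_coord (u * letter_val a)%g))%R by lra.
by rewrite /= -addbA addKb.
Qed.

Lemma labels_right u (r : word (gens P)) :
  (- D + d *+ size r <= chi2 (right_coord u))%R ->
  labels (word_path u r) = false.
Proof.
have d0 := d_ge0.
elim: r u => [|a r IH] u //.
rewrite [size _]/= mulrS => hu.
have hs := letter_height u a y_xy bound2.
have h1 : (- D + d *+ size r <= chi2 (right_coord (u * letter_val a)%g))%R.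
  by move: hs; rewrite -/(right_coord _) -/(right_coord u); lra.
have dr : (0 <= d *+ size r)%R by apply: mulrn_wge0.
rewrite [labels _]/= -/(labels _) IH // label_right ?addbF //= /cay_terminus /W /=.
  by lra.
by lra.
Qed.

(** A relator based in the half-space stays in [U] or in [W], because one of the two
    coordinates of its base point has a non-negative height. *)
Lemma labels_relator u r : r \in rels P -> (0 <= chi u)%R ->
  labels (word_path u r) = false.
Proof.
move=> rP; have d0 := d_ge0.
have r1 : word_val r = 1 by apply/relsP; apply: normal_closure_rel.
have dr : (d *+ size r <= D)%R.
  rewrite /D -[(d *+ size r)%R]mulr_natr -[(d *+ l.+1)%R]mulr_natr.
  by apply: ler_wpM2l => //; rewrite ler_nat; apply: leqW; apply: rels_size.
rewrite chi_coords => hu.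
have [h|h] := lerP 0%R (chi1 (left_coord u)).
  by rewrite labels_left; [rewrite r1 mulg1 addbb|lra].
by apply: labels_right; lra.
Qed.

Lemma labels_homotopic v w p q :
  @homotopic K (halfspace chi) v w p q -> labels p = labels q.
Proof.
elim=> {p q} [//|p q _ ->//|p q r _ -> _ ->//|p q e _|p q [u [r rP]] h].
  have -> : labels (p ++ [:: e; rev_edge e] ++ q) =
      labels p (+) ((label e (+) (label (rev_edge e) (+) false)) (+) labels q).
    by rewrite !labels_cat.
  by rewrite label_rev addbF addbb addFb labels_cat.
rewrite !labels_cat (_ : labels (boundary _) = false) ?addFb //.
rewrite /= /cay_boundary /=; move: h; rewrite /= /cay_boundary /=.
case: r rP => [|a r] rP //= /edge_path_cat[z _ /= [hz e _]].
apply: (labels_relator rP).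
by rewrite [u]e.
Qed.

Lemma short_path u (r : word (gens P)) : (d *+ size r *+ 2 <= chi u)%R ->
  @edge_path K (halfspace chi) u (word_path u r) (u * word_val r).
Proof.
have d0 := d_ge0.
elim: r u => [|a r IH] u.
  by rewrite /word_val big_nil mulg1 mulr0n mul0rn.
rewrite [size _]/= mulrS word_val_cons mulgA => hu.
have dr : (0 <= d *+ size r)%R by apply: mulrn_wge0.
have hs1 := letter_height u a x_xy bound1.
have hs2 := letter_height u a y_xy bound2.
split=> //; first by rewrite /halfspace /=; lra.
apply: IH; rewrite /= /cay_terminus /=; move: hu hs1 hs2; rewrite !chi_coords.
by rewrite -/(left_coord _) -/(right_coord _) -/(left_coord u) -/(right_coord u); lra.
Qed.

Definition link (f : Gamma -> Gamma -> bool) u v :=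
  exists2 p, @edge_path K (halfspace chi) u p v & labels p = f u v.

Definition link_right := link (fun _ _ => false).
Definition link_left := link (fun u v => alpha u (+) alpha v).

Lemma link_right_trans v u w : link_right u v -> link_right v w -> link_right u w.
Proof.
move=> [p hp ep] [q hq eq]; exists (p ++ q); last by rewrite labels_cat ep eq.
by apply/edge_path_cat; exists v.
Qed.

Lemma link_left_trans v u w : link_left u v -> link_left v w -> link_left u w.
Proof.
move=> [p hp ep] [q hq eq]; exists (p ++ q).
  by apply/edge_path_cat; exists v.
by rewrite labels_cat ep eq -addbA addKb.
Qed.

Definition pair_point h k : Gamma := in_copy x h * in_copy y k.

Lemma left_pair h k : left_coord (pair_point h k) = h.
Proof.
rewrite /left_coord base_mul !base_copy eqxx top_copy invg1 gact1.
by rewrite (negbTE xy) mulg1.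
Qed.

Lemma right_pair h k : right_coord (pair_point h k) = k.
Proof.
rewrite /right_coord base_mul !base_copy top_copy invg1 gact1 eqxx.
by rewrite eq_sym (negbTE xy) mul1g.
Qed.

Lemma pair_mul_left h k h' : pair_point h k * in_copy x h' = pair_point (h * h') k.
Proof.
rewrite /pair_point in_copyM -!mulgA; congr (_ * _).
by apply: commute_copy; rewrite eq_sym.
Qed.

Lemma pair_mul_right h k k' : pair_point h k * in_copy y k' = pair_point h (k * k').
Proof. by rewrite /pair_point in_copyM mulgA. Qed.

(** The powers of [t] raise the end points without making the steps longer: the
    path goes down to [a], over to [b], and up again. *)
Lemma travel (psi : character H R) (Q : H -> H -> Prop) (t a b : H) (n : nat) :
  (forall h k k', Q h k -> Q k k' -> Q h k') ->
  (forall h k, (0 <= psi h)%R -> k \in [:: 1; t; t^-1; a^-1 * b] -> Q h (h * k)) ->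
  (0 <= psi t)%R -> (0 <= psi a)%R -> (0 <= psi b)%R ->
  Q (a * t ^+ n) (b * t ^+ n).
Proof.
move=> Qtrans Qhop t0 a0 b0.
have pos h m : (0 <= psi h)%R -> (0 <= psi (h * t ^+ m)%g)%R.
  by move=> h0; rewrite charM charX addr_ge0 // mulrn_wge0.
have up h m : (0 <= psi h)%R -> Q h (h * t ^+ m).
  move=> h0; elim: m => [|m IH].
    by rewrite expg0; apply: Qhop; rewrite ?mem_head.
  apply: Qtrans IH _; rewrite expgSr mulgA; apply: Qhop; first exact: pos.
  by rewrite !inE eqxx orbT.
have down h m : (0 <= psi h)%R -> Q (h * t ^+ m) h.
  move=> h0; elim: m => [|m IH].
    by rewrite expg0 mulg1 -{2}[h]mulg1; apply: Qhop; rewrite ?mem_head.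
  apply: Qtrans _ IH.
  have := Qhop (h * t ^+ m.+1) t^-1 (pos _ _ h0).
  by rewrite expgSr mulgA mulgK; apply; rewrite !inE eqxx !orbT.
apply: (Qtrans _ _ _ (down a n a0)); apply: (Qtrans _ b); last exact: up.
by have := Qhop a (a^-1 * b) a0; rewrite mulVKg; apply; rewrite !inE eqxx !orbT.
Qed.

Lemma positive_letter (psi : character H R) : char_nonzero psi ->
  exists2 t, t \in YH & (0 < psi t)%R.
Proof.
move=> [h hh]; apply: contrapT => no; apply: hh.
have zero k : k \in YH -> psi k = 0%R.
  move=> kY; have [k0|k0|//] := ltgtP 0%R (psi k); first by case: no; exists k.
  case: no; exists k^-1; first exact: pair_letters_sym.
  by rewrite charV oppr_gt0.
have [w hw <-] := pair_letters_generate h.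
elim: w hw => [|k w IH] /=; first by rewrite char1.
by move=> [_ /zero k0 /walk_move/IH w0]; rewrite charM k0 w0 addr0.
Qed.

Lemma short_words (s : seq Gamma) : exists (wd : Gamma -> word (gens P)) (N : R),
  [/\ forall v, word_val (wd v) = v, (0 <= N)%R &
      forall v, v \in s -> (d *+ size (wd v) *+ 2 <= N)%R].
Proof.
have /choice[wd wdP] : forall v, exists w : word (gens P), word_val w = v.
  exact: gensP.
exists wd; suff [N N0 hN] : exists2 N : R, (0 <= N)%R &
    forall v, v \in s -> (d *+ size (wd v) *+ 2 <= N)%R by exists N.
elim: s => [|v s [N N0 IH]]; first by exists 0%R.
exists (Num.max N (d *+ size (wd v) *+ 2))%R; first by rewrite le_max N0.
move=> v'; rewrite inE le_max => /orP[/eqP->|/IH->//].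
by rewrite lexx orbT.
Qed.

(** The rectangle with corners [(A1, A2)], [(B1, A2)], [(B1, B2)] and [(A1, B2)].
    While one coordinate moves, the other one is constant and high enough to keep
    the path in the half-space.  The sides along the first coordinate lie in [W]
    and have label zero; of the other two sides only the one at [B1] joins vertices
    with different values of [alpha]. *)
Theorem halfspace_not_simply_connected (a1 a2 : H) :
  (0 <= chi1 a1)%R -> (0 <= chi1 b1)%R -> ~ C1 a1 ->
  (0 <= chi2 a2)%R -> (0 <= chi2 b2)%R -> ~ C2 a2 ->
  ~ @simply_connected_on K (halfspace chi).
Proof.
move=> a10 b10 nC1 a20 b20 nC2 sconn.
have [t1 t1Y t1pos] := positive_letter Tx.
have [t2 t2Y t2pos] := positive_letter Ty.
(* The steps of [travel]; their words have bounded length, so that [N] does not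
   depend on the exponents [n1] and [n2]. *)
pose hops t a b : seq H := [:: 1; t; t^-1; a^-1 * b].
have subl (s s' : seq H) : {subset s <= s ++ s'} by move=> h hs; rewrite mem_cat hs.
have subr (s s' : seq H) : {subset s' <= s ++ s'}.
  by move=> h hs; rewrite mem_cat hs orbT.
pose hops1 := hops t1 a1 b1 ++ hops t1 b1 a1.
pose hops2 := hops t2 a2 b2 ++ hops t2 b2 a2.
have l1 : {subset hops t1 a1 b1 <= hops1} by apply: subl.
have r1 : {subset hops t1 b1 a1 <= hops1} by apply: subr.
have l2 : {subset hops t2 a2 b2 <= hops2} by apply: subl.
have r2 : {subset hops t2 b2 a2 <= hops2} by apply: subr.
clearbody hops1 hops2.
have [wd [N [wdP N0 hN]]] := short_words
  ([seq in_copy x h | h <- hops1] ++ [seq in_copy y h | h <- hops2]).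
have d0 := d_ge0; have D0 : (0 <= D)%R by apply: mulrn_wge0.
have hop_right h k h' : (0 <= chi1 h)%R -> (N <= chi2 k)%R -> h' \in hops1 ->
    link_right (pair_point h k) (pair_point (h * h') k).
  move=> h0 kN h'in; have le : (d *+ size (wd (in_copy x h')) *+ 2 <= N)%R.
    by apply: hN; rewrite mem_cat map_f.
  have le0 : (0 <= d *+ size (wd (in_copy x h')))%R by apply: mulrn_wge0.
  exists (word_path (pair_point h k) (wd (in_copy x h'))).
    rewrite -pair_mul_left -{2}(wdP (in_copy x h')); apply: short_path.
    by rewrite chi_coords left_pair right_pair; lra.
  by apply: labels_right; rewrite right_pair; lra.
have hop_left h k k' : (N <= chi1 h)%R -> (0 <= chi2 k)%R -> k' \in hops2 ->
    link_left (pair_point h k) (pair_point h (k * k')).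
  move=> hN' k0 k'in; have le : (d *+ size (wd (in_copy y k')) *+ 2 <= N)%R.
    by apply: hN; rewrite mem_cat (map_f (in_copy y)) ?orbT.
  have le0 : (0 <= d *+ size (wd (in_copy y k')))%R by apply: mulrn_wge0.
  rewrite -pair_mul_right -{1}(wdP (in_copy y k')).
  exists (word_path (pair_point h k) (wd (in_copy y k'))).
    apply: short_path; by rewrite chi_coords left_pair right_pair; lra.
  by apply: labels_left; rewrite left_pair; lra.
have [n1 hn1] := power_above N t1pos; have [n2 hn2] := power_above N t2pos.
pose A1 := a1 * t1 ^+ n1; pose B1 := b1 * t1 ^+ n1.
pose A2 := a2 * t2 ^+ n2; pose B2 := b2 * t2 ^+ n2.
have right a b k : (0 <= chi1 a)%R -> (0 <= chi1 b)%R -> (N <= chi2 k)%R ->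
    {subset hops t1 a b <= hops1} ->
    link_right (pair_point (a * t1 ^+ n1) k) (pair_point (b * t1 ^+ n1) k).
  move=> ha hb hk sub.
  apply: (@travel chi1 (fun h h' => link_right (pair_point h k) (pair_point h' k))
    t1 a b n1) => //; last exact: ltW.
    by move=> h h' h''; apply: link_right_trans.
  by move=> h h' h0 h'in; apply: hop_right => //; apply: sub.
have left a b h : (0 <= chi2 a)%R -> (0 <= chi2 b)%R -> (N <= chi1 h)%R ->
    {subset hops t2 a b <= hops2} ->
    link_left (pair_point h (a * t2 ^+ n2)) (pair_point h (b * t2 ^+ n2)).
  move=> ha hb hh sub.
  apply: (@travel chi2 (fun k k' => link_left (pair_point h k) (pair_point h k'))
    t2 a b n2) => //; last exact: ltW.
    by move=> k k' k''; apply: link_left_trans.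
  by move=> k k' k0 k'in; apply: hop_left => //; apply: sub.
have A1N : (N <= chi1 A1)%R by rewrite charM; lra.
have B1N : (N <= chi1 B1)%R by rewrite charM; lra.
have A2N : (N <= chi2 A2)%R by rewrite charM; lra.
have B2N : (N <= chi2 B2)%R by rewrite charM; lra.
have [p1 hp1 e1] := right a1 b1 A2 a10 b10 A2N l1.
have [p2 hp2 e2] := left a2 b2 B1 a20 b20 B1N l2.
have [p3 hp3 e3] := right b1 a1 B2 b10 a10 B2N r1.
have [p4 hp4 e4] := left b2 a2 A1 b20 a20 A1N r2.
have loop : @edge_path K (halfspace chi) (pair_point A1 A2)
    (p1 ++ p2 ++ p3 ++ p4) (pair_point A1 A2).
  apply/edge_path_cat; exists (pair_point B1 A2) => //.
  apply/edge_path_cat; exists (pair_point B1 B2) => //.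
  by apply/edge_path_cat; exists (pair_point A1 B2).
have := labels_homotopic (sconn _ _ loop).
rewrite !labels_cat e1 e2 e3 e4 [labels [::]]/= !addFb.
have high (psi : character H R) t a n : (0 < psi t)%R -> (0 <= psi a)%R ->
    (- D <= psi (a * t ^+ n)%g)%R.
  by move=> tpos a0; rewrite charM charX; have := mulrn_wge0 n (ltW tpos); lra.
have climb1 (psi : character H R) t a b n : t \in YH -> (0 < psi t)%R ->
    (0 <= psi a)%R -> joined (above psi (- D)) [set` YH] b (a * t ^+ n) <->
    joined (above psi (- D)) [set` YH] b (a * t ^+ n.+1).
  move=> tY tpos a0; rewrite expgSr mulgA; apply: joined_step => //; first exact: high.
  by rewrite -mulgA -expgSr; apply: high.
have climb (psi : character H R) t b n : t \in YH -> (0 < psi t)%R ->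
    (0 <= psi b)%R -> joined (above psi (- D)) [set` YH] b (b * t ^+ n).
  move=> tY tpos b0; elim: n => [|n IH]; last exact: (iffLR (climb1 _ _ _ _ _ _ _ _) IH).
  by exists [::]; rewrite /= ?expg0 //; rewrite /above /=; lra.
have fall (psi : character H R) t a b n : t \in YH -> (0 < psi t)%R ->
    (0 <= psi a)%R -> joined (above psi (- D)) [set` YH] b (a * t ^+ n) ->
    joined (above psi (- D)) [set` YH] b a.
  move=> tY tpos a0; elim: n => [|n IH]; first by rewrite expg0 mulg1.
  by move=> j; apply: IH; apply: (iffRL (climb1 _ _ _ _ _ tY tpos a0) j).
have aA1 k : alpha (pair_point A1 k) = false.
  by apply/asboolPn; rewrite left_pair => -[/fall j _]; apply: nC1; apply: j.
have aA2 h : alpha (pair_point h A2) = false.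
  by apply/asboolPn; rewrite right_pair => -[_ /fall j]; apply: nC2; apply: j.
have aB : alpha (pair_point B1 B2) = true.
  by apply/asboolP; rewrite left_pair right_pair; split; apply: climb.
by rewrite !aA1 aA2 aB.
Qed.

End Necessity.

Lemma max_size (T : Type) (s : seq (seq T)) :
  exists l, all (fun r => size r <= l)%N s.
Proof.
elim: s => [|r s [l hl]]; first by exists 0.
exists (maxn (size r) l); rewrite /= leq_maxl /=.
by apply: sub_all hl => r' h; rewrite leq_max h orbT.
Qed.

Local Open Scope card_scope.

Theorem theorem6p5 (R : realType) (G H : groupType) (X : gSet G)
    (chi : character (wreath H X) R)
    (Gamma_fp : finitely_presented (wreath H X))
    (H_nontrivial : exists h : H, h <> 1%g)
    (X_nonempty : inhabited X)
    (T_ge2 : `I_2 #<= copy_support chi) :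
  Sigma2 (char_class chi) <->
  [\/ exists2 x : X, copy_support chi x &
        Sigma1 (char_class (char_copy chi x)),
      char_nonzero (char_top chi)
    | `I_3 #<= copy_support chi].
Proof.
have [P] := Gamma_fp.
have [s [ss us sT]] := card_ge_uniq T_ge2.
case: s ss us sT => [|x [|y []]] //= _; rewrite inE andbT => xy sT.
have Tx : copy_support chi x by apply: sT; rewrite /= inE eqxx.
have Ty : copy_support chi y by apply: sT; rewrite /= !inE eqxx orbT.
have three z : copy_support chi z -> z != x -> z != y -> uniq [:: x; y; z].
  by move=> Tz zx zy; rewrite /= !inE negb_or xy ![_ == z]eq_sym zx zy.
have [card3|card2] := boolP (`I_3 #<= copy_support chi).
  split=> [_|_]; first exact: Or33.
  have [s [ss us sT3]] := card_ge_uniq card3.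
  case: s ss us sT3 => [|p [|q [|r []]]] //= _ us sT3.
  by apply: (Sigma2_of_three P (x := p) (y := q) (z := r)) => //;
    apply: sT3; rewrite /= !inE eqxx ?orbT.
have Txy z : copy_support chi z -> z = x \/ z = y.
  move=> Tz; have [->|zx] := eqVneq z x; first by left.
  have [->|zy] := eqVneq z y; first by right.
  case/negP: card2; apply: (@uniq_card_ge _ _ _ [:: x; y; z]) => //.
    exact: three.
  by move=> z' /=; rewrite !inE => /or3P[] /eqP->.
split=> [[psi [_ [Q [_ sconn]]] e]|[[z Tz S1]|top|//]]; last 2 first.
- have [zx|zy] := Txy z Tz; first by rewrite zx in S1; apply: (Sigma2_of_Sigma1 P Tx Ty xy S1).
  by rewrite zy in S1; apply: (Sigma2_of_Sigma1 P Ty Tx _ S1); rewrite eq_sym.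
- exact: (Sigma2_of_top P Tx Ty xy Txy top).
rewrite (halfspace_class e) in sconn.
apply: contrapT => none.
have top0 : ~ char_nonzero (char_top chi) by move=> top; apply: none; apply: Or32.
have nS z : copy_support chi z -> ~ Sigma1 (char_class (char_copy chi z)).
  by move=> Tz S1; apply: none; apply: Or31; exists z.
have [d d0 hd] := bounded_letters chi Q x y.
have [l /allP hl] := max_size (rels Q).
have gen := pair_letters_generate Q Tx Ty Txy.
have [b1 [a1 [b10 a10 nj1]]] := Sigma1_gap (d *+ l.+1)%R gen Tx (nS x Tx).
have [b2 [a2 [b20 a20 nj2]]] := Sigma1_gap (d *+ l.+1)%R gen Ty (nS y Ty).
exact: (halfspace_not_simply_connected Tx Ty xy Txy top0 d0 hd hl a10 b10 nj1 a20 b20 nj2 sconn).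
Qed.
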